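(* Let $n\ge1$, $\alpha\in(\mathbb{N}\cup\{0\})^n$, let $x^0\in\mathbb{G}^{n+1}_\alpha$ be a Riemannian point and let $x(t)$ be the non-trivial arc-length geodesic starting at $x^0$ with initial covector $p^0(\phi)$, $\phi\in\mathcal{R}^0_\alpha$. Then its cut time satisfies $0\le t_{\operatorname{cut}}\le\tau$, where $\tau:=\min_{j\in J}\tau_j(\phi)$; i.e. the geodesic is not length minimizing past $t=\tau$.
   Context: Grushin space: for $n\ge1$ and $\alpha\in(\mathbb{N}\cup\{0\})^n$, $\mathbb{G}^{n+1}_\alpha$ is $\mathbb{R}^{n+1}$ with the sub-Riemannian structure generated by $X_j=\xi_j\partial_{x_j}$, $j=1,\dots,n+1$, $\xi_j(x)=\prod_{i=1}^{j-1}x_i^{\alpha_i}$, with its Carnot–Carathéodory distance. $H(x,p)=\tfrac12\sum_j\xi_j(x)^2p_j^2$; a geodesic with initial point $x^0$ and covector $p^0$ is the projection of the solution of Hamilton's equations $x_j'=\xi_j^2p_j$, $p_j'=-\partial H/\partial x_j$ with $x(0)=x^0$, $p(0)=p^0$. Cut time: $t_{\operatorname{cut}}=\sup\{t>0: x|_{[0,t]}\text{ is length minimizing}\}$. $J:=\{j:\alpha_j\neq0\}$; $x^0$ Riemannian means $x^0_j\neq0$ for $j\in J$. For real $a\ge1$: $\pi_a=2\int_0^1(1-t^{2a})^{-1/2}dt$; $\sin_a$ is the inverse of $s\mapsto\int_0^s(1-t^{2a})^{-1/2}dt$ on $[0,\pi_a/2]$, extended by $\sin_a(s)=\sin_a(\pi_a-s)$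 on $[0,\pi_a]$, oddly and $2\pi_a$-periodically; $\cos_a=\sin_a'$; $\rho_\theta(s)=|s|^{\theta-1}s$. Spherical coordinates: $\tilde\alpha_j=\alpha_j$ ($j\in J$), $=1$ otherwise; $\tilde x^0_j=x^0_j$ ($j\in J$), $=1$ otherwise; for $\phi\in\mathcal{R}_\alpha=\prod_{j\le n-1}[0,\pi_{\tilde\alpha_j}]\times[0,2\pi_{\tilde\alpha_n})$, $\delta_j=\rho_{\tilde\alpha_j}(\sin_{\tilde\alpha_j}(\phi_j)/\tilde x^0_j)$, $p^0_j(\phi)=\cos_{\tilde\alpha_j}(\phi_j)\prod_{i<j}\delta_i$ ($j\le n$), $p^0_{n+1}=\prod_{i\le n}\delta_i$. $\mathcal{R}^0_\alpha=\{\phi:\sin_{\tilde\alpha_j}(\phi_j)\neq0\ \forall j\}$ (covectors of non-trivial geodesics). For $j\in J$: $\omega_j=\frac{\sin_{\alpha_j}(\phi_j)}{x^0_j}\prod_{i<j}\delta_i$ and $\tau_j(\phi)=\min\{t>0:|\omega_j|\int_0^t\xi_j(x(s))^2ds=\pi_{\alpha_j}\}$. *)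

(* Defs.v *)
From HB Require Import structures.
From mathcomp Require Import all_boot all_order all_algebra.
From mathcomp Require Import all_classical all_reals all_analysis.
Set Implicit Arguments. Unset Strict Implicit. Unset Printing Implicit Defensive.
Import Order.TTheory GRing.Theory Num.Theory.
Import numFieldNormedType.Exports.
Local Open Scope classical_set_scope.
Local Open Scope ring_scope.

Section Grushin.
Variable R : realType.
Notation mu := (@lebesgue_measure R).

Definition gtrig_integrand (a : nat) (t : R) : R := (Num.sqrt (1 - t ^+ (2 * a)))^-1.

Definition arcsin_a (a : nat) (s : R) : R := Rintegral mu `[(0:R), s] (gtrig_integrand a).

Definition pi_a (a : nat) : R := 2 * Rintegral mu `[(0:R), 1] (gtrig_integrand a).

Definition sin_a_base (a : nat) (s : R) : R :=
  xget 0 [set y : R | 0 <= y <= 1 /\ arcsin_a a y = s].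

Definition sin_a_half (a : nat) (r : R) : R :=
  if r <= pi_a a / 2 then sin_a_base a r else sin_a_base a (pi_a a - r).

(* odd and 2 pi_a-periodic extension to all of R *)
Definition sin_a (a : nat) (s : R) : R :=
  let P := 2 * pi_a a in
  let r := s - P * (Num.floor ((s + pi_a a) / P))%:~R in   (* r in [-pi_a, pi_a) *)
  if 0 <= r then sin_a_half a r else - sin_a_half a (- r).

Definition cos_a (a : nat) (s : R) : R := derive1 (sin_a a) s.

Definition rho (theta : nat) (s : R) : R := `|s| ^+ (theta - 1) * s.

(* coordinates x_1..x_(n+1) are indexed by 'I_n.+1 (x_j <-> index j-1);
   alpha_1..alpha_n are indexed by 'I_n. *)
Variable n : nat.
Definition wid (i : 'I_n) : 'I_n.+1 := widen_ord (leqnSn n) i.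

Definition xi (alpha : 'I_n -> nat) (x : 'I_n.+1 -> R) (j : 'I_n.+1) : R :=
  \prod_(i < n | (i < j)%N) x (wid i) ^+ alpha i.

Definition Ham (alpha : 'I_n -> nat) (x p : 'I_n.+1 -> R) : R :=
  2^-1 * \sum_(j < n.+1) xi alpha x j ^+ 2 * p j ^+ 2.

Definition upd (x : 'I_n.+1 -> R) (j : 'I_n.+1) (s : R) : 'I_n.+1 -> R :=
  fun k => if k == j then s else x k.

Definition dHdx (alpha : 'I_n -> nat) (x p : 'I_n.+1 -> R) (j : 'I_n.+1) : R :=
  derive1 (fun s => Ham alpha (upd x j s) p) (x j).

Definition hamilton_solution (alpha : 'I_n -> nat) (x p : R -> 'I_n.+1 -> R) : Prop :=
  forall (t : R) (j : 'I_n.+1),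
    is_derive t 1 (fun s => x s j) (xi alpha (x t) j ^+ 2 * p t j) /\
    is_derive t 1 (fun s => p s j) (- dHdx alpha (x t) (p t) j).

Definition unorm (v : 'I_n.+1 -> R) : R := Num.sqrt (\sum_(j < n.+1) v j ^+ 2).

(* gamma : [0,1] -> R^(n+1) is horizontal with L^1 control u:
   gamma' = sum_j u_j X_j(gamma), X_j = xi_j d/dx_j, in integrated form *)
Definition admissible (alpha : 'I_n -> nat) (gamma u : R -> 'I_n.+1 -> R) : Prop :=
  (forall j, measurable_fun `[(0:R), 1] (fun s => u s j)) /\
  mu.-integrable `[(0:R), 1] (EFin \o (fun s => unorm (u s))) /\
  (forall j, mu.-integrable `[(0:R), 1] (EFin \o (fun s => u s j * xi alpha (gamma s) j))) /\
  (forall j (t : R), 0 <= t <= 1 ->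
     gamma t j = gamma 0 j + Rintegral mu `[(0:R), t] (fun s => u s j * xi alpha (gamma s) j)).

Definition cc_dist (alpha : 'I_n -> nat) (y z : 'I_n.+1 -> R) : \bar R :=
  ereal_inf [set (Rintegral mu `[(0:R), 1] (fun s => unorm (u s)))%:E |
     u in [set u | exists gamma, admissible alpha gamma u /\ gamma 0 = y /\ gamma 1 = z]].

Definition curve_length (d : ('I_n.+1 -> R) -> ('I_n.+1 -> R) -> \bar R)
    (c : R -> 'I_n.+1 -> R) (a b : R) : \bar R :=
  ereal_sup [set e : \bar R | exists (k : nat) (s : nat -> R),
     [/\ s 0%N = a, s k = b, (forall i, (i < k)%N -> s i <= s i.+1) &
         e = (\sum_(i < k) d (c (s i)) (c (s i.+1)))%E]].

Definition minimizing (alpha : 'I_n -> nat) (x : R -> 'I_n.+1 -> R) (t : R) : Prop :=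
  curve_length (cc_dist alpha) x 0 t = cc_dist alpha (x 0) (x t).

Definition t_cut (alpha : 'I_n -> nat) (x : R -> 'I_n.+1 -> R) : \bar R :=
  ereal_sup [set t%:E | t in [set t : R | 0 < t /\ minimizing alpha x t]].

Definition inJ (alpha : 'I_n -> nat) (j : 'I_n) : bool := alpha j != 0%N.

Definition riemannian (alpha : 'I_n -> nat) (x0 : 'I_n.+1 -> R) : Prop :=
  forall j : 'I_n, inJ alpha j -> x0 (wid j) != 0.

Definition atil (alpha : 'I_n -> nat) (j : 'I_n) : nat :=
  if inJ alpha j then alpha j else 1%N.
Definition xtil (alpha : 'I_n -> nat) (x0 : 'I_n.+1 -> R) (j : 'I_n) : R :=
  if inJ alpha j then x0 (wid j) else 1.

Definition delta (alpha : 'I_n -> nat) (x0 : 'I_n.+1 -> R) (phi : 'I_n -> R) (j : 'I_n) : R :=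
  rho (atil alpha j) (sin_a (atil alpha j) (phi j) / xtil alpha x0 j).

Definition in_R_alpha (alpha : 'I_n -> nat) (phi : 'I_n -> R) : Prop :=
  forall j : 'I_n,
    if (j.+1 < n)%N then 0 <= phi j <= pi_a (atil alpha j)
    else 0 <= phi j < 2 * pi_a (atil alpha j).

Definition in_R0_alpha (alpha : 'I_n -> nat) (phi : 'I_n -> R) : Prop :=
  in_R_alpha alpha phi /\ forall j : 'I_n, sin_a (atil alpha j) (phi j) != 0.

Definition p0 (alpha : 'I_n -> nat) (x0 : 'I_n.+1 -> R) (phi : 'I_n -> R) : 'I_n.+1 -> R :=
  fun j => match unlift ord_max j with
           | Some k => cos_a (atil alpha k) (phi k) *
                       \prod_(i < n | (i < k)%N) delta alpha x0 phi i
           | None => \prod_(i < n) delta alpha x0 phi i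
           end.

Definition omega (alpha : 'I_n -> nat) (x0 : 'I_n.+1 -> R) (phi : 'I_n -> R) (j : 'I_n) : R :=
  sin_a (alpha j) (phi j) / x0 (wid j) * \prod_(i < n | (i < j)%N) delta alpha x0 phi i.

(* tau_j(phi) = min {t > 0 : |omega_j| int_0^t xi_j(x(s))^2 ds = pi_{alpha_j}}
   (as an extended real; +oo if the set is empty) *)
Definition tau_j (alpha : 'I_n -> nat) (x0 : 'I_n.+1 -> R) (phi : 'I_n -> R)
    (x : R -> 'I_n.+1 -> R) (j : 'I_n) : \bar R :=
  ereal_inf [set t%:E | t in [set t : R | 0 < t /\
     `|omega alpha x0 phi j| * Rintegral mu `[(0:R), t] (fun s => xi alpha (x s) (wid j) ^+ 2)
       = pi_a (alpha j)]].

Definition tau (alpha : 'I_n -> nat) (x0 : 'I_n.+1 -> R) (phi : 'I_n -> R)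
    (x : R -> 'I_n.+1 -> R) : \bar R :=
  ereal_inf [set tau_j alpha x0 phi x j | j in [set j : 'I_n | inJ alpha j]].

End Grushin.

(* Main.v *)
Require Import Defs.
From HB Require Import structures.
From mathcomp Require Import all_boot all_order all_algebra.
From mathcomp Require Import all_classical all_reals all_analysis.
From mathcomp Require Import measurable_realfun ring lra.
Import Order.TTheory GRing.Theory Num.Theory.
Import numFieldNormedType.Exports.
Set Implicit Arguments. Unset Strict Implicit. Unset Printing Implicit Defensive.
Local Open Scope classical_set_scope.
Local Open Scope ring_scope.

(** Write [H] as a nest of one-dimensional problems: with [e_k] the conserved energy of the
    coordinates from [k] on, [e_k = p_k^2 + x_k^(2 alpha_k) e_(k+1)], and in the clock
    [s_j = int xi_j^2] the coordinate [x_j] solves [z'' = - alpha_j e_(j+1) z^(2 alpha_j - 1)].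
    Every solution of this oscillator changes sign after the half period [pi_(alpha_j) / |omega_j|].
    Hence reversing [x_j] in its clock over half a period and changing its sign gives, after
    reparametrizing the later coordinates, another curve of the same length with the same
    endpoints.  When more than half a period is available, [x_j] can rest for a while at an
    extreme value, where the motion of the later coordinates is cheapest, before the reflected
    piece starts; this saves length.  If [x_j] starts by moving away from 0, the same is done
    backwards in time, and if it starts at a turning point, after a small shift.

    To compare with the metric length, and to have [t_cut >= 0], geodesics must be shown to be
    locally minimizing at Riemannian points.  This uses a local subsolution of the eikonal
    equation that is exact along the geodesic.  It is built from the last coordinate down to the
    first: at each level the subsolution of the next level serves as a time, and the corrector
    is quadratic in the distance to the geodesic, so turning points need no special treatment. *)

(** * Epsilon-delta calculus and real induction *)

Section RealAnalysis.
Variable R : realType.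
Implicit Types (f g : R -> R) (a b t : R).

(** The difficulty lies in the clocks: the derivative [xi_j ^ 2] vanishes whenever an earlier
    coordinate with positive exponent does, so the inverse function theorem cannot differentiate the
    reparametrized coordinates. Such zeros are transversal, hence isolated in time; a clock is still
    strictly increasing, and a function whose derivative has that of the clock as a factor can be
    differentiated through it ([is_derive_clock]).

    Length is metric here, a supremum of sums of distances. Minimality at a time [T] beyond half a
    period would give [T <= length = distance <= L < T], with [L] bounding the competitor. The first
    inequality needs calibrations at all times but the isolated singular ones, which monotonicity of
    the length bridges.

    The saving is explicit: while [x_j] rests at its initial value, the squared speed drops by at
    least [xi_j ^ 2 p_j(0) ^ 2]; no regularity theory is invoked for the corners of the reflected
    curve. The half period is read off the phase [asin_odd (x_j / A_j)]; [sin_a] and [cos_a] enter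
    only through the initial data, where [|omega_j| = sqrt e_j / A_j] with
    [A_j = |x_j(0) / sin_a phi_j|]. *)

Lemma continuous_epsP f t : {for t, continuous f} <->
  forall e : R, 0 < e -> exists2 d : R, 0 < d & forall r : R, `|r - t| < d -> `|f r - f t| < e.
Proof.
split.
- move=> /cvgrPdist_lt H e e0; have /nbhs_ballP[d /= d0 Hd] := H e e0.
  exists d => // r rt; rewrite distrC; apply: Hd.
  by rewrite /ball /= distrC.
- move=> H; apply/cvgrPdist_lt => e e0; have [d d0 Hd] := H e e0.
  apply/nbhs_ballP; exists d => //= r; rewrite /ball /= => rt.
  by rewrite distrC; apply: Hd; rewrite distrC.
Qed.

(** The difference quotient is cleared of its denominator, so that [r = t] is no exception and
    errors can be added directly. *)
Lemma is_derive_epsP f t (l : R) : is_derive t 1 f l <->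
  forall e : R, 0 < e -> exists2 d : R, 0 < d &
    forall r : R, `|r - t| < d -> `|f r - f t - l * (r - t)| <= e * `|r - t|.
Proof.
split.
- move=> H e e0.
  have : (fun h => h^-1 *: ((f \o shift t) (h *: 1) - f t)) @ 0^' --> l.
    by case: H => + <-; exact.
  move/cvgrPdist_le => /(_ e e0) /nbhs_ballP[d /= d0 Hd].
  exists d => // r rt; have [->|rnt] := eqVneq r t.
    by rewrite !subrr mulr0 subrr normr0 mulr0.
  have rt0 : r - t != 0 by rewrite subr_eq0.
  have := Hd (r - t); rewrite /ball /= sub0r normrN => /(_ rt rt0).
  rewrite /GRing.scale /= mulr1 subrK => H1.
  have -> : f r - f t - l * (r - t) = - ((l - (r - t)^-1 * (f r - f t)) * (r - t)).
    by field.
  by rewrite normrN normrM ler_pM2r ?normr_gt0.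
- move=> H.
  have cv : (fun h => h^-1 *: ((f \o shift t) (h *: 1) - f t)) @ 0^' --> l.
    apply/cvgrPdist_le => e e0; have [d d0 Hd] := H e e0.
    apply/nbhs_ballP; exists d => //= h; rewrite /ball /= sub0r normrN => hd h0.
    have := Hd (h + t); rewrite addrK => /(_ hd).
    rewrite /GRing.scale /= mulr1.
    have -> : f (h + t) - f t - l * h = - ((l - h^-1 * (f (h + t) - f t)) * h).
      by field.
    by rewrite normrN normrM ler_pM2r ?normr_gt0.
  by split; [exact: (cvgP _ cv)|exact: cvg_lim].
Qed.

Lemma is_derive_continuous f t (l : R) : is_derive t 1 f l -> {for t, continuous f}.
Proof. by move=> [df _]; apply: differentiable_continuous; apply/derivable1_diffP. Qed.

Lemma is_derive_within f (df : R -> R) a b :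
  (forall t, a <= t <= b -> is_derive t 1 f (df t)) -> {within `[a, b], continuous f}.
Proof.
move=> H; apply: derivable_within_continuous => t; rewrite in_itv /= => tab.
by case: (H t tab).
Qed.

Lemma mvt f (df : R -> R) a b : a < b ->
  (forall t, a < t < b -> is_derive t 1 f (df t)) ->
  {within `[a, b], continuous f} ->
  exists2 c, a < c < b & f b - f a = df c * (b - a).
Proof.
move=> ab H cf.
have H' t : t \in `]a, b[%R -> is_derive t 1 f (df t).
  by rewrite in_itv /=; exact: H.
have [t] := MVT ab H' cf; by rewrite in_itv /= => ? ?; exists t.
Qed.

Lemma is_derive_itv f (df : R -> R) a b :
  (forall t, a <= t <= b -> is_derive t 1 f (df t)) ->
  (forall t, a < t < b -> is_derive t 1 f (df t)) /\ {within `[a, b], continuous f}.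
Proof.
move=> H; split; last exact: is_derive_within H.
by move=> t /andP[? ?]; apply: H; lra.
Qed.

(** The [u] such that [P] holds throughout [[a, u]] have a supremum; the last hypothesis makes [P]
    hold there, and the second one would push it further if it were below [b]. It serves in place of
    first exit times and compactness: for signs, confinement to a ball, growth of lengths. *)
Lemma real_induction (P : R -> Prop) a b : P a ->
  (forall t, a <= t < b -> (forall s, a <= s <= t -> P s) ->
     exists2 d : R, 0 < d & forall s, t < s < t + d -> s <= b -> P s) ->
  (forall t, a < t <= b -> (forall s, a <= s < t -> P s) -> P t) ->
  forall t, a <= t <= b -> P t.
Proof.
move=> Pa Hr Hl t /andP[at' tb].
pose A := [set u : R | a <= u <= b /\ forall s, a <= s <= u -> P s].
have ab : a <= b by lra.
have Aa : A a.
  split; first by rewrite lexx ab.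
  by move=> s /andP[? ?]; have -> : s = a by lra.
have hA : has_sup A.
  by split; [exists a | exists b => u [/andP[_ ?] _]].
have sa : a <= sup A by apply: sup_upper_bound.
have sb : sup A <= b by apply: ge_sup => [|u [/andP[_ ?] _]]; [exists a|].
have lt_sup s : a <= s < sup A -> P s.
  move=> /andP[as' ssup].
  have e0 : 0 < sup A - s by lra.
  have [u Au su] := sup_adherent e0 hA.
  by case: Au => _; apply; lra.
have Psup : P (sup A).
  have [->//|] := eqVneq (sup A) a => sn.
  apply: Hl => //; rewrite sb andbT lt_neqAle sa andbT eq_sym//.
have Hsup : forall s, a <= s <= sup A -> P s.
  move=> s /andP[h1]; rewrite le_eqVlt => /orP[/eqP->//|h2].
  by apply: lt_sup; rewrite h1 h2.
have [sblt|] := ltP (sup A) b; last first.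
  by move=> ?; apply: Hsup; lra.
have sab : a <= sup A < b by lra.
have [d d0 Hd] := Hr _ sab Hsup.
(* Half of [d], as [P] is granted only strictly before [sup A + d]. *)
have : A (Num.min b (sup A + d / 2)).
  split.
    by rewrite ge_min lexx le_min ab /= /=; lra.
  move=> s; rewrite le_min => /and3P[h1 h2 h3].
  have [hs|hs] := leP s (sup A); first by apply: Hsup; lra.
  by apply: Hd => //; lra.
move/(sup_upper_bound hA); rewrite ge_min => /orP[]; lra.
Qed.

End RealAnalysis.

Section RealAnalysis2.
Variable R : realType.
Implicit Types (f g : R -> R) (a b t : R).
Notation mu := (@lebesgue_measure R).

Lemma ge0_derive_le f (df : R -> R) a b : a <= b ->
  (forall t, a <= t <= b -> is_derive t 1 f (df t)) ->
  (forall t, a <= t <= b -> 0 <= df t) -> f a <= f b.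
Proof.
rewrite le_eqVlt => /predU1P[->//|ab] H H0.
have [H1 H2] := is_derive_itv H.
have [c /andP[? ?]] := mvt ab H1 H2.
move=> e; rewrite -subr_ge0 e; apply: mulr_ge0; last by lra.
by apply: H0; lra.
Qed.

Lemma derive0_cst f a b : a <= b ->
  (forall t, a <= t <= b -> is_derive t 1 f 0) -> f a = f b.
Proof.
rewrite le_eqVlt => /predU1P[->//|ab] H.
have [H1 H2] := is_derive_itv H.
have [c _] := mvt ab H1 H2.
by rewrite mul0r => ?; lra.
Qed.

Lemma ivt f a b y : a <= b -> (forall t, a <= t <= b -> {for t, continuous f}) ->
  f a <= y <= f b -> exists2 t, a <= t <= b & f t = y.
Proof.
move=> ab cf yab.
have cf' : {within `[a, b], continuous f}.
  by apply: continuous_in_subspaceT => t; rewrite inE /= in_itv /= => /cf.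
have [|c] := IVT ab cf' (v := y).
  by move/andP: yab => [? ?]; rewrite ge_min le_max; apply/andP; split; apply/orP; [left|right].
by rewrite in_itv /= => ? <-; exists c.
Qed.

(** Without a first zero, positivity would propagate to [b] by real induction: a limit of positive
    values is nonnegative, and if it were 0 it would be the first zero. *)
Lemma first_zero f a b : a < b -> (forall t, a <= t <= b -> {for t, continuous f}) ->
  0 < f a -> f b <= 0 ->
  exists2 s, a < s <= b & f s = 0 /\ forall t, a <= t < s -> 0 < f t.
Proof.
move=> ab cf fa fb; apply: contrapT => H.
suff: 0 < f b by lra.
apply: (@real_induction _ (fun t => 0 < f t) a b) => //; last by lra.
- move=> t tab /(_ t) ft; have {}ft : 0 < f t by apply: ft; lra.
  have /continuous_epsP/(_ _ ft)[d d0 Hd] := cf t ltac:(lra).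
  exists d => // s /andP[ts std] sb; have := Hd s; rewrite gtr0_norm; last by lra.
  move=> /(_ ltac:(lra)); rewrite ltr_norml; lra.
- move=> t tab Ht; rewrite ltNge; apply/negP => ft.
  apply: H; exists t => //; split; last exact: Ht.
  apply/eqP; rewrite eq_le ft /= leNgt; apply/negP => ft0.
  have /continuous_epsP/(_ (- f t))[|d d0 Hd] := cf t ltac:(lra); first by lra.
  pose s := Num.max a (t - d / 2).
  have hs : a <= s < t /\ t - d / 2 <= s.
    rewrite /s le_max lexx /= le_max lexx orbT gt_max; split => //.
    by apply/andP; split; lra.
  have := Ht s (proj1 hs); have := Hd s.
  rewrite ltr0_norm; last by lra.
  move=> /(_ ltac:(lra)); rewrite ltr_norml; lra.
Qed.

Lemma continuous_sign f t : {for t, continuous f} -> f t != 0 ->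
  exists2 d : R, 0 < d & forall r : R, `|r - t| < d -> 0 < f r * f t.
Proof.
move=> /continuous_epsP H ft0.
have [d d0 Hd] := H (`|f t| ) ltac:(by rewrite normr_gt0).
exists d => // r /Hd.
have [h|h|h] := ltgtP (f t) 0; last by rewrite h eqxx in ft0.
  rewrite (ltr0_norm h) ltr_norml => /andP[? ?]; nra.
rewrite (gtr0_norm h) ltr_norml => /andP[? ?]; nra.
Qed.

Lemma is_derive_mul f g t (df dg : R) : is_derive t 1 f df -> is_derive t 1 g dg ->
  is_derive t 1 (fun s => f s * g s) (df * g t + f t * dg).
Proof.
move=> Df Dg; have := is_deriveM Df Dg; rewrite /GRing.scale /=.
by rewrite [X in is_derive _ _ _ X]addrC [g t * _]mulrC.
Qed.

Lemma is_derive_pow f t (df : R) k : is_derive t 1 f df ->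
  is_derive t 1 (fun s => f s ^+ k) (k%:R * f t ^+ k.-1 * df).
Proof.
move=> Df; elim: k => [|k IH].
  by rewrite !mul0r; exact: is_derive_cst.
have -> : (fun s => f s ^+ k.+1) = (fun s => f s * f s ^+ k) by apply/funext => s; rewrite exprS.
have := is_derive_mul Df IH; congr is_derive.
case: k {IH} => [|k] /=; first by rewrite !expr0; ring.
by rewrite exprS -[in RHS]natr1; ring.
Qed.

Lemma is_derive_cmul f t (df c : R) : is_derive t 1 f df -> is_derive t 1 (fun s => c * f s) (c * df).
Proof. by move=> Df; exact: is_deriveZ. Qed.

Lemma is_derive_add f g t (df dg : R) : is_derive t 1 f df -> is_derive t 1 g dg ->
  is_derive t 1 (fun s => f s + g s) (df + dg).
Proof. by move=> Df Dg; exact: is_deriveD. Qed.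

Lemma is_derive_sub f g t (df dg : R) : is_derive t 1 f df -> is_derive t 1 g dg ->
  is_derive t 1 (fun s => f s - g s) (df - dg).
Proof. by move=> Df Dg; exact: is_deriveB. Qed.

Lemma is_derive_opp f t (df : R) : is_derive t 1 f df -> is_derive t 1 (fun s => - f s) (- df).
Proof. by move=> Df; exact: is_deriveN. Qed.

Lemma is_derive_ext f g t (df dg : R) : is_derive t 1 f df -> f =1 g -> df = dg -> is_derive t 1 g dg.
Proof. by move=> Df /funext <- <-. Qed.

(** * Clocks *)

(** The derivative may vanish, but only at isolated times; this is what happens to [int xi_j ^ 2]
    when the geodesic meets zeros of earlier coordinates. *)
Definition is_clock (S : R -> R) (dS : R -> R) : Prop :=
  (forall t, is_derive t 1 S (dS t)) /\ (forall t, 0 <= dS t) /\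
  (forall t, exists2 d : R, 0 < d & forall r : R, 0 < `|r - t| < d -> 0 < dS r).

(** The mean value theorem gives a strict gain on a short interval after [a], where the derivative
    is positive; monotonicity does the rest. *)
Lemma clock_lt S dS a b : is_clock S dS -> a < b -> S a < S b.
Proof.
move=> [H1 [H2 H3]] ab.
have mono u v : u <= v -> S u <= S v.
  by move=> uv; apply: (@ge0_derive_le S dS).
have [d d0 Hd] := H3 a.
pose c := Num.min b (a + d / 2).
have [ac cb cd] : [/\ a < c, c <= b & c <= a + d / 2].
  rewrite /c lt_min ge_min lexx /= ge_min lexx orbT; split => //; lra.
apply: (@lt_le_trans _ _ (S c)); last exact: mono.
have wS : {within `[a, c], continuous S} by apply: is_derive_within => t _; exact: H1.
have [e he eq] := @mvt _ S dS a c ac (fun t _ => H1 t) wS.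
rewrite -subr_gt0 eq; apply: mulr_gt0; last by lra.
apply: Hd; rewrite gtr0_norm; lra.
Qed.

Lemma clock_ltE S dS a b : is_clock S dS -> (S a < S b) = (a < b).
Proof.
move=> H; have [ab|ab|->] := ltgtP a b; last by rewrite ltxx.
  exact: clock_lt H ab.
by apply/negP => h; have := clock_lt H ab; lra.
Qed.

Lemma clock_leE S dS a b : is_clock S dS -> (S a <= S b) = (a <= b).
Proof. by move=> H; rewrite !leNgt (clock_ltE _ _ H). Qed.

Lemma clock_inj S dS : is_clock S dS -> injective S.
Proof. by move=> H a b e; apply/eqP; rewrite eq_le -(clock_leE a b H) -(clock_leE b a H) e lexx. Qed.

Lemma clock_continuous S dS t : is_clock S dS -> {for t, continuous S}.
Proof. by move=> [H _]; exact: is_derive_continuous (H t). Qed.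

(** The default 0 is returned when [y] has no preimage: hence the range conditions in what
    follows. *)
Definition clock_inv (S : R -> R) (y : R) : R := xget 0 [set r | S r = y].

Lemma clock_invK S dS y t : is_clock S dS -> S t = y -> clock_inv S y = t.
Proof.
move=> H e; apply: (clock_inj H); rewrite e.
by rewrite /clock_inv; case: xgetP => [r -> //|/(_ t)]; rewrite /= e.
Qed.

Lemma clock_ivt S dS a b y : is_clock S dS -> S a <= y <= S b ->
  a <= clock_inv S y <= b /\ S (clock_inv S y) = y.
Proof.
move=> H yab.
have ab : a <= b by rewrite -(clock_leE _ _ H); lra.
have [t tab <-] := ivt ab (fun t _ => clock_continuous H) yab.
by rewrite (clock_invK H erefl).
Qed.

Lemma clock_inv_near S dS t : is_clock S dS ->
  exists2 d : R, 0 < d & forall y, `|y - S t| < d -> S (clock_inv S y) = y.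
Proof.
move=> H; pose d := Num.min (S t - S (t - 1)) (S (t + 1) - S t).
have d0 : 0 < d.
  by rewrite /d lt_min !subr_gt0 !(clock_ltE _ _ H); apply/andP; split; lra.
have [d1 d2] : d <= S t - S (t - 1) /\ d <= S (t + 1) - S t.
  by split; rewrite /d ge_min lexx ?orbT.
exists d => // y; rewrite ltr_norml => /andP[? ?].
by have [] := @clock_ivt S dS (t - 1) (t + 1) y H ltac:(lra).
Qed.

Lemma clock_inv_continuous S dS t : is_clock S dS -> {for S t, continuous (clock_inv S)}.
Proof.
move=> H; apply/continuous_epsP => e e0.
pose d := Num.min (S t - S (t - e / 2)) (S (t + e / 2) - S t).
have d0 : 0 < d.
  by rewrite /d lt_min !subr_gt0 !(clock_ltE _ _ H); apply/andP; split; lra.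
have [d1 d2] : d <= S t - S (t - e / 2) /\ d <= S (t + e / 2) - S t.
  by split; rewrite /d ge_min lexx ?orbT.
exists d => // y; rewrite ltr_norml => /andP[? ?].
have [? _] := @clock_ivt S dS (t - e / 2) (t + e / 2) y H ltac:(lra).
rewrite (clock_invK H erefl) ltr_norml; lra.
Qed.

(* Comparing [G] with [(g (tau t) -+ e) S] replaces Cauchy's mean value theorem,
   which would need the derivative of the clock not to vanish. *)
Lemma is_derive_clock_near S dS (G g tau H : R -> R) (t h : R) :
  is_clock S dS ->
  (exists2 d0 : R, 0 < d0 & forall r : R, `|r - tau t| < d0 -> is_derive r 1 G (dS r * g r)) -> {for tau t, continuous g} ->
  {for t, continuous tau} ->
  (exists2 d : R, 0 < d & forall r : R, `|r - t| < d -> S (tau r) = H r) ->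
  is_derive t 1 H h -> is_derive t 1 (G \o tau) (h * g (tau t)).
Proof.
move=> HS [dn dn0 dG] cg ctau [d d0 Hd] /is_derive_epsP dH.
have key e : 0 < e -> exists2 d : R, 0 < d & forall r : R, `|r - tau t| < d ->
    `|G r - G (tau t) - g (tau t) * (S r - S (tau t))| <= e * `|S r - S (tau t)|.
  move=> e0; have /continuous_epsP/(_ _ e0)[d' d'0 Hd'] := cg.
  exists (Num.min d' dn); first by rewrite lt_min d'0.
  move=> r; rewrite lt_min => /andP[rd' rdn].
  have cmp a b : a <= b -> `|a - tau t| < d' -> `|b - tau t| < d' -> `|a - tau t| < dn -> `|b - tau t| < dn ->
      `|G b - G a - g (tau t) * (S b - S a)| <= e * (S b - S a).
    move=> ab ha hb ha' hb'.
    have hz z : a <= z <= b -> `|g z - g (tau t)| < e.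
      by move=> zab; apply: Hd'; move: ha hb; rewrite !ltr_norml; lra.
    have dGz z : a <= z <= b -> is_derive z 1 G (dS z * g z).
      by move=> zab; apply: dG; clear -ha' hb' zab; move: ha' hb'; rewrite !ltr_norml; lra.
    have dSd (c z : R) : a <= z <= b -> is_derive z 1 (fun z => c * S z - G z) (c * dS z - dS z * g z).
      have [dS' _] := HS; have := dS' z => ? /dGz ?.
      by apply: is_deriveB.
    have dSd' (c z : R) : a <= z <= b -> is_derive z 1 (fun z => G z - c * S z) (dS z * g z - c * dS z).
      have [dS' _] := HS; have := dS' z => ? /dGz ?.
      by apply: is_deriveB.
    have [_ [dS0 _]] := HS.
    have := @ge0_derive_le _ _ a b ab (dSd (g (tau t) + e)).
    have := @ge0_derive_le _ _ a b ab (dSd' (g (tau t) - e)).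
    move=> h1 h2.
    have {}h1 := h1 ltac:(by move=> z /hz; have := dS0 z; rewrite ltr_norml; nra).
    have {}h2 := h2 ltac:(by move=> z /hz; have := dS0 z; rewrite ltr_norml; nra).
    rewrite ler_norml; lra.
  have h0 : `|tau t - tau t| < d' by rewrite subrr normr0.
  have h0' : `|tau t - tau t| < dn by rewrite subrr normr0.
  have [le|le] := leP (tau t) r.
    have := cmp _ _ le h0 rd' h0' rdn; rewrite (ger0_norm (_ : 0 <= S r - _)) //.
    by rewrite subr_ge0 (clock_leE _ _ HS).
  have := cmp _ _ (ltW le) rd' h0 rdn h0'; rewrite (ltr0_norm (_ : S r - _ < 0)); last first.
    by rewrite subr_lt0 (clock_ltE _ _ HS).
  by rewrite opprB -normrN; congr (_ <= _); congr (`| _ |); ring.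
apply/is_derive_epsP => e e0.
pose e1 := Num.min 1 (e / (2 * (`|h| + 1 + `|g (tau t)|))).
have N0 : 0 < `|h| + 1 + `|g (tau t)| by have := normr_ge0 h; have := normr_ge0 (g (tau t)); lra.
have e10 : 0 < e1 by rewrite /e1 lt_min ltr01 divr_gt0 //; lra.
have [e1a e1b] : e1 <= 1 /\ e1 * (`|h| + 1 + `|g (tau t)|) <= e / 2.
  split; first by rewrite /e1 ge_min lexx.
  rewrite -ler_pdivlMr //; rewrite /e1 ge_min; apply/orP; right.
  by rewrite le_eqVlt; apply/orP; left; apply/eqP; field; lra.
have [d1 d10 Hd1] := key _ e10.
have [d2 d20 Hd2] := dH _ e10.
have /continuous_epsP/(_ _ d10)[d3 d30 Hd3] := ctau.
exists (Num.min d (Num.min d2 d3)); first by rewrite !lt_min d0 d20.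
move=> r; rewrite !lt_min => /and3P[r1 r2 r3] /=.
have tt : `|t - t| < d by rewrite subrr normr0.
have := Hd1 _ (Hd3 _ r3); rewrite (Hd _ r1) (Hd _ tt) => k1.
have k2 := Hd2 _ r2.
have k3 : `|H r - H t| <= (`|h| + 1) * `|r - t|.
  have -> : H r - H t = (H r - H t - h * (r - t)) + h * (r - t) by ring.
  apply: le_trans (ler_normD _ _) _; rewrite normrM.
  have := normr_ge0 (r - t); nra.
have -> : G (tau r) - G (tau t) - h * g (tau t) * (r - t) =
  (G (tau r) - G (tau t) - g (tau t) * (H r - H t)) + g (tau t) * (H r - H t - h * (r - t)) by ring.
apply: le_trans (ler_normD _ _) _; rewrite normrM.
have n0 := normr_ge0 (r - t); have n1 := normr_ge0 (g (tau t)).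
have k4 : e1 * `|H r - H t| <= e1 * ((`|h| + 1) * `|r - t|) by rewrite ler_pM2l.
have k5 : `|g (tau t)| * `|H r - H t - h * (r - t)| <= `|g (tau t)| * (e1 * `|r - t|).
  by rewrite ler_wpM2l.
nra.
Qed.

Lemma is_derive_clock S dS (G g tau H : R -> R) (t h : R) :
  is_clock S dS ->
  (forall r : R, is_derive r 1 G (dS r * g r)) -> {for tau t, continuous g} ->
  {for t, continuous tau} ->
  (exists2 d : R, 0 < d & forall r : R, `|r - t| < d -> S (tau r) = H r) ->
  is_derive t 1 H h -> is_derive t 1 (G \o tau) (h * g (tau t)).
Proof. by move=> HS dG; apply: is_derive_clock_near HS _; exists 1. Qed.

(** * Integrals and antiderivatives of continuous functions *)

Lemma Rintegral_split f a b c : a <= b <= c ->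
  mu.-integrable `[a, c] (EFin \o f) ->
  \int[mu]_(t in `[a, c]) f t = \int[mu]_(t in `[a, b]) f t + \int[mu]_(t in `[b, c]) f t.
Proof.
move=> /andP[ab bc] intf.
have := @Rintegral_itvB _ f (BLeft a) (BRight c) b intf.
rewrite !bnd_simp => /(_ ab bc) e; rewrite -[X in _ = _ + X]Rintegral_itv_obnd_cbnd.
  by rewrite -e; ring.
apply: integrableS intf => //; apply: subset_itvr; rewrite bnd_simp//.
Qed.

Lemma continuous_integrable f a b : (forall t, a <= t <= b -> {for t, continuous f}) ->
  mu.-integrable `[a, b] (EFin \o f).
Proof.
move=> cf; apply: continuous_compact_integrable; first exact: segment_compact.
by apply: continuous_in_subspaceT => t; rewrite inE /= in_itv /= => /cf.
Qed.

Lemma Rintegral_FTC2 f F a b : a <= b ->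
  (forall t, a <= t <= b -> is_derive t 1 F (f t)) ->
  (forall t, a <= t <= b -> {for t, continuous f}) ->
  \int[mu]_(t in `[a, b]) f t = F b - F a.
Proof.
rewrite le_eqVlt => /predU1P[->|ab] dF cf.
  by rewrite set_itv1 Rintegral_set1 subrr.
rewrite /Rintegral (@continuous_FTC2 R f F a b) //.
- by apply: continuous_in_subspaceT => t; rewrite inE /= in_itv /= => /cf.
- split.
  + by move=> t; rewrite in_itv /= => /andP[? ?]; have [] := dF t ltac:(lra).
  + by apply: cvg_at_right_filter; apply: is_derive_continuous (dF a _); rewrite lexx ltW.
  + by apply: cvg_at_left_filter; apply: is_derive_continuous (dF b _); rewrite lexx ltW.
- move=> t; rewrite in_itv /= => /andP[? ?]; rewrite derive1E.
  by have [] := dF t ltac:(lra).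
Qed.

Lemma antiderivative f : (forall t, {for t, continuous f}) ->
  exists F, forall t, is_derive t 1 F (f t).
Proof.
move=> cf.
(* For either sign of [t] one of the two integrals is over an empty or one-point set; the difference
   is the oriented integral from 0. *)
pose F t := \int[mu]_(s in `[0, t]) f s - \int[mu]_(s in `[t, 0]) f s.
have Fc c t : c < 0 -> c < t -> F t = \int[mu]_(s in `[c, t]) f s - \int[mu]_(s in `[c, 0]) f s.
  move=> c0 ct; have ci a b : mu.-integrable `[a, b] (EFin \o f).
    by apply: continuous_integrable.
  rewrite /F; have [t0|t0] := leP 0 t.
    rewrite (@Rintegral_split f c 0 t) ?t0 ?ltW //.
    have -> : \int[mu]_(s in `[t, 0]) f s = 0; last by ring.
    move: t0; rewrite le_eqVlt => /predU1P[<-|t0]; first by rewrite set_itv1 Rintegral_set1.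
    by rewrite set_itv_ge ?Rintegral_set0 // bnd_simp -ltNge.
  rewrite (@Rintegral_split f c t 0) ?ltW //.
  by rewrite (@set_itv_ge _ _ (BLeft 0)) ?Rintegral_set0 ?bnd_simp -?ltNge //; ring.
(* A base point to the left of both [t] and 0: near [t], [F] is an integral from [c] up to a
   constant. *)
exists F => t; pose c := Num.min t 0 - 1.
have [c0 ct] : c < 0 /\ c < t.
  have h1 : Num.min t 0 <= 0 by rewrite ge_min lexx orbT.
  have h2 : Num.min t 0 <= t by rewrite ge_min lexx.
  by rewrite /c; split; lra.
have [] := @continuous_FTC1_closed R f c t (t + 1) _ _ ct (cf t).
- by lra.
- exact: continuous_integrable.
move=> D DE.
apply: (@near_eq_is_derive _ _ _ (fun t => \int[mu]_(s in `[c, t]) f s - \int[mu]_(s in `[c, 0]) f s)) => //.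
  near=> s; rewrite (Fc c) //; near: s; exact: lt_nbhsr.
rewrite -DE -[X in is_derive _ _ _ X]subr0; apply: is_deriveB.
by rewrite derive1E; exact: DeriveDef.
Unshelve. all: by end_near. Qed.

End RealAnalysis2.

(** * Generalized trigonometric functions *)

Section GeneralizedTrigonometry.
Variable R : realType.
Notation mu := (@lebesgue_measure R).
Variable a : nat.
Hypothesis a0 : (0 < a)%N.
Notation g := (@gtrig_integrand R a).
Notation As := (@arcsin_a R a).

Lemma pow2aN (t : R) : (- t) ^+ (2 * a) = t ^+ (2 * a).
Proof. by rewrite !exprM sqrrN. Qed.

(** This crude bound lets [(1 - t) ^ (-1/2)], which has an explicit primitive, dominate the
    integrand up to its singularity at 1. *)
Lemma pow2a_le (t : R) : `|t| <= 1 -> t ^+ (2 * a) <= `|t|.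
Proof.
move=> t1; have -> : t ^+ (2 * a) = `|t| ^+ (2 * a) by rewrite !exprM real_normK ?num_real.
case: a a0 => // b _; rewrite mulnS exprD expr2 -mulrA ler_piMr //.
by apply: mulr_ile1; rewrite ?exprn_ge0 ?exprn_ile1.
Qed.

Lemma pow2a_lt1 (t : R) : `|t| < 1 -> t ^+ (2 * a) < 1.
Proof. by move=> t1; apply: le_lt_trans (pow2a_le (ltW t1)) t1. Qed.

Lemma pow2a_le1 (t : R) : t ^+ (2 * a) <= 1 -> -1 <= t <= 1.
Proof.
rewrite exprM => h; have h2 : t ^+ 2 <= 1.
  by rewrite leNgt; apply/negP => h2; move: h; rewrite leNgt exprn_egt1 //; case: a a0.
by rewrite -ler_norml -(@ler_pXn2r _ 2) ?nnegrE // expr1n real_normK ?num_real.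
Qed.

Lemma continuous_pow2a (t : R) : {for t, continuous (fun t : R => 1 - t ^+ (2 * a))}.
Proof.
apply: continuousB; first exact: cvg_cst.
exact: exprn_continuous.
Qed.

Lemma gtrigV (t : R) : (g t)^-1 = Num.sqrt (1 - t ^+ (2 * a)).
Proof. by rewrite /gtrig_integrand invrK. Qed.

Lemma sqrt_pow2a_gt0 (t : R) : `|t| < 1 -> 0 < Num.sqrt (1 - t ^+ (2 * a)).
Proof. by move=> /pow2a_lt1 ?; rewrite sqrtr_gt0; lra. Qed.

Lemma gtrig_continuous (t : R) : `|t| < 1 -> {for t, continuous g}.
Proof.
move=> t1; apply: continuousV; first by rewrite gt_eqF // sqrt_pow2a_gt0.
apply: (@continuous_comp _ _ _ (fun t : R => 1 - t ^+ (2 * a)) Num.sqrt).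
  exact: continuous_pow2a.
exact: sqrt_continuous.
Qed.

Lemma gtrig_ge0 (t : R) : 0 <= g t.
Proof. by rewrite /gtrig_integrand invr_ge0 sqrtr_ge0. Qed.

Lemma gtrig_gt0 (t : R) : `|t| < 1 -> 0 < g t.
Proof. by move=> t1; rewrite /gtrig_integrand invr_gt0 sqrt_pow2a_gt0. Qed.

Lemma gtrigN (t : R) : g (- t) = g t.
Proof. by rewrite /gtrig_integrand pow2aN. Qed.

Lemma is_derive_sqrt1B (t : R) : t < 1 ->
  is_derive t 1 (fun t : R => - 2 * Num.sqrt (1 - t)) (Num.sqrt (1 - t))^-1.
Proof.
move=> t1; have h : 0 < 1 - t by lra.
have s0 : 0 < Num.sqrt (1 - t) by rewrite sqrtr_gt0.
have h1 : is_derive (1 - t) 1 Num.sqrt ((2 * Num.sqrt (1 - t))^-1) by exact: is_derive1_sqrt.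
have h2 : is_derive t 1 (fun t : R => 1 - t) (- 1).
  by rewrite -[X in is_derive _ _ _ X]add0r; apply: is_deriveB.
have h3 : is_derive t 1 (Num.sqrt \o (fun t : R => 1 - t)) ((2 * Num.sqrt (1 - t))^-1 * - 1).
  exact: is_derive1_comp.
apply: is_derive_eq.
by rewrite /GRing.scale /=; field; rewrite gt_eqF.
Qed.

(** On [[0, 1 - 1/(n+1)]] the integrand is continuous and at most [(1 - t) ^ (-1/2)], whose integral
    is at most 2; monotone convergence passes to the limit. *)
Lemma gtrig_integrable : mu.-integrable `[0, 1] (EFin \o g).
Proof.
have mg : measurable_fun `[(0:R), 1] g.
  apply/(measurable_fun_itv_bndo_bndcP _ _ g).
  apply: subspace_continuous_measurable_fun => //.
  apply: continuous_in_subspaceT => t; rewrite inE /= in_itv /= => /andP[? ?].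
  by apply: gtrig_continuous; rewrite ger0_norm.
apply/integrableP; split; first exact/measurable_EFinP.
rewrite -integral_itv_bndo_bndc; last first.
  apply: measurableT_comp => //; apply/measurable_EFinP.
  exact/(measurable_fun_itv_bndo_bndcP _ _ g).
rewrite itv_bnd_open_bigcup.
pose F n := `[(0:R), 1 - n.+1%:R^-1]%classic.
have sF n : F n `<=` `[0, 1].
  by apply: subset_itvl; rewrite bnd_simp gerBl invr_ge0.
have := @ge0_nondecreasing_set_cvg_integral _ (measurableTypeR R) R F (fun t => `|(EFin \o g) t|%E) mu.
move=> H.
have /cvg_lim <- // : (\int[mu]_(x in F i) `|(EFin \o g) x|)%E @[i --> \oo] -->
   (\int[mu]_(x in \bigcup_i F i) `|(EFin \o g) x|)%E.
  apply: H => //.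
  - apply/nondecreasing_seqP => n; rewrite subsetEset; apply: subset_itvl.
    by rewrite bnd_simp lerB // lef_pV2 ?posrE ?ltr0n // ler_nat.
  - by move=> i; exact: measurable_itv.
  - move=> i; apply: measurableT_comp => //; apply/measurable_EFinP.
    exact: measurable_funS mg.
apply: (@le_lt_trans _ _ 2%:E); last by rewrite ltry.
apply: lime_le.
  apply: ereal_nondecreasing_is_cvgn.
  apply: ge0_nondecreasing_set_nondecreasing_integral => //.
  - apply/nondecreasing_seqP => n; rewrite subsetEset; apply: subset_itvl.
    by rewrite bnd_simp lerB // lef_pV2 ?posrE ?ltr0n // ler_nat.
  - by move=> i; exact: measurable_itv.
  - move=> i; apply: measurableT_comp => //; apply/measurable_EFinP.
    exact: measurable_funS mg.
near=> n.
pose c : R := 1 - n.+1%:R^-1.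
have [c0 c1] : 0 <= c /\ c < 1.
  have h1 : (n.+1%:R : R)^-1 <= 1 by rewrite invf_le1 ?ltr0n // ler1n.
  have h2 : 0 < (n.+1%:R : R)^-1 by rewrite invr_gt0 ltr0n.
  by move: h1 h2; rewrite /c; move: (_^-1) => v ? ?; split; lra.
pose k (t : R) := (Num.sqrt (1 - t))^-1.
have ck t : 0 <= t <= c -> {for t, continuous k}.
  move=> tc; have h : 0 < 1 - t by lra.
  apply: continuousV; first by rewrite gt_eqF // sqrtr_gt0.
  apply: (@continuous_comp _ _ _ (fun t : R => 1 - t) Num.sqrt).
    by apply: continuousB; [exact: cvg_cst|exact: cvg_id].
  exact: sqrt_continuous.
have cg t : 0 <= t <= c -> {for t, continuous g}.
  by move=> tc; apply: gtrig_continuous; rewrite ger0_norm; lra.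
have ig := continuous_integrable cg.
have -> : (\int[mu]_(x in F n) `|(EFin \o g) x| = (\int[mu]_(x in `[0%R, c]) g x)%:E)%E.
  rewrite /Rintegral fineK; last exact: integrable_fin_num.
  by apply: eq_integral => t _ /=; rewrite ger0_norm ?gtrig_ge0.
rewrite lee_fin.
apply: (@le_trans _ _ (\int[mu]_(x in `[0, c]) k x)).
  apply: le_Rintegral => //; first exact: continuous_integrable.
  move=> t; rewrite /= in_itv /= => tc.
  have t1 : `|t| < 1 by rewrite ger0_norm; lra.
  rewrite /gtrig_integrand /k lef_pV2 ?posrE ?sqrt_pow2a_gt0 ?sqrtr_gt0 //; last by lra.
  rewrite ler_sqrt; last by have := pow2a_lt1 t1; lra.
  by have := pow2a_le (ltW t1); rewrite ger0_norm; lra.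
have -> : \int[mu]_(x in `[0, c]) k x = - 2 * Num.sqrt (1 - c) - - 2 * Num.sqrt (1 - 0).
  apply: (@Rintegral_FTC2 _ k (fun t : R => - 2 * Num.sqrt (1 - t))) => //.
  by move=> t tc; apply: is_derive_sqrt1B; lra.
by rewrite subr0 sqrtr1; have := sqrtr_ge0 (1 - c); lra.
Unshelve. all: by end_near. Qed.


Lemma arcsin0 : As 0 = 0.
Proof. by rewrite /arcsin_a set_itv1 Rintegral_set1. Qed.

(* Clipping the argument makes the integrand continuous on the whole line, so that an
   antiderivative is available on both sides of 0. *)
Lemma gtrig_primitive (c : R) : 0 < c < 1 ->
  exists F : R -> R, [/\ forall t : R, `|t| <= c -> is_derive t 1 F (g t),
     forall t : R, 0 <= t <= c -> As t = F t - F 0 &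
     forall t : R, 0 <= t <= c -> - As t = F (- t) - F 0].
Proof.
move=> /andP[c0 c1].
pose clip (t : R) := Num.max (- c) (Num.min c t).
have clipE t : `|t| <= c -> clip t = t.
  rewrite ler_norml => /andP[h1 h2]; rewrite /clip.
  by rewrite (min_idPr h2) (max_idPr h1).
have clip1 t : `|clip t| < 1.
  apply: le_lt_trans c1; rewrite ler_norml /clip le_max lexx /= ge_max ge_min lexx /= andbT.
  by lra.
have cclip : continuous clip.
  move=> t; apply: (@continuous_max _ _ (cst (- c)) (cst c \min id)); first exact: cvg_cst.
  by apply: (@continuous_min _ _ (cst c) id); [exact: cvg_cst|exact: cvg_id].
have cg t : {for t, continuous (g \o clip)}.
  by apply: continuous_comp; [exact: cclip|exact: gtrig_continuous (clip1 _)].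
have [F dF] := antiderivative cg.
have dF' (t : R) : `|t| <= c -> is_derive t 1 F (g t).
  by move=> tc; have := dF t; rewrite /= clipE.
have FE t : 0 <= t <= c -> As t = F t - F 0.
  move=> tc; apply: Rintegral_FTC2; first by lra.
  - by move=> s sc; apply: dF'; rewrite ger0_norm; lra.
  - by move=> s sc; apply: gtrig_continuous; rewrite ger0_norm; lra.
exists F; split => // t tc.
rewrite (FE _ tc).
suff : F 0 + F (- 0) = F t + F (- t) by rewrite oppr0; lra.
apply: (@derive0_cst _ (fun t => F t + F (- t))); first by lra.
move=> s sc.
have h1 : is_derive s 1 F (g s) by apply: dF'; rewrite ger0_norm; lra.
have h2 : is_derive (- s) 1 F (g s).
  by rewrite -gtrigN; apply: dF'; rewrite normrN ger0_norm; lra.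
have h3 : is_derive s 1 (F \o -%R) (g s * -1) by apply: is_derive1_comp.
by apply: is_derive_eq; rewrite mulrN1 subrr.
Qed.

(** The position of the oscillator runs through [[-1, 1]], whereas [arcsin_a] is the phase on
    [[0, 1]] only. *)
Definition asin_odd (y : R) : R := if 0 <= y then As y else - As (- y).

Lemma asin_oddN (y : R) : asin_odd (- y) = - asin_odd y.
Proof.
rewrite /asin_odd oppr_ge0 opprK.
have [h|h|->] := ltgtP y 0; rewrite ?opprK //.
by rewrite oppr0 arcsin0 oppr0.
Qed.

Lemma asin_oddE (y : R) : 0 <= y -> asin_odd y = As y.
Proof. by rewrite /asin_odd => ->. Qed.

Lemma is_derive_asin_odd (y : R) : `|y| < 1 -> is_derive y 1 asin_odd (g y).
Proof.
move=> y1; pose c := (`|y| + 1) / 2.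
have c01 : 0 < c < 1 by have := normr_ge0 y; rewrite /c; lra.
have yc : `|y| < c by rewrite /c; lra.
have [F [dF F1 F2]] := gtrig_primitive c01.
apply: (@near_eq_is_derive _ _ _ (fun t => F t - F 0)) => //.
  have : `|y| < c by []. rewrite -subr_gt0 => d0.
  apply/nbhs_ballP; exists (c - `|y|) => //= z; rewrite /ball /= => yz.
  have zc : `|z| <= c.
    by have := ler_normB y (y - z); rewrite subKr; lra.
  rewrite /asin_odd; have [z0|z0] := leP 0 z.
    by rewrite F1 // z0 -(ger0_norm z0).
  by rewrite F2 ?opprK // oppr_ge0 (ltW z0) /= -(ltr0_norm z0).
rewrite -[X in is_derive _ _ _ X]subr0; apply: is_deriveB.
by apply: dF; lra.
Qed.

(** Continuity relative to [[-1, 1]], as the derivative blows up at the ends: at 1 an integral is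
    continuous in its upper bound, at -1 oddness applies, and in between differentiability. *)
Lemma asin_odd_eps (y e : R) : -1 <= y <= 1 -> 0 < e -> exists2 d : R, 0 < d &
  forall z : R, -1 <= z <= 1 -> `|z - y| < d -> `|asin_odd z - asin_odd y| < e.
Proof.
have at1 (e' : R) : 0 < e' -> exists2 d : R, 0 < d &
  forall z : R, -1 <= z <= 1 -> `|z - 1| < d -> `|asin_odd z - asin_odd 1| < e'.
  move=> e0.
  have /subspace_continuousP := parameterized_integral_continuous (@ler01 R) gtrig_integrable.
  move=> /(_ 1); rewrite /= in_itv /= ler01 lexx => /(_ isT) /cvgrPdist_lt /(_ _ e0).
  rewrite /within /= => /nbhs_ballP[d /= d0 H].
  exists (Num.min 1 d); first by rewrite lt_min ltr01.
  move=> z z1; rewrite lt_min => /andP[h1 h2].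
  have z0 : 0 <= z by move: h1; rewrite ltr_norml; lra.
  rewrite !asin_oddE // distrC; apply: (H z); last by rewrite in_itv /=; lra.
  by rewrite /ball /= distrC.
move=> y1 e0; have [yy|yy] := eqVneq y 1; first by rewrite yy; exact: at1.
have [yy'|yy'] := eqVneq y (-1).
  rewrite yy'; have [d d0 H] := at1 _ e0; exists d => // z z1 zd.
  have -> : asin_odd z - asin_odd (-1) = - (asin_odd (- z) - asin_odd 1) by rewrite !asin_oddN; ring.
  rewrite normrN; apply: H; first by lra.
  have -> : - z - 1 = - (z - -1) by ring.
  by rewrite normrN.
have : `|y| < 1 by rewrite ltr_norml !lt_neqAle eq_sym yy' yy; lra.
move/is_derive_asin_odd/is_derive_continuous/continuous_epsP/(_ _ e0) => [d d0 H].
by exists d => // z _; exact: H.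
Qed.

Lemma arcsin_lt (x y : R) : 0 <= x -> x < y -> y <= 1 -> As x < As y.
Proof.
move=> x0 xy y1.
have cw : {within `[x, y], continuous asin_odd}.
  apply/subspace_continuousP => z; rewrite /= in_itv /= => zxy.
  apply/cvgrPdist_lt => e e0.
  have [d d0 H] := @asin_odd_eps z e ltac:(lra) e0.
  apply/nbhs_ballP; exists d => //= t; rewrite /ball /= => zt.
  by rewrite in_itv /= => txy; rewrite distrC; apply: H; [lra|rewrite distrC].
have dd t : x < t < y -> is_derive t 1 asin_odd (g t).
  by move=> txy; apply: is_derive_asin_odd; rewrite ger0_norm; lra.
have [c cxy] := mvt xy dd cw.
rewrite !asin_oddE //; last by lra.
move=> e; rewrite -subr_gt0 e mulr_gt0 ?subr_gt0 //.
by apply: gtrig_gt0; rewrite ger0_norm; lra.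
Qed.

Lemma arcsin_inj (x y : R) : 0 <= x <= 1 -> 0 <= y <= 1 -> As x = As y -> x = y.
Proof.
move=> hx hy e; have [h|h|//] := ltgtP x y.
- by have := @arcsin_lt x y ltac:(lra) h ltac:(lra); lra.
- by have := @arcsin_lt y x ltac:(lra) h ltac:(lra); lra.
Qed.

Lemma asin_odd_lt (x y : R) : -1 <= x -> x < y -> y <= 1 -> asin_odd x < asin_odd y.
Proof.
move=> x0 xy y1; rewrite /asin_odd.
have [hx|hx] := leP 0 x; have [hy|hy] := leP 0 y; try lra.
- exact: arcsin_lt.
- have := @arcsin_lt 0 (- x) ltac:(lra) ltac:(lra) ltac:(lra); rewrite arcsin0.
  have [->|y0] := eqVneq y 0; first by rewrite arcsin0; lra.
  have := @arcsin_lt 0 y ltac:(lra) ltac:(by rewrite lt_neqAle eq_sym y0) ltac:(lra).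
  by rewrite arcsin0; lra.
- by rewrite ltrN2; apply: arcsin_lt; lra.
Qed.

Notation pia := (@pi_a R a).

Lemma pi_aE : As 1 = pia / 2.
Proof. by rewrite /pi_a /arcsin_a; field. Qed.

Lemma pi_a_gt0 : 0 < pia.
Proof.
have := @arcsin_lt 0 1 ltac:(lra) ltac:(lra) ltac:(lra); rewrite arcsin0 pi_aE; lra.
Qed.

Lemma sin_baseE (y : R) : 0 <= y <= 1 -> sin_a_base a (As y) = y.
Proof.
move=> y1; rewrite /sin_a_base; case: xgetP => [z _ [z1 e]|/(_ y) /= H].
  exact: arcsin_inj.
by exfalso; apply: H.
Qed.

Lemma sin_base0 : sin_a_base a (0 : R) = 0.
Proof. by rewrite -[X in sin_a_base a X]arcsin0 sin_baseE // lexx ler01. Qed.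

Lemma arcsin_surj (s : R) : 0 <= s <= pia / 2 -> exists2 y, 0 <= y <= 1 & As y = s.
Proof.
move=> s1.
have cw : {within `[0, 1], continuous asin_odd}.
  apply/subspace_continuousP => z; rewrite /= in_itv /= => zxy.
  apply/cvgrPdist_lt => e e0.
  have [d d0 H] := @asin_odd_eps z e ltac:(lra) e0.
  apply/nbhs_ballP; exists d => //= t; rewrite /ball /= => zt.
  by rewrite in_itv /= => txy; rewrite distrC; apply: H; [lra|rewrite distrC].
have [|y] := IVT (@ler01 R) cw (v := s).
  rewrite !asin_oddE // arcsin0 pi_aE ge_min le_max.
  by move/andP: s1 => [-> ->]; rewrite orbT.
rewrite in_itv /= => y1; rewrite asin_oddE; last by lra.
by move=> <-; exists y.
Qed.

Lemma sin_base_bound (s : R) : 0 <= s <= pia / 2 ->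
  0 <= sin_a_base a s <= 1 /\ As (sin_a_base a s) = s.
Proof. by move=> /arcsin_surj[y y1 <-]; rewrite sin_baseE. Qed.


Lemma is_derive_sin_base (s : R) : 0 < s < pia / 2 ->
  is_derive s 1 (sin_a_base a) (Num.sqrt (1 - sin_a_base a s ^+ (2 * a))).
Proof.
move=> s1; have [y y1 e] : exists2 y, 0 <= y <= 1 & As y = s by apply: arcsin_surj; lra.
have y0 : y != 0 by apply/eqP => y0; move: s1; rewrite -e y0 arcsin0 ltxx.
have y0' : y != 1 by apply/eqP => y0'; move: s1; rewrite -e y0' pi_aE ltxx andbF.
have {y0'}y1' : 0 < y < 1 by rewrite !lt_neqAle eq_sym y0 y0'; lra.
have ya : `|y| < 1 by rewrite gtr0_norm; lra.
rewrite -{1 2}e sin_baseE // -gtrigV.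
have D : is_derive y 1 As (g y).
  apply: (@near_eq_is_derive _ _ _ asin_odd) (is_derive_asin_odd ya) => //.
  by near=> z'; rewrite asin_oddE //; apply: ltW; near: z'; apply: lt_nbhsr; lra.
apply: is_derive_inverse D _; last by rewrite gt_eqF // gtrig_gt0.
- near=> z; rewrite sin_baseE //; apply/andP; split; apply: ltW; near: z; [apply: lt_nbhsr|apply: lt_nbhsl]; lra.
- near=> z; have z1 : 0 < z < 1 by apply/andP; split; near: z; [apply: lt_nbhsr|apply: lt_nbhsl]; lra.
  have za : `|z| < 1 by rewrite gtr0_norm; lra.
  have : is_derive z 1 As (g z).
    apply: (@near_eq_is_derive _ _ _ asin_odd) (is_derive_asin_odd za) => //.
    by near=> z'; rewrite asin_oddE //; apply: ltW; near: z'; apply: lt_nbhsr; lra.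
  exact: is_derive_continuous.
Unshelve. all: by end_near. Qed.

Lemma sin_half_pi2 : sin_a_half a (pia / 2) = 1.
Proof. by rewrite /sin_a_half lexx -pi_aE sin_baseE // lexx ler01. Qed.

(* At the maximum the difference quotient is bounded by [(1 - y) / (As 1 - As y)], and the
   integrand of [As] blows up at 1. *)
Lemma is_derive_sin_half_pi2 : is_derive (pia / 2) 1 (sin_a_half a) 0.
Proof.
apply/is_derive_epsP => e e0.
have p0 := pi_a_gt0.
have : {for (1 : R), continuous (fun t : R => Num.sqrt (1 - t ^+ (2 * a)))}.
  apply: (@continuous_comp _ _ _ (fun t : R => 1 - t ^+ (2 * a)) Num.sqrt).
    exact: continuous_pow2a.
  exact: sqrt_continuous.
move/continuous_epsP/(_ _ e0) => [d d0]; rewrite expr1n subrr sqrtr0 => Hd.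
pose y0 := Num.max (1 / 2) (1 - d / 2).
have [y00 y01 y0d] : [/\ 1 / 2 <= y0, y0 < 1 & 1 - d / 2 <= y0].
  by rewrite /y0 gt_max !le_max !lexx orbT; split => //; apply/andP; split; lra.
have hA := @arcsin_lt y0 1 ltac:(lra) y01 ltac:(lra).
exists (Num.min (pia / 2) (As 1 - As y0)); first by rewrite lt_min; apply/andP; split; lra.
move=> r; rewrite lt_min => /andP[r1 r2].
rewrite mul0r subr0 sin_half_pi2.
have [y [y1 yE sE]] : exists y : R, [/\ 0 <= y <= 1, As 1 - As y = `|r - pia / 2| & sin_a_half a r = y].
  rewrite /sin_a_half; have [h|h] := leP r (pia / 2).
    have [] := @sin_base_bound r; first by move: r1; rewrite ltr_norml; lra.
    move=> ? E; exists (sin_a_base a r); split => //.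
    by rewrite E pi_aE ler0_norm; lra.
  have [] := @sin_base_bound (pia - r); first by move: r1; rewrite ltr_norml; lra.
  move=> ? E; exists (sin_a_base a (pia - r)); split => //.
  by rewrite E pi_aE gtr0_norm; lra.
rewrite sE -yE.
have [->|yn1] := eqVneq y 1; first by rewrite !subrr normr0 mulr0.
have yy0 : y0 < y.
  rewrite ltNge le_eqVlt; apply/negP => /predU1P[yy|yy]; first by move: r2; rewrite -yE yy; lra.
  by have := @arcsin_lt y y0 ltac:(lra) yy ltac:(lra); lra.
have ylt1 : y < 1 by rewrite lt_neqAle yn1; lra.
have cw : {within `[y, 1], continuous asin_odd}.
  apply/subspace_continuousP => z; rewrite /= in_itv /= => zxy.
  apply/cvgrPdist_lt => e' e0'.
  have [d' d0' H] := @asin_odd_eps z e' ltac:(lra) e0'.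
  apply/nbhs_ballP; exists d' => //= t; rewrite /ball /= => zt.
  by rewrite in_itv /= => txy; rewrite distrC; apply: H; [lra|rewrite distrC].
have dd t : y < t < 1 -> is_derive t 1 asin_odd (g t).
  by move=> txy; apply: is_derive_asin_odd; rewrite ger0_norm; lra.
have [c cxy] := mvt ylt1 dd cw.
rewrite !asin_oddE //; [|lra..] => ->.
have gc : e * g c >= 1.
  have c1 : `|c| < 1 by rewrite ger0_norm; lra.
  rewrite /gtrig_integrand ler_pdivlMr ?sqrt_pow2a_gt0 // mul1r.
  have := Hd c; rewrite subr0 (ger0_norm (sqrtr_ge0 _)) => h; apply: ltW; apply: h.
  by rewrite ltr0_norm; lra.
rewrite ler0_norm; last by lra.
by have h : 0 <= (e * g c - 1) * (1 - y); [apply: mulr_ge0; lra|lra].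
Qed.

(** Only the square of the derivative is recorded, since its sign differs on the two sides of
    [pi_a / 2]. *)
Lemma is_derive_sin_half (s : R) : 0 < s < pia ->
  exists2 D : R, is_derive s 1 (sin_a_half a) D & D ^+ 2 = 1 - sin_a_half a s ^+ (2 * a).
Proof.
move=> s1; have sq (y : R) : 0 <= y <= 1 -> Num.sqrt (1 - y ^+ (2 * a)) ^+ 2 = 1 - y ^+ (2 * a).
  move=> y1; rewrite sqr_sqrtr // subr_ge0; apply: le_trans (pow2a_le _) _; rewrite ger0_norm; lra.
have [h|h|->] := ltgtP s (pia / 2).
- exists (Num.sqrt (1 - sin_a_base a s ^+ (2 * a))).
    apply: (@near_eq_is_derive _ _ _ (sin_a_base a)) (is_derive_sin_base _) => //; last by lra.
    near=> t; rewrite /sin_a_half ifT //; apply: ltW; near: t; exact: lt_nbhsl.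
  rewrite /sin_a_half ifT ?ltW // sq //.
  by have [] := @sin_base_bound s ltac:(lra).
- exists (- Num.sqrt (1 - sin_a_base a (pia - s) ^+ (2 * a))).
    apply: (@near_eq_is_derive _ _ _ (sin_a_base a \o (fun t => pia - t))) => //.
      near=> t; rewrite /sin_a_half ifF //; apply/negbTE; rewrite -ltNge; near: t; exact: lt_nbhsr.
    have h1 : is_derive s 1 (fun t : R => pia - t) (-1).
      by rewrite -[X in is_derive _ _ _ X]add0r; apply: is_deriveB.
    have h2 := @is_derive_sin_base (pia - s) ltac:(lra).
    by rewrite -[X in is_derive _ _ _ X]mulrN1; apply: is_derive1_comp.
  rewrite sqrrN /sin_a_half ifF; last by apply/negbTE; rewrite -ltNge.
  by rewrite sq //; have [] := @sin_base_bound (pia - s) ltac:(lra).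
- exists 0; first exact: is_derive_sin_half_pi2.
  by rewrite sin_half_pi2 expr1n subrr expr0n.
Unshelve. all: by end_near. Qed.

Lemma sin_a_lo (s : R) : - pia <= s < pia ->
  sin_a a s = if 0 <= s then sin_a_half a s else - sin_a_half a (- s).
Proof.
move=> s1; have p0 := pi_a_gt0; rewrite /sin_a.
have -> : Num.floor ((s + pia) / (2 * pia)) = 0.
  by apply/eqP; rewrite floor_eq /= ?divr_ge0 ?ltr_pdivrMr //; lra.
by rewrite mulr0 subr0.
Qed.

Lemma sin_a_hi (s : R) : pia <= s < 3 * pia ->
  sin_a a s = sin_a a (s - 2 * pia).
Proof.
move=> s1; have p0 := pi_a_gt0; rewrite [RHS]sin_a_lo; last by lra.
rewrite /sin_a.
have -> : Num.floor ((s + pia) / (2 * pia)) = 1.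
  by apply/eqP; rewrite floor_eq /= ?ler_pdivlMr ?ltr_pdivrMr //; lra.
by rewrite mulr1.
Qed.

(** The condition [sin_a a s != 0] keeps [s] off 0 and [pi_a], where the pieces of the extension
    meet; elsewhere [sin_a] is locally [sin_a_half] or minus its reflection. *)
Lemma cos_sqr_add_sin (s : R) : 0 <= s < 2 * pia -> sin_a a s != 0 ->
  cos_a a s ^+ 2 = 1 - sin_a a s ^+ (2 * a).
Proof.
move=> s1 s0; have p0 := pi_a_gt0.
suff [D dD <-] : exists2 D : R, is_derive s 1 (sin_a a) D & D ^+ 2 = 1 - sin_a a s ^+ (2 * a).
  by rewrite /cos_a derive1E; case: dD => _ ->.
have sn0 : s != 0.
  apply: contraNneq s0 => ->; rewrite sin_a_lo; last by lra.
  by rewrite lexx /sin_a_half ifT ?sin_base0 //; lra.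
have snp : s != pia.
  apply: contraNneq s0 => ->; rewrite sin_a_hi; last by lra.
  rewrite sin_a_lo; last by lra.
  rewrite ifF; last by apply/negbTE; rewrite -ltNge; lra.
  rewrite /sin_a_half ifF; last by apply/negbTE; rewrite -ltNge; lra.
  by rewrite (_ : pia - _ = 0) ?sin_base0 ?oppr0 //; ring.
have s0' : 0 < s by rewrite lt_neqAle eq_sym sn0; lra.
have [h|h|e] := ltgtP s pia; last by rewrite e eqxx in snp.
- have [D dD DE] : exists2 D : R, is_derive s 1 (sin_a_half a) D & D ^+ 2 = 1 - sin_a_half a s ^+ (2 * a).
    by apply: is_derive_sin_half; lra.
  have e0 (t : R) : 0 < t < pia -> sin_a a t = sin_a_half a t.
    by move=> t1; rewrite sin_a_lo ?ifT //; lra.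
  exists D; last by rewrite e0 //; lra.
  apply: (@near_eq_is_derive _ _ _ (sin_a_half a)) => //.
  by near=> t; rewrite e0 //; apply/andP; split; near: t; [exact: lt_nbhsr|exact: lt_nbhsl].
- have [D dD DE] : exists2 D : R, is_derive (2 * pia - s) 1 (sin_a_half a) D &
      D ^+ 2 = 1 - sin_a_half a (2 * pia - s) ^+ (2 * a).
    by apply: is_derive_sin_half; lra.
  have e0 (t : R) : pia < t < 2 * pia -> sin_a a t = - sin_a_half a (2 * pia - t).
    move=> t1; rewrite sin_a_hi; last by lra.
    rewrite sin_a_lo; last by lra.
    by rewrite ifF ?opprB //; apply/negbTE; rewrite -ltNge; lra.
  exists D; last by rewrite e0 ?pow2aN //; lra.
  apply: (@near_eq_is_derive _ _ _ (fun t => - (sin_a_half a \o (fun t => 2 * pia - t)) t)) => //.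
    near=> t; rewrite /= e0 //; apply/andP; split; near: t; [exact: lt_nbhsr|apply: lt_nbhsl; lra].
  have h1 : is_derive s 1 (fun t : R => 2 * pia - t) (-1).
    by rewrite -[X in is_derive _ _ _ X]add0r; apply: is_deriveB.
  have h2 : is_derive s 1 (sin_a_half a \o (fun t => 2 * pia - t)) (D * -1) by apply: is_derive1_comp.
  by rewrite -[D]opprK -[X in - X]mulrN1; apply: is_deriveN.
Unshelve. all: by end_near. Qed.

End GeneralizedTrigonometry.

(** * Half-periods of the oscillator *)

Section HalfPeriod.
Variable R : realType.
Variable a : nat.
Hypothesis a0 : (0 < a)%N.
Variables (s dS : R -> R) (w be : R).
Hypotheses (Hs : is_clock s dS) (w0 : 0 < w) (be0 : 0 < be).
(* [F] and [P] play the roles of [asin_odd a] and [pi_a a]. *)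
Variables (F : R -> R) (P : R).
Hypotheses (P0 : 0 < P) (F1E : F 1 = P / 2) (FN : forall y, F (- y) = - F y)
  (F_lt : forall x y : R, -1 <= x -> x < y -> y <= 1 -> F x < F y)
  (F_derive : forall y : R, `|y| < 1 -> is_derive y 1 F (gtrig_integrand a y))
  (F_eps : forall y e : R, -1 <= y <= 1 -> 0 < e -> exists2 d : R, 0 < d &
     forall z : R, -1 <= z <= 1 -> `|z - y| < d -> `|F z - F y| < e).

Lemma F_inj (x y : R) : -1 <= x <= 1 -> -1 <= y <= 1 -> F x = F y -> x = y.
Proof.
move=> hx hy e; have [h|h|//] := ltgtP x y.
- by have := @F_lt x y ltac:(lra) h ltac:(lra); lra.
- by have := @F_lt y x ltac:(lra) h ltac:(lra); lra.
Qed.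

(** Here [u] will be the coordinate over its amplitude and [v] the momentum over the square root of
    its energy; the factor [dS] means that derivatives are taken in the clock. *)
Definition oscillates (u v : R -> R) : Prop :=
  [/\ forall t : R, is_derive t 1 u (w * dS t * v t),
      forall t : R, is_derive t 1 v (- (be * dS t * u t ^+ (2 * a).-1)) &
      forall t : R, v t ^+ 2 + u t ^+ (2 * a) = 1].

Lemma odd_2aN (x : R) : (- x) ^+ (2 * a).-1 = - x ^+ (2 * a).-1.
Proof.
have e : (2 * a).-1 = (2 * a.-1).+1 by case: a a0 => // b _; rewrite mulnS.
by rewrite e !exprS !exprM sqrrN mulNr.
Qed.

Lemma oscillatesN u v : oscillates u v -> oscillates (fun t => - u t) (fun t => - v t).
Proof.
move=> [h1 h2 h3]; split => t.
- by rewrite mulrN; apply: is_deriveN.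
- by rewrite odd_2aN mulrN; apply: is_deriveN.
- by rewrite sqrrN pow2aN.
Qed.

Lemma osc_bound u v t : oscillates u v -> -1 <= u t <= 1.
Proof.
by case=> _ _ /(_ t) e; apply: (pow2a_le1 a0); rewrite -e lerDr sqr_ge0.
Qed.

(** While [v] is positive it equals [sqrt (1 - u ^ (2 a))], the reciprocal of [F'(u)], so the phase
    [F u] advances at constant speed [w] in the clock. At the endpoints, possibly turning points,
    continuity is enough. *)
Lemma osc_rise u v x y : oscillates u v -> x <= y -> (forall t, x < t < y -> 0 < v t) ->
  F (u y) - F (u x) = w * (s y - s x).
Proof.
move=> H; rewrite le_eqVlt => /predU1P[<- _|xy vp]; first by rewrite !subrr mulr0.
have [h1 h2 h3] := H.
pose f t := F (u t) - w * s t.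
suff : f x = f y by rewrite /f; lra.
have cf : {within `[x, y], continuous f}.
  apply: continuous_in_subspaceT => t _.
  apply: (@continuousB _ _ _ (F \o u) (fun t => w * s t)).
    apply/continuous_epsP => e e0.
    have [d d0 Hd] := F_eps (osc_bound t H) e0.
    have /continuous_epsP/(_ _ d0)[d' d'0 Hd'] := is_derive_continuous (h1 t).
    by exists d' => // r rt; apply: Hd; [exact: osc_bound H|exact: Hd'].
  apply: (@continuousM _ _ (cst w)); first exact: cvg_cst.
  exact: clock_continuous Hs.
have df t : x < t < y -> is_derive t 1 f 0.
  move=> /vp v0; have ut : `|u t| < 1.
    rewrite ltNge; apply/negP => ut; have := h3 t.
    have : 1 <= u t ^+ (2 * a).
      rewrite exprM exprn_ege1 // -real_normK ?num_real // expr_ge1 //.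
    have : 0 < v t ^+ 2 by rewrite exprn_gt0.
    lra.
  have vE : v t = Num.sqrt (1 - u t ^+ (2 * a)).
    by rewrite -(h3 t) addrK sqrtr_sqr gtr0_norm.
  have [hs _] := Hs.
  have F1e : is_derive t 1 (F \o u) (gtrig_integrand a (u t) * (w * dS t * v t)).
    by have := h1 t; have := F_derive ut => ? ?; apply: is_derive1_comp.
  have e2 : is_derive t 1 (fun t => w * s t) (w * dS t).
    by have := hs t => ?; exact: is_deriveZ.
  apply: is_derive_eq.
  rewrite /gtrig_integrand -vE; field; lra.
have [c _] := mvt xy df cf.
by rewrite mul0r; lra.
Qed.

Lemma osc_fall u v x y : oscillates u v -> x <= y -> (forall t, x < t < y -> v t < 0) ->
  F (u y) - F (u x) = - (w * (s y - s x)).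
Proof.
move=> H xy vn; have := @osc_rise _ _ x y (oscillatesN H) xy.
rewrite !FN => <-; first by ring.
by move=> t /vn; rewrite oppr_gt0.
Qed.

Lemma F_bound (y : R) : -1 <= y <= 1 -> - (P / 2) <= F y <= P / 2.
Proof.
move=> y1.
rewrite -F1E -FN; apply/andP; split.
  have [->//|n] := eqVneq y (-1); apply: ltW; apply: F_lt => //; last by lra.
  by rewrite lt_def n; lra.
have [->//|n] := eqVneq y 1; apply: ltW; apply: F_lt => //; first by lra.
by rewrite lt_neqAle n; lra.
Qed.

Lemma osc_turn u v t : oscillates u v -> v t = 0 -> u t = 1 \/ u t = -1.
Proof.
move=> H v0; have [_ _ /(_ t)] := H; rewrite v0 expr0n /= add0r => e.
have ub := osc_bound t H.
have : 1 <= `|u t|.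
  rewrite leNgt; apply/negP => h; have := pow2a_lt1 a0 h; lra.
by have [h|h] := leP 0 (u t); [rewrite ger0_norm // => ?; left; lra|rewrite ltr0_norm // => ?; right; lra].
Qed.

(* At the first turning point [s1] the phase is [pi_a / 2]; a second one inside the interval
   would be a whole half-period later. *)
Lemma half_period_pos u v t1 t2 : oscillates u v -> 0 < v t1 ->
  w * (s t2 - s t1) = P -> u t2 = - u t1 /\ v t2 < 0.
Proof.
move=> H v1 hs; have [h1 h2 h3] := H.
have p0 := P0.
have cv t : {for t, continuous v} by exact: is_derive_continuous (h2 t).
have t12 : t1 < t2.
  rewrite -(clock_ltE _ _ Hs) -subr_gt0 -(pmulr_rgt0 _ w0); lra.
have en1 : F (-1 : R) = - (P / 2) by rewrite FN F1E.
have u1n : F (u t1) != - (P / 2).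
  apply/eqP => e; have ue : u t1 = -1.
    by apply: F_inj; [exact: osc_bound H|lra|rewrite en1].
  have := h3 t1; rewrite ue pow2aN expr1n => ?.
  have : 0 < v t1 ^+ 2 by rewrite exprn_gt0.
  lra.
(* Otherwise the phase would rise by [P], the full width of its range, hence start at [- P / 2],
   that is at [u = -1], where [v] vanishes. *)
have [r r12 vr] : exists2 r, t1 < r < t2 & v r <= 0.
  apply: contrapT => Hn.
  have vp t : t1 < t < t2 -> 0 < v t.
    by move=> tt; rewrite ltNge; apply/negP => vt; apply: Hn; exists t.
  have := osc_rise H (ltW t12) vp.
  have := F_bound (osc_bound t1 H); have := F_bound (osc_bound t2 H).
  by move: u1n; rewrite hs neq_lt => /orP[]; lra.
have [s1 s1r [vs1 vp]] : exists2 s1, t1 < s1 <= r & v s1 = 0 /\ forall t, t1 <= t < s1 -> 0 < v t.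
  by apply: first_zero => //; lra.
have hr : F (u s1) - F (u t1) = w * (s s1 - s t1).
  by apply: osc_rise => //; [lra|move=> t tt; apply: vp; lra].
have s1p : 0 < w * (s s1 - s t1) by rewrite mulr_gt0 // subr_gt0 (clock_ltE _ _ Hs); lra.
have us1 : u s1 = 1.
  have [//|us1] := osc_turn H vs1.
  by have := F_bound (osc_bound t1 H); rewrite us1 en1 in hr; lra.
rewrite us1 F1E in hr.
have us1p : 0 < u s1 by rewrite us1.
have [d d0 Hd] : exists2 d : R, 0 < d & forall t : R, `|t - s1| < d -> 0 < u t.
  have un0 : u s1 != 0 by rewrite us1 oner_eq0.
  have [d d0 Hd] := continuous_sign (is_derive_continuous (h1 s1)) un0.
  by exists d => // t /Hd; rewrite us1 mulr1.
have [hsd [dS0 dSp]] := Hs.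
(* Near [s1], where [u] is positive, [v] does not increase; it cannot stay at 0 either, since its
   derivative is nonzero wherever that of the clock is. *)
have vneg t : s1 < t < s1 + d -> v t < 0.
  move=> td.
  have vd x y : s1 <= x -> x <= y -> y <= t -> v y <= v x.
    move=> sx xy yt; rewrite -lerN2.
    apply: (@ge0_derive_le _ (fun t => - v t) (fun t => be * dS t * u t ^+ (2 * a).-1) x y) => //.
      by move=> z _; rewrite -[be * _ * _]opprK; apply: is_deriveN.
    move=> z zxy; rewrite mulr_ge0 ?mulr_ge0 ?dS0 ?(ltW be0) ?exprn_ge0 //.
    by apply: ltW; apply: Hd; rewrite ger0_norm; lra.
  have vt0 : v t <= 0 by rewrite -vs1; apply: vd; lra.
  rewrite lt_neqAle vt0 andbT; apply/eqP => vt.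
  have [d' d'0 Hd'] := dSp s1.
  pose z := s1 + Num.min ((t - s1) / 2) (d' / 2).
  have [z1 z2 z3] : [/\ s1 < z, z < t & z < s1 + d'].
    have m0 : 0 < Num.min ((t - s1) / 2) (d' / 2) by rewrite lt_min; apply/andP; split; lra.
    have m1 : Num.min ((t - s1) / 2) (d' / 2) <= (t - s1) / 2 by rewrite ge_min lexx.
    have m2 : Num.min ((t - s1) / 2) (d' / 2) <= (d' / 2) by rewrite ge_min lexx orbT.
    by rewrite /z; split; lra.
  have vz y : s1 <= y <= t -> v y = 0.
    move=> yt; have := vd s1 y ltac:(lra) ltac:(lra) ltac:(lra).
    by have := vd y t ltac:(lra) ltac:(lra) ltac:(lra); lra.
  have zd : is_derive z 1 v 0.
    apply: (@near_eq_is_derive _ _ _ (cst 0)) => //.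
    near=> y; rewrite vz //; apply/andP; split; apply: ltW; near: y; [exact: lt_nbhsr|exact: lt_nbhsl].
  have := h2 z; case: zd => _ e [_]; rewrite e.
  have : 0 < be * dS z * u z ^+ (2 * a).-1.
    rewrite !mulr_gt0 ?exprn_gt0 //; first by apply: Hd'; rewrite gtr0_norm; lra.
    by apply: Hd; rewrite gtr0_norm; lra.
  lra.
(* At a second zero of [v] the phase would have fallen by 0 or by [P] since [s1], but its fall up to
   [t2] is positive and less than [P]. *)
have vneg2 t : s1 < t <= t2 -> v t < 0.
  move=> st; rewrite ltNge; apply/negP => vt.
  pose t0 := s1 + Num.min ((t - s1) / 2) (d / 2).
  have [z1 z2 z3] : [/\ s1 < t0, t0 < t & t0 < s1 + d].
    have m0 : 0 < Num.min ((t - s1) / 2) (d / 2) by rewrite lt_min; apply/andP; split; lra.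
    have m1 : Num.min ((t - s1) / 2) (d / 2) <= (t - s1) / 2 by rewrite ge_min lexx.
    have m2 : Num.min ((t - s1) / 2) (d / 2) <= (d / 2) by rewrite ge_min lexx orbT.
    by rewrite /t0; split; lra.
  have [s2 s2t [vs2 vn]] : exists2 s2, t0 < s2 <= t & - v s2 = 0 /\ forall t, t0 <= t < s2 -> 0 < - v t.
    apply: (@first_zero _ (fun t => - v t)) => //.
    - by move=> z _; apply: continuousN; exact: cv.
    - by rewrite oppr_gt0; apply: vneg; lra.
    - by rewrite oppr_le0.
  have hf : F (u s2) - F (u s1) = - (w * (s s2 - s s1)).
    apply: osc_fall => //; first by lra.
    move=> z zz; have [h|h] := leP t0 z; last by apply: vneg; lra.
    by rewrite -oppr_gt0; apply: vn; lra.
  have s2p : 0 < w * (s s2 - s s1) by rewrite mulr_gt0 // subr_gt0 (clock_ltE _ _ Hs); lra.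
  have s2m : 0 <= w * (s t2 - s s2) by rewrite mulr_ge0 ?(ltW w0) // subr_ge0 (clock_leE _ _ Hs); lra.
  rewrite us1 F1E in hf.
  have vs2' : v s2 = 0 by lra.
  have [us2|us2] := osc_turn H vs2'.
    by rewrite us2 F1E in hf; lra.
  by rewrite us2 en1 in hf; lra.
split; last by apply: vneg2; lra.
have hf : F (u t2) - F (u s1) = - (w * (s t2 - s s1)).
  by apply: osc_fall => //; [lra|move=> z zz; apply: vneg2; lra].
rewrite us1 F1E in hf.
apply: F_inj; [exact: osc_bound H| |].
  by have := osc_bound t1 H; lra.
by rewrite FN; lra.
Unshelve. all: by end_near. Qed.

Lemma half_period_of u v t1 t2 : oscillates u v -> v t1 != 0 ->
  w * (s t2 - s t1) = P -> u t2 = - u t1 /\ v t2 * v t1 < 0.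
Proof.
move=> H; rewrite neq_lt => /orP[v1|v1] hs; last first.
  have [-> h] := half_period_pos H v1 hs; split => //; nra.
have v1' : 0 < - v t1 by rewrite oppr_gt0.
have [e h] := half_period_pos (oscillatesN H) v1' hs; split; first by lra.
by nra.
Qed.

End HalfPeriod.

Lemma half_period (R : realType) (a : nat) (s dS : R -> R) (w be : R) (u v : R -> R) t1 t2 :
  (0 < a)%N -> is_clock s dS -> 0 < w -> 0 < be -> oscillates a dS w be u v ->
  v t1 != 0 -> w * (s t2 - s t1) = pi_a R a -> u t2 = - u t1 /\ v t2 * v t1 < 0.
Proof.
move=> a0 Hs w0 be0; apply: (@half_period_of R a a0 s dS w be Hs w0 be0 (asin_odd a) (pi_a R a)).
- exact: pi_a_gt0.
- by rewrite asin_oddE // pi_aE.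
- exact: asin_oddN.
- exact: asin_odd_lt.
- exact: is_derive_asin_odd.
- exact: asin_odd_eps.
Qed.

(** * Conserved energies *)

Section Energies.
Variables (R : realType) (n : nat) (alpha : 'I_n -> nat).
Implicit Types (x p : 'I_n.+1 -> R) (k m : nat).

(** [seg x 0 j] is [xi_j]; with lower end [k] it is the analogue of [xi_j] in the subsystem of the
    coordinates from [k] on. *)
Definition seg x k m : R := \prod_(i < n | (k <= i < m)%N) x (wid i) ^+ alpha i.

Lemma xi_seg x (j : 'I_n.+1) : xi alpha x j = seg x 0 j.
Proof. by []. Qed.

Lemma segkk x k : seg x k k = 1.
Proof.
by rewrite /seg big_pred0 // => i; apply/negP => /andP[h1 h2]; move: (leq_trans h2 h1); rewrite ltnn.
Qed.

Lemma segS x k (m : 'I_n) : (k <= m)%N -> seg x k m.+1 = seg x k m * x (wid m) ^+ alpha m.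
Proof.
move=> km; rewrite /seg (bigD1 m) /=; last by rewrite km ltnSn.
rewrite mulrC; congr (_ * _); apply: eq_bigl => i.
rewrite ltnS -andbA; congr (_ && _).
by rewrite andbC ltn_neqAle.
Qed.

Lemma seg_recl x (k : 'I_n) m : (k < m)%N -> seg x k m = x (wid k) ^+ alpha k * seg x k.+1 m.
Proof.
move=> km; rewrite /seg (bigD1 k) /=; last by rewrite leqnn km.
congr (_ * _); apply: eq_bigl => i.
by rewrite andbAC; congr (_ && _); rewrite andbC eq_sym -ltn_neqAle.
Qed.

Lemma seg_cat x k l m : (k <= l <= m)%N -> seg x k m = seg x k l * seg x l m.
Proof.
move=> /andP[kl lm]; rewrite /seg (bigID (fun i : 'I_n => (i < l)%N)) /=.
congr (_ * _); apply: eq_bigl => i.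
  rewrite -andbA; congr (_ && _); apply: andb_idl => il; exact: leq_trans lm.
rewrite -leqNgt; case: (leqP l i) => h; last by rewrite andbF.
by rewrite (leq_trans kl h) andbT.
Qed.

Lemma seg_neq0 x k m : (forall i : 'I_n, (k <= i < m)%N -> x (wid i) ^+ alpha i != 0) -> seg x k m != 0.
Proof. by move=> H; apply/prodf_neq0 => i /H. Qed.

Lemma eq_seg x y k m : (forall i : 'I_n, (k <= i < m)%N -> x (wid i) = y (wid i)) ->
  seg x k m = seg y k m.
Proof. by move=> H; apply: eq_bigr => i /H ->. Qed.

(** Twice the Hamiltonian of that subsystem, so that unit speed means [energy x p 0 = 1]. *)
Definition energy x p k : R := \sum_(j < n.+1 | (k <= j)%N) (seg x k j * p j) ^+ 2.

Lemma Ham_energy x p : Ham alpha x p = 2^-1 * energy x p 0.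
Proof. by rewrite /Ham; congr (_ * _); apply: eq_bigr => j _; rewrite exprMn. Qed.

Lemma energy_max x p : energy x p n = p ord_max ^+ 2.
Proof.
rewrite /energy (bigD1 ord_max) //= segkk mul1r big1 ?addr0 // => j /andP[h1 h2].
by move: h2; rewrite -val_eqE /= eqn_leq h1 -ltnS ltn_ord.
Qed.

Lemma energyS x p (k : 'I_n) :
  energy x p k = p (wid k) ^+ 2 + x (wid k) ^+ (2 * alpha k) * energy x p k.+1.
Proof.
rewrite /energy (bigD1 (wid k)) //= segkk mul1r; congr (_ + _).
rewrite mulr_sumr; apply: eq_big => j.
  by rewrite -val_eqE /= andbC eq_sym -ltn_neqAle.
rewrite -val_eqE /= => /andP[h1 h2].
rewrite seg_recl; last by rewrite ltn_neqAle eq_sym h2.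
by rewrite -mulrA exprMn -exprM mulnC.
Qed.

Lemma eq_energy x y p k : (forall i : 'I_n, (k <= i)%N -> x (wid i) = y (wid i)) ->
  energy x p k = energy y p k.
Proof.
move=> H; apply: eq_bigr => j _; rewrite (@eq_seg x y) // => i /andP[? _]; exact: H.
Qed.

Lemma energyE x p k m : (k <= m <= n)%N ->
  energy x p k = \sum_(j < n.+1 | (k <= j < m)%N) (seg x k j * p j) ^+ 2 + seg x k m ^+ 2 * energy x p m.
Proof.
move=> /andP[km mn]; rewrite /energy (bigID (fun j : 'I_n.+1 => (j < m)%N)) /=; congr (_ + _).
rewrite mulr_sumr; apply: eq_big => j; first by rewrite -leqNgt andbC; case: (leqP m j) => //= /(leq_trans km) ->.
rewrite -leqNgt => /andP[kj mj].
by rewrite (@seg_cat x k m j) ?km // -mulrA exprMn.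
Qed.

Lemma updE x j s : upd x j s j = s.
Proof. by rewrite /upd eqxx. Qed.

Lemma upd_neq x j s i : i != j -> upd x j s i = x i.
Proof. by rewrite /upd => /negbTE ->. Qed.

(** By the recursion [energyS], coordinate [m] enters the energy of level [k] only through
    [seg x k m ^ 2] times the energy of level [m]; the induction runs down from [k = m]. *)
Lemma is_derive_energy_upd x p (m : 'I_n) k : (k <= m)%N ->
  is_derive (x (wid m)) 1 (fun s => energy (upd x (wid m) s) p k)
    (seg x k m ^+ 2 * (((2 * alpha m)%:R * x (wid m) ^+ (2 * alpha m).-1) * energy x p m.+1)).
Proof.
elim: {k}(m - k)%N {-2}k (erefl (m - k)%N) => [|d IH] k dk km.
  have -> : k = m by apply/eqP; rewrite eqn_leq km -subn_eq0 dk.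
  rewrite segkk expr1n mul1r.
  have -> : (fun s => energy (upd x (wid m) s) p m) =
     (fun s => s ^+ (2 * alpha m) * energy x p m.+1 + p (wid m) ^+ 2).
    apply/funext => s; rewrite energyS updE addrC (@eq_energy _ x) // => i mi.
    by rewrite upd_neq // -val_eqE /= eq_sym ltn_eqF.
  have D0 := is_derive_pow (2 * alpha m) (is_derive_id (x (wid m)) 1).
  have D1 := is_derive_cmul (energy x p m.+1) D0.
  apply: (is_derive_ext (is_deriveD D1 (is_derive_cst (p (wid m) ^+ 2) _ _))) => [s|].
    by rewrite /= mulrC.
  by ring.
have km' : (k < m)%N by rewrite -subn_gt0 dk.
have kn : (k < n)%N by apply: ltn_trans km' (ltn_ord m).
pose k' := Ordinal kn.
have -> : (fun s => energy (upd x (wid m) s) p k) =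
     (fun s => p (wid k') ^+ 2 + x (wid k') ^+ (2 * alpha k') * energy (upd x (wid m) s) p k.+1).
  apply/funext => s; rewrite (@energyS _ _ k') upd_neq //.
  by rewrite -val_eqE /= ltn_eqF.
have D := IH k.+1 _ km'.
have {}D := D ltac:(by rewrite subnS dk).
apply: (is_derive_ext (is_deriveD (is_derive_cst (p (wid k') ^+ 2) _ _)
  (is_derive_cmul (x (wid k') ^+ (2 * alpha k')) D))) => //.
by rewrite (@seg_recl x k' m km') exprMn -exprM (mulnC (alpha k')); ring.
Qed.

Lemma dHdx_wid x p (m : 'I_n) : dHdx alpha x p (wid m) =
  seg x 0 m ^+ 2 * ((alpha m)%:R * x (wid m) ^+ (2 * alpha m).-1 * energy x p m.+1).
Proof.
rewrite /dHdx derive1E.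
have D := @is_derive_energy_upd x p m 0 (leq0n m).
have -> : (fun s => Ham alpha (upd x (wid m) s) p) = (fun s => 2^-1 * energy (upd x (wid m) s) p 0).
  by apply/funext => s; rewrite Ham_energy.
have {}D : is_derive (x (wid m)) 1 (fun s => 2^-1 * energy (upd x (wid m) s) p 0) _ := is_deriveZ _ D.
case: D => _ ->; rewrite /GRing.scale /= natrM. by field.
Qed.

Lemma dHdx_max x p : dHdx alpha x p ord_max = 0.
Proof.
rewrite /dHdx derive1E.
have -> : (fun s => Ham alpha (upd x ord_max s) p) = cst (Ham alpha x p).
  apply/funext => s; rewrite !Ham_energy /= (@eq_energy _ x) // => i _.
  by rewrite upd_neq // -val_eqE /= ltn_eqF.
by have [_ ->] := is_derive_cst (Ham alpha x p) (x ord_max) 1.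
Qed.

Section Solution.
Variables (x p : R -> 'I_n.+1 -> R).
Hypothesis H : hamilton_solution alpha x p.

Lemma sol_x (j : 'I_n.+1) (t : R) : is_derive t 1 (fun s => x s j) (seg (x t) 0 j ^+ 2 * p t j).
Proof. by have [] := H t j. Qed.

Lemma sol_p (m : 'I_n) (t : R) : is_derive t 1 (fun s => p s (wid m))
  (- (seg (x t) 0 m ^+ 2 * ((alpha m)%:R * x t (wid m) ^+ (2 * alpha m).-1 * energy (x t) (p t) m.+1))).
Proof. by have [_] := H t (wid m); rewrite dHdx_wid. Qed.

Lemma sol_p_max (t : R) : is_derive t 1 (fun s => p s ord_max) 0.
Proof. by have [_] := H t ord_max; rewrite dHdx_max oppr0. Qed.

Lemma continuous_x j t : {for t, continuous (fun s => x s j)}.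
Proof. exact: is_derive_continuous (sol_x j t). Qed.

Lemma continuous_p j t : {for t, continuous (fun s => p s j)}.
Proof. by have [_ h] := H t j; exact: is_derive_continuous h. Qed.

Lemma is_derive_cst0 (f : R -> R) : (forall t : R, is_derive t 1 f 0) -> forall s t, f s = f t.
Proof. by move=> h s t; have [st|st] := leP s t; [|symmetry]; apply: derive0_cst => //; exact: ltW. Qed.

(** Downward induction: once [e_(k+1)] is constant, the derivatives of [p_k ^ 2] and
    [x_k ^ (2 alpha_k) e_(k+1)] cancel by Hamilton's equations. *)
Lemma energy_deriv (t : R) k : (k <= n)%N -> is_derive t 1 (fun s => energy (x s) (p s) k) 0.
Proof.
move=> kn; elim: {k}(n - k)%N {-2}k (erefl (n - k)%N) kn => [|d IH] k dk kn.
  have -> : k = n by apply/eqP; rewrite eqn_leq kn -subn_eq0 dk.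
  have -> : (fun s => energy (x s) (p s) n) = (fun s => p s ord_max ^+ 2).
    by apply/funext => s; rewrite energy_max.
  have D := sol_p_max t; apply: (is_derive_ext (is_derive_pow 2 D)) => //; ring.
have kn' : (k < n)%N by rewrite -subn_gt0 dk.
pose k' := Ordinal kn'.
have -> : (fun s => energy (x s) (p s) k) =
  (fun s => p s (wid k') ^+ 2 + x s (wid k') ^+ (2 * alpha k') * energy (x s) (p s) k.+1).
  by apply/funext => s; rewrite (@energyS _ _ k').
have D := IH k.+1 ltac:(by rewrite subnS dk) kn'.
have D1 := sol_x (wid k') t; have D2 := sol_p k' t.
apply: (is_derive_ext (is_deriveD (is_derive_pow 2 D2)
  (is_derive_mul (is_derive_pow (2 * alpha k') D1) D))) => //.
by rewrite natrM; ring.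
Qed.

Lemma energy_cst s t k : (k <= n)%N -> energy (x s) (p s) k = energy (x t) (p t) k.
Proof. by move=> kn; apply: (@is_derive_cst0 (fun s => energy (x s) (p s) k)) => u; exact: energy_deriv. Qed.

Lemma continuous_seg k m t : {for t, continuous (fun s => seg (x s) k m)}.
Proof.
have -> : (fun s => seg (x s) k m) = \prod_(i < n | (k <= i < m)%N) (fun s => x s (wid i) ^+ alpha i).
  by apply/funext => s; rewrite /seg fct_prodE.
elim/big_ind: _ => [|f g|i _].
- exact: cvg_cst.
- by move=> cf cg; apply: continuousM.
- apply: (@continuous_comp _ _ _ (fun s => x s (wid i)) (fun y => y ^+ alpha i)).
    exact: continuous_x.
  exact: exprn_continuous.
Qed.

End Solution.
End Energies.

(** * Smooth arcs and their lengths *)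

Section Arcs.
Variables (R : realType) (n : nat) (alpha : 'I_n -> nat).
Notation pt := ('I_n.+1 -> R).

(* [dLam] dominates the speed, so [Lam b - Lam a] is an upper bound of the length. *)
Definition c1arc (y z : pt) (L : R) : Prop :=
  exists (g u : R -> pt) (Lam dLam : R -> R) (a b : R),
  [/\ a < b, g a = y /\ g b = z, L = Lam b - Lam a,
   forall (t : R) (j : 'I_n.+1), a <= t <= b ->
     is_derive t 1 (fun s => g s j) (u t j * xi alpha (g t) j) /\ {for t, continuous (fun s => u s j)} &
   forall t : R, a <= t <= b ->
     [/\ is_derive t 1 Lam (dLam t), {for t, continuous dLam} & unorm (u t) <= dLam t]].

Lemma is_derive_oppr (f : R -> R) (t df : R) : is_derive (- t) 1 f df ->
  is_derive t 1 (fun s => f (- s)) (- df).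
Proof.
move=> D; have D2 : is_derive t 1 (-%R : R -> R) (-1) := is_deriveN (is_derive_id t 1).
by rewrite -mulrN1; exact: (@is_derive1_comp _ f -%R).
Qed.

Lemma continuous_oppr (f : R -> R) (t : R) : {for - t, continuous f} -> {for t, continuous (fun s => f (- s))}.
Proof.
by move=> cf; apply: (@continuous_comp _ _ _ -%R f) => //; exact: opp_continuous.
Qed.

Lemma c1arc_rev y z L : c1arc y z L -> c1arc z y L.
Proof.
move=> [g [u [Lam [dLam [a [b [ab [ga gb] -> H1 H2]]]]]]].
exists (fun s => g (- s)), (fun s j => - u (- s) j), (fun s => - Lam (- s)), (fun s => dLam (- s)), (- b), (- a).
split.
- by rewrite ltrN2.
- by rewrite !opprK.
- by rewrite !opprK addrC.
- move=> t j tab; have [h1 h2] := H1 (- t) j ltac:(lra); split.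
    by rewrite mulNr; exact: is_derive_oppr.
  exact: continuousN (continuous_oppr h2).
- move=> t tab; have [h1 h2 h3] := H2 (- t) ltac:(lra); split.
  + by rewrite -[dLam _]opprK; exact: is_deriveN (is_derive_oppr h1).
  + exact: continuous_oppr.
  + apply: le_trans h3; rewrite /unorm ler_wsqrtr // le_eqVlt; apply/orP; left; apply/eqP.
    by apply: eq_bigr => j _; rewrite sqrrN.
Qed.

Variables (x p : R -> pt).
Hypothesis H : hamilton_solution alpha x p.
Hypothesis E0 : forall t, energy alpha (x t) (p t) 0 = 1.

Lemma c1arc_sol a b : a < b -> c1arc (x a) (x b) (b - a).
Proof.
move=> ab; exists x, (fun t (j : 'I_n.+1) => seg alpha (x t) 0 j * p t j), id, (cst 1), a, b; split => //.
- move=> t j _; split; first by rewrite xi_seg mulrAC -expr2; exact: sol_x H j t.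
  by apply: continuousM; [exact: continuous_seg H _ _ _|exact: continuous_p H _ _].
- move=> t _; split; [exact: is_derive_id|exact: cvg_cst|].
  have := E0 t; rewrite /energy /unorm => e.
  by rewrite (eq_bigl xpredT) in e; rewrite // e sqrtr1.
Qed.

Section Splice.
Variables (m : 'I_n) (y q T Hf : R -> R) (rho : R) (Lam dLam : R -> R) (a b : R).
Variable sg : R -> R.
Let e1 := energy alpha (x 0) (p 0) m.+1.
Let e0 := energy alpha (x 0) (p 0) m.
(** The coordinates after [m] are those of the geodesic, replayed at the time [T t]. Below, [q] is
    the momentum of [y], and the clock of the later coordinates runs at [rho] times the rate
    [xi_m ^ 2 y ^ (2 alpha_m)] that [y] would impose. *)
Definition splice (t : R) : pt := fun k =>
  if (k < m)%N then x t k else if (k == m :> nat) then y t else x (T t) k.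
Definition splice_u (t : R) : pt := fun k =>
  if (k < m)%N then seg alpha (x t) 0 k * p t k
  else if (k == m :> nat) then seg alpha (x t) 0 m * q t
  else rho * (seg alpha (x t) 0 m * y t ^+ alpha m * seg alpha (x (T t)) m.+1 k) * p (T t) k.

Lemma splice_seg_le t k : (k <= m)%N -> seg alpha (splice t) 0 k = seg alpha (x t) 0 k.
Proof.
move=> km; apply: eq_seg => i /= ik; rewrite /splice ifT //=; exact: leq_trans km.
Qed.

Lemma splice_seg_gt t k : (m < k)%N -> seg alpha (splice t) 0 k =
  seg alpha (x t) 0 m * y t ^+ alpha m * seg alpha (x (T t)) m.+1 k.
Proof.
move=> mk; rewrite (@seg_cat _ _ _ _ 0 m.+1 k) // segS // splice_seg_le //.
congr (_ * _ ^+ _ * _); first by rewrite /splice ltnn eqxx.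
apply: eq_seg => i /andP[mi _]; rewrite /splice /= ltnNge (ltnW mi) /=.
by rewrite gtn_eqF.
Qed.

(** The coordinates before [m] contribute [1 - xi_m ^ 2 e_m], coordinate [m] contributes
    [xi_m ^ 2 q ^ 2], and the later ones [(rho xi_m y ^ alpha_m) ^ 2 e_(m+1)] whatever [T t] is,
    because their energy is conserved. *)
Lemma splice_speed t : \sum_j splice_u t j ^+ 2 =
  1 - seg alpha (x t) 0 m ^+ 2 * (e0 - q t ^+ 2 - rho ^+ 2 * y t ^+ (2 * alpha m) * e1).
Proof.
have mn : (m <= n)%N by rewrite ltnW.
have E1 s k : (k <= n)%N -> energy alpha (x s) (p s) k = energy alpha (x 0) (p 0) k.
  by move=> kn; apply: (energy_cst H).
have := E0 t; rewrite (@energyE _ _ _ _ _ 0 m) // (E1 _ _ mn) -/e0 => h.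
rewrite (bigID (fun j : 'I_n.+1 => (j < m)%N)) /=.
have -> : \sum_(j < n.+1 | (j < m)%N) splice_u t j ^+ 2 =
    \sum_(j < n.+1 | (0 <= j < m)%N) (seg alpha (x t) 0 j * p t j) ^+ 2.
  by apply: eq_bigr => j jm; rewrite /splice_u jm.
rewrite [X in _ + X](bigD1 (wid m)) /=; last by rewrite ltnn.
have -> : splice_u t (wid m) = seg alpha (x t) 0 m * q t by rewrite /splice_u /= ltnn eqxx.
have -> : \sum_(j < n.+1 | ~~ (j < m)%N && (j != wid m)) splice_u t j ^+ 2 =
   (rho * (seg alpha (x t) 0 m * y t ^+ alpha m)) ^+ 2 * e1.
  rewrite /e1 -(E1 (T t) m.+1) // /energy mulr_sumr; apply: eq_big => j.
    by rewrite -leqNgt andbC eq_sym -val_eqE -ltn_neqAle.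
  move=> /andP[/negbTE jm]; rewrite -val_eqE /= => /negbTE jm2.
  by rewrite /splice_u jm jm2 -exprMn; congr (_ ^+ _); ring.
rewrite (mulnC 2%N) exprM; move: h; set s1 := \sum_(_ < _ | _) _; move=> h.
have -> : s1 = 1 - seg alpha (x t) 0 m ^+ 2 * e0 by rewrite -h; ring.
ring.
Qed.

Hypothesis ab : a < b.
Hypothesis Hsg : is_clock sg (fun t => seg alpha (x t) 0 m.+1 ^+ 2).
Hypothesis Hy : forall t : R, a <= t <= b -> is_derive t 1 y (seg alpha (x t) 0 m ^+ 2 * q t).
Hypothesis cq : forall t : R, a <= t <= b -> {for t, continuous q}.
Hypothesis cT : forall t : R, a <= t <= b -> {for t, continuous T}.
Hypothesis HT : forall t : R, a <= t <= b ->
  exists2 d : R, 0 < d & forall r : R, `|r - t| < d -> sg (T r) = Hf r.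
Hypothesis dH : forall t : R, a <= t <= b ->
  is_derive t 1 Hf (rho * (seg alpha (x t) 0 m ^+ 2 * y t ^+ (2 * alpha m))).
Hypothesis HL : forall t : R, a <= t <= b -> [/\ is_derive t 1 Lam (dLam t), {for t, continuous dLam},
  0 <= dLam t &
  1 - seg alpha (x t) 0 m ^+ 2 * (e0 - q t ^+ 2 - rho ^+ 2 * y t ^+ (2 * alpha m) * e1) <= dLam t ^+ 2].

Lemma c1arc_splice : c1arc (splice a) (splice b) (Lam b - Lam a).
Proof.
exists splice, splice_u, Lam, dLam, a, b; split => //; last first.
  move=> t /HL[h1 h2 h3 h4]; split => //.
  by rewrite /unorm splice_speed -(ger0_norm h3) -sqrtr_sqr ler_wsqrtr.
move=> t j tab; rewrite xi_seg /splice_u.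
have cy : {for t, continuous y} := is_derive_continuous (Hy tab).
have [jm|mj] := ltnP j m.
  rewrite (_ : (fun s => splice s j) = fun s => x s j); last first.
    by apply/funext => s; rewrite /splice jm.
  split; first by rewrite splice_seg_le ?(ltnW jm) // mulrAC -expr2; exact: (sol_x H).
  by apply: continuousM; [exact: continuous_seg H _ _ _|exact: continuous_p H _ _].
move: mj; rewrite leq_eqVlt => /orP[/eqP mj|mj].
  rewrite (_ : (fun s => splice s j) = y); last first.
    by apply/funext => s; rewrite /splice -mj ltnn eqxx.
  rewrite -mj eqxx; split; first by rewrite splice_seg_le // mulrAC -expr2; exact: Hy.
  by apply: continuousM; [exact: continuous_seg H _ _ _|exact: cq].
have jm : (j == m :> nat) = false by apply: gtn_eqF.
have jm' : (j < m)%N = false by rewrite ltnNge (ltnW mj).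
rewrite (_ : (fun s => splice s j) = (fun s => x s j) \o T); last first.
  by apply/funext => s; rewrite /splice jm jm'.
rewrite jm; split; last first.
  apply: continuousM; last first.
    by apply: (@continuous_comp _ _ _ T (fun s => p s j)); [exact: cT|exact: continuous_p H _ _].
  apply: (@continuousM _ _ (cst rho)); first exact: cvg_cst.
  apply: continuousM.
    apply: continuousM; first exact: continuous_seg H _ _ _.
    by apply: (@continuous_comp _ _ _ y (fun y => y ^+ alpha m)) => //; exact: exprn_continuous.
  apply: (@continuous_comp _ _ _ T (fun s => seg alpha (x s) m.+1 j)); first exact: cT.
  exact: continuous_seg H _ _ _.
(* The velocity of a later coordinate is [g] times the derivative of the clock [sg]; hence it can be
   composed with [T], which is only continuous. *)
pose g s := seg alpha (x s) m.+1 j ^+ 2 * p s j.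
have dG (r : R) : is_derive r 1 (fun s => x s j) (seg alpha (x r) 0 m.+1 ^+ 2 * g r).
  have := sol_x H j r; rewrite (@seg_cat _ _ _ _ 0 m.+1 j) // => D.
  by apply: (is_derive_ext D) => //; rewrite /g; ring.
have cg : {for T t, continuous g}.
  apply: continuousM; last exact: continuous_p H _ _.
  apply: (@continuous_comp _ _ _ (fun s => seg alpha (x s) m.+1 j) (fun y => y ^+ 2)).
    exact: continuous_seg H _ _ _.
  exact: exprn_continuous.
apply: (is_derive_ext (is_derive_clock Hsg dG cg (cT tab) (HT tab) (dH tab))) => //.
by rewrite splice_seg_gt // /g (mulnC 2%N) exprM; ring.
Qed.

End Splice.
End Arcs.

(** * The reflected competitor *)

Lemma clock_inv_comp (R : realType) (S dS h : R -> R) (lo hi t : R) : is_clock S dS ->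
  S lo <= h t <= S hi -> {for t, continuous h} ->
  {for t, continuous (fun s => clock_inv S (h s))} /\
  exists2 d : R, 0 < d & forall r : R, `|r - t| < d -> S (clock_inv S (h r)) = h r.
Proof.
move=> HS hr ch; have [_ E] := clock_ivt HS hr; split.
  by apply: (@continuous_comp _ _ _ h (clock_inv S)) => //; rewrite -E; exact: clock_inv_continuous HS.
have [d d0 Hd] := clock_inv_near (clock_inv S (h t)) HS.
have /continuous_epsP/(_ _ d0)[d' d'0 Hd'] := ch.
by exists d' => // r /Hd'; rewrite -{1}E => /Hd.
Qed.

Section Competitor.
Variables (R : realType) (n : nat) (alpha : 'I_n -> nat).
Notation pt := ('I_n.+1 -> R).
Variables (x p : R -> pt).
Hypothesis H : hamilton_solution alpha x p.
Hypothesis E0 : forall t, energy alpha (x t) (p t) 0 = 1.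
Hypothesis Epos : forall k, (k <= n)%N -> 0 < energy alpha (x 0) (p 0) k.

Lemma energy_at t k : (k <= n)%N -> energy alpha (x t) (p t) k = energy alpha (x 0) (p 0) k.
Proof. by move=> kn; apply: (energy_cst H). Qed.

Lemma coord_energy t (m : 'I_n) : p t (wid m) ^+ 2 +
  x t (wid m) ^+ (2 * alpha m) * energy alpha (x 0) (p 0) m.+1 = energy alpha (x 0) (p 0) m.
Proof. by rewrite -(energy_at t (ltnW (ltn_ord m))) energyS energy_at. Qed.

(* A zero of a coordinate with positive exponent is transversal: there the momentum carries the
   whole energy, so it does not vanish. *)
Lemma seg_isolated m (t : R) : (m <= n)%N ->
  exists2 d : R, 0 < d & forall r : R, 0 < `|r - t| < d -> seg alpha (x r) 0 m != 0.
Proof.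
elim: m => [|m IH] mn; first by exists 1 => // r _; rewrite segkk oner_neq0.
have [d d0 Hd] := IH (ltnW mn); pose m' := Ordinal mn.
have Hs r : seg alpha (x r) 0 m.+1 = seg alpha (x r) 0 m * x r (wid m') ^+ alpha m'.
  by rewrite (@segS _ _ _ _ 0 m').
suff [d' d'0 Hd'] : exists2 d' : R, 0 < d' & forall r : R, 0 < `|r - t| < d' -> `|r - t| < d ->
    x r (wid m') ^+ alpha m' != 0.
  exists (Num.min d d'); first by rewrite lt_min d0.
  move=> r /andP[r0]; rewrite lt_min => /andP[r1 r2].
  by rewrite Hs mulf_neq0 ?Hd ?r0 ?r1 // Hd' // r0.
have [a0|a0] := posnP (alpha m'); first by exists 1 => // r _ _; rewrite a0 expr0 oner_neq0.
have [xt0|xt0] := eqVneq (x t (wid m')) 0; last first.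
  have [d' d'0 Hd'] := continuous_sign (@continuous_x _ _ _ _ _ H (wid m') t) xt0.
  exists d' => // r /andP[_ /Hd' h] _; apply: expf_neq0; apply: contraTneq h => ->.
  by rewrite mul0r ltxx.
have pt0 : p t (wid m') != 0.
  have := coord_energy t m'; rewrite xt0 expr0n muln_eq0 /= -[alpha m' == 0%N]negbK -lt0n a0 mul0r addr0.
  by move=> e; apply: contraTneq (Epos (ltnW mn)) => pt0; rewrite -e pt0 expr0n ltxx.
have [d' d'0 Hd'] := continuous_sign (@continuous_p _ _ _ _ _ H (wid m') t) pt0.
exists d' => // r /andP[r0 rd'] rd; apply: expf_neq0.
have dz (c : R) : is_derive c 1 (fun s => x s (wid m')) (seg alpha (x c) 0 m ^+ 2 * p c (wid m')).
  exact: (sol_x H).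
have nz c : 0 < `|c - t| < Num.min d d' -> seg alpha (x c) 0 m ^+ 2 * p c (wid m') != 0.
  rewrite lt_min => /and3P[c0 c1 c2]; rewrite mulf_neq0 ?sqrf_eq0 ?Hd ?c0 //.
  by apply: contraTneq (Hd' _ c2) => ->; rewrite mul0r ltxx.
have wz u v : {within `[u, v], continuous (fun s => x s (wid m'))}.
  by apply: is_derive_within => c _; exact: dz.
have rt : r != t by apply: contraTneq r0 => ->; rewrite subrr normr0 ltxx.
have [lt_rt|lt_tr] : r < t \/ t < r by move: rt; rewrite neq_lt => /orP[]; [left|right].
- have [c /andP[c1 c2]] := mvt lt_rt (fun c _ => dz c) (wz _ _).
  rewrite xt0 sub0r => e; rewrite -oppr_eq0 e; apply: mulf_neq0; last by rewrite subr_eq0 eq_sym.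
  apply: nz.
  rewrite lt_min; move: rd rd'; rewrite !ltr0_norm ?subr_lt0 // => *.
  by apply/and3P; split; lra.
- have [c /andP[c1 c2]] := mvt lt_tr (fun c _ => dz c) (wz _ _).
  rewrite xt0 subr0 => ->; apply: mulf_neq0; last by rewrite subr_eq0.
  apply: nz.
  rewrite lt_min; move: rd rd'; rewrite !gtr0_norm ?subr_gt0 // => *.
  by apply/and3P; split; lra.
Qed.

Lemma seg_clock m : (m <= n)%N -> exists S, is_clock S (fun t => seg alpha (x t) 0 m ^+ 2).
Proof.
move=> mn.
have [|S HS] := @antiderivative R (fun t => seg alpha (x t) 0 m ^+ 2).
  move=> t; apply: (@continuous_comp _ _ _ (fun s => seg alpha (x s) 0 m) (fun y => y ^+ 2)).
    exact: continuous_seg H _ _ _.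
  exact: exprn_continuous.
exists S; split=> //; split=> t; first exact: sqr_ge0.
have [d d0 Hd] := seg_isolated t mn; exists d => // r /Hd h.
by rewrite lt_def sqrf_eq0 h sqr_ge0.
Qed.

Variables (m : 'I_n) (A : R) (S sg : R -> R).
Hypothesis am0 : (0 < alpha m)%N.
Local Notation e0 := (energy alpha (x 0) (p 0) m).
Local Notation e1 := (energy alpha (x 0) (p 0) m.+1).
Local Notation z t := (x t (wid m)).
Local Notation q t := (p t (wid m)).
Hypothesis A0 : 0 < A.
Hypothesis eA : e1 * A ^+ (2 * alpha m) = e0.
Hypothesis HS : is_clock S (fun t => seg alpha (x t) 0 m ^+ 2).
Hypothesis Hsg : is_clock sg (fun t => seg alpha (x t) 0 m.+1 ^+ 2).

(** Frequency of coordinate [m] in its clock [S]. By [eA], the amplitude [A] is the position at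
    which the momentum would be 0. *)
Let w := Num.sqrt e0 / A.

Lemma e0_gt0 : 0 < e0. Proof. exact: Epos (ltnW (ltn_ord m)). Qed.
Lemma e1_gt0 : 0 < e1. Proof. exact: Epos (ltn_ord m). Qed.

Lemma w_gt0 : 0 < w.
Proof. by rewrite divr_gt0 // sqrtr_gt0 e0_gt0. Qed.

Lemma antiperiod t1 t2 : q t1 != 0 -> w * (S t2 - S t1) = pi_a R (alpha m) ->
  z t2 = - z t1 /\ q t2 * q t1 < 0.
Proof.
move=> q1 hw; have s0 : 0 < Num.sqrt e0 by rewrite sqrtr_gt0 e0_gt0.
have An0 : A != 0 by rewrite gt_eqF.
have sn0 : Num.sqrt e0 != 0 by rewrite gt_eqF.
have se : Num.sqrt e0 ^+ 2 = e0 by rewrite sqr_sqrtr // ltW // e0_gt0.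
(* The restoring coefficient in the equation for the momentum after both rescalings. *)
pose be := (alpha m)%:R * A ^+ (2 * alpha m).-1 * e1 / Num.sqrt e0.
have be0 : 0 < be by rewrite !mulr_gt0 ?ltr0n ?exprn_gt0 ?invr_gt0 ?e1_gt0.
have osc : oscillates (alpha m) (fun t => seg alpha (x t) 0 m ^+ 2) w be
    (fun t => A^-1 * z t) (fun t => (Num.sqrt e0)^-1 * q t).
  split=> t.
  - apply: (is_derive_ext (is_derive_cmul A^-1 (sol_x H (wid m) t))) => //.
    by rewrite /w; field; rewrite An0 sn0.
  - apply: (is_derive_ext (is_derive_cmul (Num.sqrt e0)^-1 (sol_p H m t))) => //.
    rewrite energy_at // exprMn exprVn /be; field.
    by rewrite sn0 expf_neq0.
  - rewrite !exprMn !exprVn se.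
    have := coord_energy t m; rewrite -eA => e.
    have e1n : e1 != 0 by rewrite gt_eqF // e1_gt0.
    have -> : q t ^+ 2 = e1 * A ^+ (2 * alpha m) - z t ^+ (2 * alpha m) * e1 by rewrite -e; ring.
    by field; rewrite e1n expf_neq0.
have v1 : (Num.sqrt e0)^-1 * q t1 != 0 by rewrite mulf_neq0 // invr_eq0.
have [h1 h2] := half_period am0 HS w_gt0 be0 osc v1 hw; split.
  by apply: (mulfI (_ : A^-1 != 0)); rewrite ?invr_eq0 // h1 mulrN.
have i0 : 0 < (Num.sqrt e0)^-1 ^+ 2 by rewrite exprn_gt0 // invr_gt0.
rewrite -(pmulr_rlt0 _ i0); apply: le_lt_trans h2.
by rewrite le_eqVlt; apply/orP; left; apply/eqP; ring.
Qed.


Section Detour.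
(** Times are prescribed by the clock [S]: [hp] is half a period and [dd] an excess beyond it. Since
    time 0 the clock has advanced by [dd] at [a'], [2 dd] at [t2], [hp] at [b0] and [hp + dd] at
    [b]. By [zq] the coordinate approaches 0 until [a'], so its initial value is extreme there. *)
Variables (dd hp : R).
Hypothesis hpw : w * hp = pi_a R (alpha m).
Hypothesis dd0 : 0 < dd.
Hypothesis ddhp : dd < hp.
Variables (a' b b0 t2 : R).
Hypotheses (Sa' : S a' = S 0 + dd) (Sb : S b = S 0 + hp + dd) (Sb0 : S b0 = S 0 + hp)
  (St2 : S t2 = S 0 + 2 * dd).
Hypothesis zq : forall t, 0 <= t <= a' -> z t * q t < 0.
Local Notation Z := (z 0 ^+ (2 * alpha m)).

Local Ltac slra := have := dd0; have := ddhp; lra.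

Lemma a'_gt0 : 0 < a'. Proof. by rewrite -(clock_ltE _ _ HS) Sa'; slra. Qed.
Lemma t2_gt0 : 0 < t2. Proof. by rewrite -(clock_ltE _ _ HS) St2; slra. Qed.
Lemma t2_ltb : t2 < b. Proof. by rewrite -(clock_ltE _ _ HS) St2 Sb; slra. Qed.
Lemma b0_ltb : b0 < b. Proof. by rewrite -(clock_ltE _ _ HS) Sb0 Sb; slra. Qed.
Lemma a'_ltb0 : a' < b0. Proof. by rewrite -(clock_ltE _ _ HS) Sb0 Sa'; slra. Qed.

Lemma q_neq0 t : 0 <= t <= a' -> q t != 0.
Proof. by move=> /zq h; apply: contraTneq h => ->; rewrite mulr0 ltxx. Qed.

Lemma seg_succ t : seg alpha (x t) 0 m.+1 ^+ 2 = seg alpha (x t) 0 m ^+ 2 * z t ^+ (2 * alpha m).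
Proof. by rewrite segS // exprMn (mulnC 2%N) exprM. Qed.

Lemma z_le t : 0 <= t <= a' -> z t ^+ (2 * alpha m) <= Z.
Proof.
move=> /andP[t0 ta]; rewrite !exprM; apply: lerXn2r; rewrite ?nnegrE ?sqr_ge0 //.
rewrite -lerN2; apply: (@ge0_derive_le _ (fun t => - z t ^+ 2)
  (fun t => - (2 * (seg alpha (x t) 0 m ^+ 2 * (z t * q t)))) 0 t t0) => s /andP[s0 st].
  apply: is_derive_opp; apply: (is_derive_ext (is_derive_pow 2 (sol_x H (wid m) s))) => //=.
  ring.
have := @zq s; rewrite s0 (le_trans st ta) => /(_ isT) h.
by rewrite oppr_ge0 pmulr_rle0 // mulr_ge0_le0 ?sqr_ge0 // ltW.
Qed.

(** The stretch from [b0] to [b] is the antiperiodic image of the one from 0 to [a'], so bounds on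
    [|z|] carry over. *)
Lemma z_shift t : b0 <= t <= b -> exists2 s, 0 <= s <= a' & z t = - z s.
Proof.
move=> /andP[h1 h2]; have [s0 Ss] : 0 <= clock_inv S (S t - hp) <= a' /\ S (clock_inv S (S t - hp)) = S t - hp.
  apply: clock_ivt HS _; move: h1 h2; rewrite -(clock_leE b0 t HS) -(clock_leE t b HS) Sb0 Sb Sa' => h1 h2.
  by apply/andP; split; slra.
exists (clock_inv S (S t - hp)) => //.
have [] // := @antiperiod (clock_inv S (S t - hp)) t (q_neq0 s0).
by rewrite Ss -hpw; congr (_ * _); ring.
Qed.

(** Measured in [S], the clock [sg] advances at the rate [z ^ (2 alpha_m)]. *)
Lemma sg_le u v : u <= v -> (forall t, u <= t <= v -> z t ^+ (2 * alpha m) <= Z) ->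
  sg v - sg u <= Z * (S v - S u).
Proof.
move=> uv hz; suff : Z * S u - sg u <= Z * S v - sg v by slra.
have [dS _] := HS; have [dsg _] := Hsg.
apply: (@ge0_derive_le _ (fun t => Z * S t - sg t)
  (fun t => Z * seg alpha (x t) 0 m ^+ 2 - seg alpha (x t) 0 m.+1 ^+ 2) u v uv) => t tuv.
by rewrite seg_succ -mulrC -mulrBr mulr_ge0 ?sqr_ge0 // subr_ge0 hz.
Qed.

(** The reversed piece replays [sg] between [a'] and [b0] only; this is what remains of
    [sg b - sg 0]. *)
Definition Dsg := sg a' - sg 0 + (sg b - sg b0).

Lemma Dsg_gt0 : 0 < Dsg.
Proof.
have := @clock_ltE _ _ _ 0 a' Hsg; have := @clock_ltE _ _ _ b0 b Hsg.
rewrite a'_gt0 b0_ltb /Dsg => h1 h2; slra.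
Qed.

Lemma Dsg_le : Dsg <= Z * (2 * dd).
Proof.
have h1 : sg a' - sg 0 <= Z * (S a' - S 0) by apply: sg_le; [exact: ltW a'_gt0|exact: z_le].
have h2 : sg b - sg b0 <= Z * (S b - S b0).
  apply: sg_le; first exact: ltW b0_ltb.
  by move=> t /z_shift[s hs ->]; rewrite pow2aN; exact: z_le.
have e1' : S a' - S 0 = dd by rewrite Sa'; ring.
have e2' : S b - S b0 = dd by rewrite Sb Sb0; ring.
rewrite e1' in h1; rewrite e2' in h2.
rewrite /Dsg; apply: le_trans (lerD h1 h2) _.
by rewrite le_eqVlt; apply/orP; left; apply/eqP; ring.
Qed.

Lemma z0_neq0 : z 0 != 0.
Proof.
have := @zq 0; rewrite lexx (ltW a'_gt0) => /(_ isT) h.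
by apply: contraTneq h => ->; rewrite mul0r ltxx.
Qed.

Lemma Z_gt0 : 0 < Z.
Proof. by rewrite exprM exprn_gt0 // lt_def sqrf_eq0 z0_neq0 sqr_ge0. Qed.

(** The rate required of [sg] during the rest, over the rate [Z] that the resting position offers.
    Being at most 1, it lets the later coordinates reach their targets with no more than their usual
    energy. *)
Definition ratio := Dsg / (2 * dd) / Z.

Lemma ratio_le1 : 0 <= ratio <= 1.
Proof.
rewrite /ratio; apply/andP; split.
  by rewrite !divr_ge0 ?(ltW Z_gt0) ?(ltW Dsg_gt0) // mulr_ge0 // ltW.
by rewrite ler_pdivrMr ?Z_gt0 // mul1r ler_pdivrMr ?mulr_gt0 // Dsg_le.
Qed.

Lemma seg_energy_le t : seg alpha (x t) 0 m ^+ 2 * e0 <= 1.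
Proof.
have mn : (m <= n)%N by exact: ltnW.
have := E0 t; rewrite (@energyE _ _ _ _ _ 0 m) // energy_at // => <-.
by rewrite lerDr sumr_ge0 // => j _; exact: sqr_ge0.
Qed.

(* On [0, t2] the coordinate [m] rests at [z 0]; on [t2, b] it follows the reversed and negated
   oscillation.  The times [T1] and [T2] make the later coordinates reach their targets: their
   clock [sg] advances by [Dsg] on the first piece, which the rest at [z 0] allows by [Dsg_le]. *)
Definition T1 t := clock_inv sg (sg 0 + Dsg / (2 * dd) * (S t - S 0)).
Definition T2 t := clock_inv sg (sg a' + sg b - sg (clock_inv S (2 * S 0 + hp + 2 * dd - S t))).
Definition y2 t := - z (clock_inv S (2 * S 0 + hp + 2 * dd - S t)).
Definition c1 := splice x m (cst (z 0)) T1.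
Definition c2 := splice x m y2 T2.

(** By [coord_energy], [e0 - Z e1 = q(0) ^ 2], so at rest, with [ratio <= 1], the squared speed is
    at most [1 - xi_m ^ 2 q(0) ^ 2]. Then [1 - v <= (1 - v / 2) ^ 2] bounds the speed by
    [1 - q(0) ^ 2 xi_m ^ 2 / 2], and [xi_m ^ 2] integrates to [2 dd] over [[0, t2]]. *)
Lemma detour1 : c1arc alpha (c1 0) (c1 t2) (t2 - q 0 ^+ 2 * dd).
Proof.
have Sd (t : R) : is_derive t 1 S (seg alpha (x t) 0 m ^+ 2) by have [dS _] := HS; exact: dS.
have Dd : 0 < Dsg / (2 * dd) by rewrite divr_gt0 ?Dsg_gt0 ?mulr_gt0.
have HfE (t : R) : is_derive t 1 (fun t => sg 0 + Dsg / (2 * dd) * (S t - S 0))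
    (Dsg / (2 * dd) * seg alpha (x t) 0 m ^+ 2).
  have D0 := is_derive_sub (Sd t) (is_derive_cst (S 0) t 1); rewrite subr0 in D0.
  have := is_derive_add (is_derive_cst (sg 0) t 1) (is_derive_cmul (Dsg / (2 * dd)) D0).
  by rewrite add0r.
pose h1f t := sg 0 + Dsg / (2 * dd) * (S t - S 0).
have rng (t : R) : 0 <= t <= t2 -> sg 0 <= h1f t <= sg b.
  rewrite -(clock_leE 0 t HS) -(clock_leE t t2 HS) St2 => /andP[h1 h2].
  apply/andP; split; first by rewrite lerDl mulr_ge0 ?(ltW Dd) // subr_ge0.
  have h3 : Dsg / (2 * dd) * (S t - S 0) <= Dsg / (2 * dd) * (2 * dd).
    by rewrite ler_pM2l //; slra.
  rewrite mulfVK in h3; last by rewrite mulf_neq0 // gt_eqF.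
  have := @clock_ltE _ _ _ a' b0 Hsg; rewrite a'_ltb0 => h4.
  move: h3; rewrite /h1f /Dsg; slra.
have -> : t2 - q 0 ^+ 2 * dd = (t2 - q 0 ^+ 2 / 2 * S t2) - (0 - q 0 ^+ 2 / 2 * S 0).
  by rewrite St2; field.
apply: (@c1arc_splice _ _ _ _ _ H E0 m (cst (z 0)) (cst 0) T1
  (fun t => sg 0 + Dsg / (2 * dd) * (S t - S 0)) ratio (fun t => t - q 0 ^+ 2 / 2 * S t)
  (fun t => 1 - q 0 ^+ 2 / 2 * seg alpha (x t) 0 m ^+ 2) 0 t2 sg t2_gt0 Hsg) => t tt.
- by rewrite mulr0; exact: is_derive_cst.
- exact: cvg_cst.
- by have [] := @clock_inv_comp _ _ _ h1f _ _ _ Hsg (rng t tt) (is_derive_continuous (HfE t)).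
- by have [] := @clock_inv_comp _ _ _ h1f _ _ _ Hsg (rng t tt) (is_derive_continuous (HfE t)).
- apply: (is_derive_ext (HfE t)) => //; rewrite /ratio /=; field.
  by rewrite !gt_eqF ?Z_gt0.
- have seE := seg_energy_le t.
  have ce := coord_energy 0 m.
  have q0e : q 0 ^+ 2 <= e0.
    by rewrite -ce lerDl mulr_ge0 ?(ltW Z_gt0) // ltW // e1_gt0.
  have s0 := sqr_ge0 (seg alpha (x t) 0 m).
  split.
  + exact: is_derive_sub (is_derive_id t 1) (is_derive_cmul (q 0 ^+ 2 / 2) (Sd t)).
  + apply: continuousB; first exact: cvg_cst.
    apply: (@continuousM _ _ (cst _)); first exact: cvg_cst.
    apply: (@continuous_comp _ _ _ (fun s => seg alpha (x s) 0 m) (fun y => y ^+ 2)).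
      exact: continuous_seg H _ _ _.
    exact: exprn_continuous.
  + have : seg alpha (x t) 0 m ^+ 2 * q 0 ^+ 2 <= 1 by apply: le_trans seE; rewrite ler_wpM2l.
    move: (_ ^+ 2) (q 0 ^+ 2) => u v; slra.
  + rewrite expr0n /= subr0.
    have r2 : ratio ^+ 2 <= 1 by rewrite expr_le1 //; have /andP[] := ratio_le1.
    have : ratio ^+ 2 * Z * e1 <= 1 * (Z * e1).
      by rewrite -mulrA ler_wpM2r // mulr_ge0 ?(ltW Z_gt0) // ltW // e1_gt0.
    rewrite mul1r /cst; move: ce; set zz := _ * e1; move=> ce h.
    have h2 : q 0 ^+ 2 <= e0 - ratio ^+ 2 * Z * e1 by rewrite -ce -lerBlDr; slra.
    have h3 : seg alpha (x t) 0 m ^+ 2 * q 0 ^+ 2 <=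
      seg alpha (x t) 0 m ^+ 2 * (e0 - ratio ^+ 2 * Z * e1) by rewrite ler_wpM2l.
    have h4 := sqr_ge0 (q 0 ^+ 2 / 2 * seg alpha (x t) 0 m ^+ 2).
    apply: (@le_trans _ _ (1 - seg alpha (x t) 0 m ^+ 2 * q 0 ^+ 2)).
      by rewrite lerD2l lerN2.
    rewrite sqrrB expr1n -[X in X <= _]addr0.
    apply: lerD => //; rewrite lerD2l lerN2 le_eqVlt; apply/orP; left; apply/eqP.
    by field.
Qed.

(** Reversing the clock and negating the position leave the energy of coordinate [m] unchanged, so
    with [rho = 1] this piece has unit speed. *)
Lemma detour2 : c1arc alpha (c2 t2) (c2 b) (b - t2).
Proof.
have Sd (t : R) : is_derive t 1 S (seg alpha (x t) 0 m ^+ 2) by have [dS _] := HS; exact: dS.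
(* The reflection of the clock that matches [t2] with [b0] and [b] with [a']. *)
pose Hs t := 2 * S 0 + hp + 2 * dd - S t.
pose Rf t := clock_inv S (Hs t).
have dHs (t : R) : is_derive t 1 Hs (- seg alpha (x t) 0 m ^+ 2).
  rewrite -[X in is_derive _ _ _ X]add0r; exact: is_derive_sub (is_derive_cst _ t 1) (Sd t).
have rng (t : R) : t2 <= t <= b -> S a' <= Hs t <= S b0.
  rewrite -(clock_leE t2 t HS) -(clock_leE t b HS) St2 Sb Sa' Sb0 /Hs => /andP[h1 h2].
  by apply/andP; split; slra.
have cR (t : R) : t2 <= t <= b -> {for t, continuous Rf} /\
    exists2 d : R, 0 < d & forall r : R, `|r - t| < d -> S (Rf r) = Hs r.
  by move=> tt; exact: clock_inv_comp HS (rng t tt) (is_derive_continuous (dHs t)).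
have Rin (t : R) : t2 <= t <= b -> a' <= Rf t <= b0.
  by move=> tt; have [] := clock_ivt HS (rng t tt).
have dzR (t : R) : t2 <= t <= b -> is_derive t 1 ((fun s => z s) \o Rf) (- seg alpha (x t) 0 m ^+ 2 * q (Rf t)).
  move=> /cR[cRt nR].
  apply: (@is_derive_clock _ S _ (fun s => z s) (fun s => q s) Rf Hs t _ HS) => //.
    exact: (sol_x H).
  exact: continuous_p H _ _.
have dsR (t : R) : t2 <= t <= b -> is_derive t 1 (sg \o Rf)
    (- seg alpha (x t) 0 m ^+ 2 * z (Rf t) ^+ (2 * alpha m)).
  move=> /cR[cRt nR].
  apply: (@is_derive_clock _ S _ sg (fun s => z s ^+ (2 * alpha m)) Rf Hs t _ HS) => //.
    by move=> r; rewrite -seg_succ; have [dsg _] := Hsg; exact: dsg.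
  apply: (@continuous_comp _ _ _ (fun s => z s) (fun y => y ^+ (2 * alpha m))).
    exact: continuous_x H _ _.
  exact: exprn_continuous.
pose Hf t := sg a' + sg b - (sg \o Rf) t.
have dHf (t : R) : t2 <= t <= b -> is_derive t 1 Hf (seg alpha (x t) 0 m ^+ 2 * z (Rf t) ^+ (2 * alpha m)).
  move=> tt; apply: (is_derive_ext (is_derive_sub (is_derive_cst (sg a' + sg b) t 1) (dsR t tt))) => //.
  ring.
have rngf (t : R) : t2 <= t <= b -> sg a' <= Hf t <= sg b.
  move=> /Rin; rewrite -(clock_leE a' _ Hsg) -(clock_leE _ b0 Hsg) /Hf /= => /andP[h1 h2].
  have := @clock_ltE _ _ _ b0 b Hsg; rewrite b0_ltb => h3.
  by apply/andP; split; lra.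
apply: (@c1arc_splice _ _ _ _ _ H E0 m y2 ((fun s => q s) \o Rf) T2 Hf 1 id (cst 1) t2 b sg t2_ltb Hsg) => t tt.
- apply: (is_derive_ext (is_derive_opp (dzR t tt))) => //; by rewrite /=; ring.
- apply: (@continuous_comp _ _ _ Rf (fun s => q s)); first by have [] := cR t tt.
  exact: continuous_p H _ _.
- by have [] := clock_inv_comp Hsg (rngf t tt) (is_derive_continuous (dHf t tt)).
- by have [] := clock_inv_comp Hsg (rngf t tt) (is_derive_continuous (dHf t tt)).
- by apply: (is_derive_ext (dHf t tt)) => //; rewrite mul1r /y2 pow2aN.
- split => //; first exact: is_derive_id.
    exact: cvg_cst.
  have := coord_energy (Rf t) m => e.
  rewrite expr1n mul1r /y2 pow2aN -lerBrDl subrr oppr_le0 mulr_ge0 ?sqr_ge0 //.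
  by rewrite -[e0]e /= -/(Hs t) -/(Rf t) le_eqVlt; apply/orP; left; apply/eqP; ring.
Qed.

Lemma detour_start : c1 0 = x 0.
Proof.
apply/funext => k; rewrite /c1 /splice /T1 subrr mulr0 addr0 (clock_invK Hsg erefl).
have [//|_] := ltnP k m; have [km|//] := eqVneq.
by congr (x 0); apply/val_inj.
Qed.

(** The pieces meet because [- z b0 = z 0] by antiperiodicity, and because the rest brings [sg] to
    [sg 0 + Dsg], where the reversed piece starts. *)
Lemma detour_mid : c1 t2 = c2 t2.
Proof.
have e : clock_inv S (2 * S 0 + hp + 2 * dd - S t2) = b0.
  by apply: (clock_invK HS); rewrite Sb0 St2; ring.
have q0 : q 0 != 0 by apply: q_neq0; rewrite lexx (ltW a'_gt0).
have [zb0 _] : z b0 = - z 0 /\ q b0 * q 0 < 0.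
  by apply: antiperiod => //; rewrite -hpw Sb0; congr (_ * _); ring.
have eT : T1 t2 = T2 t2.
  rewrite /T1 /T2 e; congr clock_inv; rewrite St2 /Dsg; field.
  by rewrite gt_eqF.
apply/funext => k; rewrite /c1 /c2 /splice eT /y2 e zb0 opprK.
by [].
Qed.

Lemma detour_end : c2 b = x b.
Proof.
have e : clock_inv S (2 * S 0 + hp + 2 * dd - S b) = a'.
  by apply: (clock_invK HS); rewrite Sa' Sb; ring.
have qa : q a' != 0 by apply: q_neq0; rewrite lexx (ltW a'_gt0).
have [zb _] : z b = - z a' /\ q b * q a' < 0.
  by apply: antiperiod => //; rewrite -hpw Sa' Sb; congr (_ * _); ring.
have eT : T2 b = b by rewrite /T2 e addrAC subrr add0r; exact: clock_invK Hsg erefl.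
apply/funext => k; rewrite /c2 /splice eT /y2 e -zb.
have [//|_] := ltnP k m; have [km|//] := eqVneq.
by congr (x b); apply/val_inj.
Qed.

Lemma detour : exists (y : pt) (L1 L2 : R),
  [/\ c1arc alpha (x 0) y L1, c1arc alpha y (x b) L2 & L1 + L2 < b].
Proof.
exists (c1 t2), (t2 - q 0 ^+ 2 * dd), (b - t2); split.
- by rewrite -detour_start; exact: detour1.
- by rewrite detour_mid -detour_end; exact: detour2.
- have : 0 < q 0 ^+ 2 * dd.
    rewrite mulr_gt0 // lt_def sqrf_eq0 sqr_ge0 andbT; apply: q_neq0.
    by rewrite lexx (ltW a'_gt0).
  lra.
Qed.

End Detour.

Lemma competitor_dec T : 0 < T -> pi_a R (alpha m) < w * (S T - S 0) -> z 0 * q 0 < 0 ->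
  exists (b : R) (y : pt) (L1 L2 : R),
  [/\ 0 < b <= T, c1arc alpha (x 0) y L1, c1arc alpha y (x b) L2 & L1 + L2 < b].
Proof.
move=> T0 hT zq0; have w0 := w_gt0.
pose hp := pi_a R (alpha m) / w.
have hpw : w * hp = pi_a R (alpha m) by rewrite /hp mulrC divfK // gt_eqF.
have hp0 : 0 < hp by rewrite divr_gt0 // pi_a_gt0.
have hpT : 0 < S T - S 0 - hp by rewrite subr_gt0 -(ltr_pM2l w0) hpw.
have cz : {for 0, continuous (fun t => z t * q t)}.
  by apply: continuousM; [exact: continuous_x H _ _|exact: continuous_p H _ _].
have [d d0 Hd] := continuous_sign cz (ltr0_neq0 zq0).
(* The excess [dd] must stay below [hp], and [hp + dd] must fit before [T]. *)
pose e := Num.min hp (S T - S 0 - hp).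
have [ep e1' e2'] : [/\ 0 < e, e <= hp & e <= S T - S 0 - hp].
  by rewrite /e lt_min hp0 hpT !ge_min !lexx orbT.
have cS : {for 0, continuous S} := clock_continuous HS.
have /continuous_epsP/(_ _ ep)[d' d'0 Hd'] := cS.
pose a' := Num.min (d / 2) (d' / 2).
have [a'0 a'd a'd'] : [/\ 0 < a', a' < d & a' < d'].
  rewrite /a' lt_min !divr_gt0 // !gt_min; split => //; apply/orP; [left|right]; lra.
have Sa' : S 0 < S a' by rewrite (clock_ltE _ _ HS).
have Sae : S a' - S 0 < e.
  by have := Hd' a'; rewrite subr0 !gtr0_norm ?subr_gt0 //; exact.
pose dd := S a' - S 0.
have rngb y : S 0 <= y <= S T -> S (clock_inv S y) = y by move=> /(clock_ivt HS)[].
have dd0 : 0 < dd by rewrite subr_gt0.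
have ddh : dd < hp by rewrite /dd; lra.
have ddT : dd < S T - S 0 - hp by rewrite /dd; lra.
have r1 : S 0 <= S 0 + hp + dd <= S T by clear -dd0 ddh ddT hp0; lra.
have r2 : S 0 <= S 0 + hp <= S T by clear -dd0 ddh ddT hp0; lra.
have r3 : S 0 <= S 0 + 2 * dd <= S T by clear -dd0 ddh ddT hp0; lra.
have zqn t : 0 <= t <= a' -> z t * q t < 0.
  move=> /andP[t0 ta]; have := Hd t; rewrite subr0 ger0_norm // => /(_ (le_lt_trans ta a'd)).
  by rewrite nmulr_lgt0.
have [y [L1 [L2 [h1 h2 h3]]]] := @detour dd hp hpw dd0 ddh a' (clock_inv S (S 0 + hp + dd))
  (clock_inv S (S 0 + hp)) (clock_inv S (S 0 + 2 * dd)) ltac:(by rewrite /dd; ring)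
  (rngb _ r1) (rngb _ r2) (rngb _ r3) zqn.
exists (clock_inv S (S 0 + hp + dd)), y, L1, L2; split => //.
rewrite -(clock_ltE 0 _ HS) -(clock_leE _ T HS) (rngb _ r1).
by clear -dd0 ddh ddT hp0; apply/andP; split; lra.
Qed.

End Competitor.

(** * Upper bounds for the distance *)

Section AdmissibleArcs.
Variables (R : realType) (n : nat) (alpha : 'I_n -> nat).
Notation pt := ('I_n.+1 -> R).
Notation mu := (@lebesgue_measure R).

Lemma itvcc_setU (a b c : R) : a <= b -> b <= c -> `[a, c]%classic = `[a, b] `|` `]b, c].
Proof.
move=> ab bc; apply/seteqP; split => t /=; rewrite !in_itv /=.
  by move=> /andP[h1 h2]; have [h|h] := leP t b; [left|right]; rewrite ?h1 ?h2 ?h.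
case=> /andP[h1 h2]; rewrite ?h1 ?h2 ?andbT //=; first exact: le_trans bc.
by apply: le_trans (ltW h1).
Qed.

Lemma disj_itvcc (a b c : R) : [disjoint `[a, b]%classic & `]b, c]%classic].
Proof.
rewrite disj_set2E; apply/eqP/seteqP; split => t //= [].
rewrite !in_itv /= => /andP[_ h1] /andP[h2 _].
by move: (lt_le_trans h2 h1); rewrite ltxx.
Qed.

Section Glue.
Variables (f1 f2 : R -> R) (a b c : R).
Hypotheses (ab : a <= b) (bc : b <= c).
Definition glue t := if t <= b then f1 t else f2 t.

Lemma glue1 : {in `[a, b]%classic, f1 =1 glue}.
Proof. by move=> t; rewrite inE /= in_itv /= /glue => /andP[_ ->]. Qed.

Lemma glue2 t : {in `]b, t]%classic, f2 =1 glue}.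
Proof. by move=> s; rewrite inE /= in_itv /= => /andP[bs _]; rewrite /glue leNgt bs. Qed.

Lemma measurable_glue : measurable_fun `[a, b] f1 -> measurable_fun `[b, c] f2 ->
  measurable_fun `[a, c] glue.
Proof.
move=> m1 m2; rewrite (itvcc_setU ab bc); apply/measurable_funU => //; split => //.
  exact: eq_measurable_fun glue1 m1.
apply: eq_measurable_fun (@glue2 c) _.
by apply: measurable_funS m2 => //; apply: subset_itvr; rewrite bnd_simp.
Qed.

Lemma integrable_glue : mu.-integrable `[a, b] (EFin \o f1) -> mu.-integrable `[b, c] (EFin \o f2) ->
  mu.-integrable `[a, c] (EFin \o glue).
Proof.
move=> h1 h2.
have /integrableP[m1 i1] : mu.-integrable `[a, b] (EFin \o glue).
  by apply: eq_integrable h1 => // t /glue1 /= ->.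
have h2' : mu.-integrable `]b, c] (EFin \o f2).
  by apply: integrableS h2 => //; apply: subset_itvr; rewrite bnd_simp.
have /integrableP[m2 i2] : mu.-integrable `]b, c] (EFin \o glue).
  by apply: eq_integrable h2' => // t /glue2 /= ->.
have m : measurable_fun (`[a, b] `|` `]b, c]) (EFin \o glue) by apply/measurable_funU.
apply/integrableP; rewrite (itvcc_setU ab bc); split => //.
rewrite ge0_integral_setU //; first exact: lte_add_pinfty.
  exact: measurableT_comp.
exact: disj_itvcc.
Qed.

Lemma Rintegral_glue1 t : t <= b -> Rintegral mu `[a, t] glue = Rintegral mu `[a, t] f1.
Proof.
move=> tb; apply: eq_Rintegral => s; rewrite inE /= in_itv /= /glue => /andP[_ st].
by rewrite (le_trans st tb).
Qed.

Lemma Rintegral_glue2 t : b <= t <= c -> mu.-integrable `[a, b] (EFin \o f1) ->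
  mu.-integrable `[b, c] (EFin \o f2) ->
  Rintegral mu `[a, t] glue = Rintegral mu `[a, b] f1 + Rintegral mu `[b, t] f2.
Proof.
move=> /andP[bt tc] h1 h2.
have hg : mu.-integrable `[a, t] (EFin \o glue).
  by apply: integrableS (integrable_glue h1 h2) => //; apply: subset_itvl; rewrite bnd_simp.
have := @Rintegral_itvB _ glue (BLeft a) (BRight t) b hg.
rewrite !bnd_simp => /(_ ab bt) e.
rewrite -(@Rintegral_glue1 b) // -[RHS]addrC -[LHS](subrK (Rintegral mu `[a, b] glue)) e.
congr (_ + _); rewrite -Rintegral_itv_obnd_cbnd.
  by apply: eq_Rintegral => s /glue2 ->.
by apply: integrableS h2 => //; apply: subset_itv; rewrite bnd_simp.
Qed.
End Glue.

Lemma continuous_unorm (u : R -> pt) (t : R) : (forall j, {for t, continuous (fun s => u s j)}) ->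
  {for t, continuous (fun s => unorm (u s))}.
Proof.
move=> cu; apply: (@continuous_comp _ _ _ (fun s => \sum_(j < n.+1) u s j ^+ 2) Num.sqrt).
  rewrite (_ : (fun s => _) = \sum_(j < n.+1) (fun s => u s j ^+ 2)); last first.
    by apply/funext => s; rewrite fct_sumE.
  elim/big_ind: _ => [|f g|i _].
  - exact: cvg_cst.
  - by move=> cf cg; apply: continuousD.
  - apply: (@continuous_comp _ _ _ (fun s => u s i) (fun y => y ^+ 2)); first exact: cu.
    exact: exprn_continuous.
exact: sqrt_continuous.
Qed.

Lemma continuous_measurable (f : R -> R) (a b : R) :
  (forall t, a <= t <= b -> {for t, continuous f}) -> measurable_fun `[a, b] f.
Proof.
move=> cf; apply: subspace_continuous_measurable_fun => //.
by apply: continuous_in_subspaceT => t; rewrite inE /= in_itv /= => /cf.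
Qed.

(** [admissible] on any parameter interval, together with a length bound, so that the pieces of a
    curve can be placed on subintervals of [[0, 1]]. *)
Record admissible_on (a b : R) (y z : pt) (L : R) (g u : R -> pt) : Prop := AdmissibleOn {
  ao_meas : forall j, measurable_fun `[a, b] (fun s => u s j);
  ao_len : mu.-integrable `[a, b] (EFin \o (fun s => unorm (u s)));
  ao_int : forall j, mu.-integrable `[a, b] (EFin \o (fun s => u s j * xi alpha (g s) j));
  ao_eq : forall j t, a <= t <= b ->
    g t j = y j + Rintegral mu `[a, t] (fun s => u s j * xi alpha (g s) j);
  ao_end : g b = z;
  ao_le : Rintegral mu `[a, b] (fun s => unorm (u s)) <= L }.

Definition arc_on a b y z L := exists g u, admissible_on a b y z L g u.

Lemma c1arc_on y z L (a b : R) : a < b -> c1arc alpha y z L -> arc_on a b y z L.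
Proof.
move=> ab [g [u [Lam [dLam [c [d [cd [<- <-] -> H1 H2]]]]]]].
pose m := (d - c) / (b - a).
have m0 : 0 < m by rewrite divr_gt0 // subr_gt0.
have ba : b - a != 0 by rewrite subr_eq0 gt_eqF.
pose th t := c + m * (t - a).
have tha : th a = c by rewrite /th subrr mulr0 addr0.
have thb : th b = d by rewrite /th /m divfK // addrC subrK.
have thI t : a <= t <= b -> c <= th t <= d.
  move=> /andP[h1 h2]; rewrite -{1}tha -thb /th !lerD2l !ler_pM2l // !lerD2r.
  by rewrite h1 h2.
have dth (t : R) : is_derive t 1 th m.
  have D : is_derive t 1 (fun s : R => s - a) (1 - 0) := is_derive_sub (is_derive_id t 1) (is_derive_cst a t 1).
  have := is_derive_add (is_derive_cst c t 1) (is_derive_cmul m D).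
  by rewrite subr0 mulr1 add0r.
have cth t : {for t, continuous th} := is_derive_continuous (dth t).
have cu j t : a <= t <= b -> {for t, continuous (fun s => m * u (th s) j)}.
  move=> tab; apply: (@continuousM _ _ (cst m)); first exact: cvg_cst.
  apply: (@continuous_comp _ _ _ th (fun s => u s j)) => //.
  by have [_] := H1 (th t) j (thI t tab).
have dg j (t : R) : a <= t <= b -> is_derive t 1 (fun s => g (th s) j) (m * u (th t) j * xi alpha (g (th t)) j).
  move=> tab; have [D _] := H1 (th t) j (thI t tab).
  apply: (is_derive_ext (is_derive1_comp D (dth t))) => //.
  by ring.
have cxi j t : a <= t <= b -> {for t, continuous (fun s => xi alpha (g (th s)) j)}.
  move=> tab; rewrite (_ : (fun s => _) = \prod_(i < n | (i < j)%N) (fun s => g (th s) (wid i) ^+ alpha i)); last first.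
    by apply/funext => s; rewrite fct_prodE.
  elim/big_ind: _ => [|f1 g1|i _].
  - exact: cvg_cst.
  - by move=> cf cg; apply: continuousM.
  - apply: (@continuous_comp _ _ _ (fun s => g (th s) (wid i)) (fun y => y ^+ alpha i)).
      exact: is_derive_continuous (dg (wid i) t tab).
    exact: exprn_continuous.
have cint j t : a <= t <= b -> {for t, continuous (fun s => m * u (th s) j * xi alpha (g (th s)) j)}.
  by move=> tab; apply: continuousM; [exact: cu|exact: cxi].
have cun t : a <= t <= b -> {for t, continuous (fun s => unorm (fun j => m * u (th s) j))}.
  by move=> tab; apply: (@continuous_unorm (fun s j => m * u (th s) j)) => j; exact: cu.
exists (fun s => g (th s)), (fun s j => m * u (th s) j); split.
- by move=> j; apply: continuous_measurable => t; exact: cu.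
- exact: continuous_integrable.
- by move=> j; apply: continuous_integrable => t; exact: cint.
- move=> j t /andP[h1 h2].
  have -> : Rintegral mu `[a, t] (fun s => m * u (th s) j * xi alpha (g (th s)) j) =
    g (th t) j - g (th a) j.
    apply: (@Rintegral_FTC2 _ _ (fun s => g (th s) j)) => // s /andP[s1 s2].
      by apply: dg; rewrite s1 (le_trans s2 h2).
    by apply: cint; rewrite s1 (le_trans s2 h2).
  by rewrite tha addrC subrK.
- by rewrite thb.
- have cL t : a <= t <= b -> {for t, continuous (fun s => m * dLam (th s))}.
    move=> tab; apply: (@continuousM _ _ (cst m)); first exact: cvg_cst.
    apply: (@continuous_comp _ _ _ th dLam) => //.
    by have [] := H2 (th t) (thI t tab).
  apply: (@le_trans _ _ (Rintegral mu `[a, b] (fun s => m * dLam (th s)))).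
    apply: le_Rintegral => //; [exact: continuous_integrable|exact: continuous_integrable|].
    move=> t; rewrite /= in_itv /= => tab.
    have [_ _ h] := H2 (th t) (thI t tab).
    apply: le_trans (_ : m * unorm (u (th t)) <= _); last by rewrite ler_pM2l.
    rewrite /unorm le_eqVlt; apply/orP; left; apply/eqP.
    rewrite -{2}(gtr0_norm m0) -sqrtr_sqr -sqrtrM ?sqr_ge0 // mulr_sumr.
    by congr Num.sqrt; apply: eq_bigr => j _; rewrite exprMn.
  rewrite -{1}tha -thb le_eqVlt; apply/orP; left; apply/eqP.
  apply: (@Rintegral_FTC2 _ _ (fun s => Lam (th s))) => //; first exact: ltW.
  move=> t tab; have [D _ _] := H2 (th t) (thI t tab).
  apply: (is_derive_ext (is_derive1_comp D (dth t))) => //.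
  by ring.
Qed.

Lemma arc_on_cat y w z L1 L2 (a b c : R) : a <= b -> b <= c ->
  arc_on a b y w L1 -> arc_on b c w z L2 -> arc_on a c y z (L1 + L2).
Proof.
move=> ab bc [g1 [u1 H1]] [g2 [u2 H2]].
have g12 : g1 b = g2 b.
  apply/funext => j; rewrite (ao_end H1).
  by rewrite (ao_eq H2) ?lexx // set_itv1 Rintegral_set1 addr0.
pose g t := if t <= b then g1 t else g2 t.
pose u t := if t <= b then u1 t else u2 t.
have uE j : (fun s => u s j) = glue (fun s => u1 s j) (fun s => u2 s j) b.
  by apply/funext => s; rewrite /u /glue; case: ifP.
have nE : (fun s => unorm (u s)) = glue (fun s => unorm (u1 s)) (fun s => unorm (u2 s)) b.
  by apply/funext => s; rewrite /u /glue; case: ifP.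
have iE j : (fun s => u s j * xi alpha (g s) j) =
    glue (fun s => u1 s j * xi alpha (g1 s) j) (fun s => u2 s j * xi alpha (g2 s) j) b.
  by apply/funext => s; rewrite /u /g /glue; case: ifP.
exists g, u; split.
- by move=> j; rewrite uE; apply: measurable_glue => //; [exact: ao_meas H1 j|exact: ao_meas H2 j].
- by rewrite nE; apply: integrable_glue => //; [exact: ao_len H1|exact: ao_len H2].
- by move=> j; rewrite iE; apply: integrable_glue => //; [exact: ao_int H1 j|exact: ao_int H2 j].
- move=> j t /andP[h1 h2]; rewrite iE /g; have [tb|tb] := leP t b.
    by rewrite Rintegral_glue1 // (ao_eq H1) // h1.
  rewrite (@Rintegral_glue2 _ _ a b c) // ?(ltW tb) //; [|exact: ao_int H1 j|exact: ao_int H2 j].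
  by rewrite (ao_eq H2) ?(ltW tb) // -(ao_end H1) (ao_eq H1) ?ab ?lexx // addrA.
- rewrite /g; have [cb|cb] := leP c b; last exact: ao_end H2.
  have -> : c = b by apply/eqP; rewrite eq_le cb.
  rewrite g12; have -> : b = c by apply/eqP; rewrite eq_le bc.
  exact: ao_end H2.
- rewrite nE (@Rintegral_glue2 _ _ a b c) // ?bc ?lexx //; [|exact: ao_len H1|exact: ao_len H2].
  by apply: lerD; [exact: ao_le H1|exact: ao_le H2].
Qed.

(** Concatenation leaves corners, so the smooth arcs are kept apart and only their length bounds are
    added. *)
Inductive chain : pt -> pt -> R -> Prop :=
| chain1 y z L : c1arc alpha y z L -> chain y z L
| chain_cat y w z L1 L2 : chain y w L1 -> chain w z L2 -> chain y z (L1 + L2).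

Lemma chain_rev y z L : chain y z L -> chain z y L.
Proof.
elim=> [{}y {}z {}L h|{}y w {}z L1 L2 _ h1 _ h2]; first exact/chain1/c1arc_rev.
by rewrite addrC; apply: chain_cat h2 h1.
Qed.

(** Each concatenation splits the parameter interval at its midpoint. *)
Lemma chain_on y z L (a b : R) : a < b -> chain y z L -> arc_on a b y z L.
Proof.
move=> + h; elim: h a b => [{}y {}z {}L h|{}y w {}z L1 L2 _ h1 _ h2] a b ab; first exact: c1arc_on.
have m1 : a < (a + b) / 2 by lra.
have m2 : (a + b) / 2 < b by lra.
exact: arc_on_cat (ltW m1) (ltW m2) (h1 _ _ m1) (h2 _ _ m2).
Qed.

Lemma chain_cc_dist y z L : chain y z L -> (cc_dist alpha y z <= L%:E)%E.
Proof.
move=> /(chain_on (@ltr01 R))[g [u H]].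
apply: (@le_trans _ _ (Rintegral mu `[0, 1] (fun s => unorm (u s)))%:E); last by rewrite lee_fin; exact: ao_le H.
apply: ereal_inf_lbound; exists u => //; exists g.
have g0 : g 0 = y.
  by apply/funext => j; rewrite (ao_eq H) ?lexx ?ler01 // set_itv1 Rintegral_set1 addr0.
split; last by split; [|exact: ao_end H].
split; first exact: ao_meas H.
split; first exact: ao_len H.
split; first exact: ao_int H.
by move=> j t t01; rewrite g0 (ao_eq H).
Qed.

End AdmissibleArcs.

(** * Subsolutions of the eikonal equation *)

(** The remainders satisfy [r_(N+1) = y r_N + N X ^ (N-1) (y - X) ^ 2], whence the constant. *)
Lemma pow_taylor (R : realType) (B : R) (N : nat) : 0 <= B ->
  exists2 C : R, 0 <= C & forall X y : R, `|X| <= B -> `|y| <= B ->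
    `|y ^+ N - X ^+ N - N%:R * X ^+ N.-1 * (y - X)| <= C * (y - X) ^+ 2.
Proof.
move=> B0; elim: N => [|N [C C0 IH]].
  by exists 0 => // X y _ _; rewrite !expr0 subrr !mul0r subrr normr0.
exists (B * C + N%:R * B ^+ N.-1); first by rewrite addr_ge0 ?mulr_ge0 ?exprn_ge0.
move=> X y hX hy.
have -> : y ^+ N.+1 - X ^+ N.+1 - N.+1%:R * X ^+ N.+1.-1 * (y - X) =
  y * (y ^+ N - X ^+ N - N%:R * X ^+ N.-1 * (y - X)) + N%:R * X ^+ N.-1 * (y - X) ^+ 2.
  case: N {IH} => [|N] /=; first by rewrite !expr0 expr1; ring.
  by rewrite !exprS -!natr1; ring.
rewrite mulrDl; apply: le_trans (ler_normD _ _) _; apply: lerD.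
  rewrite normrM -[X in _ <= X]mulrA; apply: ler_pM => //; exact: IH.
rewrite normrM (ger0_norm (sqr_ge0 _)) ler_wpM2r ?sqr_ge0 // normrM normr_nat ler_wpM2l //.
by rewrite normrX lerXn2r // nnegrE.
Qed.

(* The Hamilton-Jacobi inequality for the quadratic corrector: the terms of order one in [h]
   cancel and [- kappa K h ^ 2] absorbs the second order ones. *)
Lemma eikonal_ineq (R : realType) (kappa v0 M K V V1 C Q th h W0 : R) :
  let mu := - (kappa * V1 / (2 * V)) + th * Q / (kappa * V) in
  let Nm := kappa * M / (2 * v0) + M / (kappa * v0) in
  0 < kappa -> 0 < v0 -> 0 <= M -> v0 <= V -> `|V1| <= M -> `|Q| <= M -> 0 <= C <= M -> `|th| <= 1 ->
  0 <= K -> K * `|h| <= 1 -> `|h| <= 1 -> (M + M) * `|h| <= v0 / 2 ->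
  0 <= W0 <= V + V1 * h + C * h ^+ 2 ->
  (Nm ^+ 2 + Nm + 1 + 2 / v0 * (1 + 4 * kappa * Nm * M + kappa ^+ 2 * M)) <= kappa * K ->
  (Q - th * h) ^+ 2 + W0 * (kappa + mu * h - K / 2 * h ^+ 2) ^+ 2 <= Q ^+ 2 + kappa ^+ 2 * V.
Proof.
move=> mu Nm k0 v00 M0 vV hV1 hQ /andP[C0 CM] hth K0 Kh h1 hM /andP[W00 hW] hK.
have V0 : 0 < V by exact: lt_le_trans vV.
have Nm0 : 0 <= Nm by rewrite /Nm addr_ge0 // divr_ge0 // ?mulr_ge0 // ltW.
have hmu : `|mu| <= Nm.
  rewrite /mu /Nm; apply: le_trans (ler_normD _ _) _; apply: lerD.
    rewrite normrN !normrM (gtr0_norm k0) -!mulrA ler_pM2l //.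
    rewrite (ger0_norm (_ : 0 <= (2 * V)^-1)) ?invr_ge0 ?mulr_ge0 ?(ltW V0) //.
    apply: ler_pM; rewrite ?normr_ge0 ?invr_ge0 ?mulr_ge0 ?(ltW V0) //.
    by rewrite lef_pV2 ?posrE ?mulr_gt0 // ler_pM2l.
  rewrite !normrM (ger0_norm (_ : 0 <= (kappa * V)^-1)) ?invr_ge0 ?mulr_ge0 ?(ltW V0) ?(ltW k0) //.
  apply: ler_pM; rewrite ?mulr_ge0 // ?invr_ge0 ?mulr_ge0 ?(ltW V0) ?(ltW k0) //.
    by rewrite -[M]mul1r ler_pM.
  by rewrite lef_pV2 ?posrE ?mulr_gt0 // ler_pM2l.
pose D := kappa * K - (Nm ^+ 2 + Nm + 1).
have hmu1 : mu <= Nm by apply: le_trans hmu; exact: ler_norm.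
have hmu2 : - Nm <= mu by rewrite lerNl; apply: le_trans hmu; rewrite -normrN ler_norm.
have h2 : `|h| ^+ 2 = h ^+ 2 by rewrite real_normK ?num_real.
have h20 := sqr_ge0 h.
(* Exact expansion in [h], where [K |h| <= 1] turns the cubic and quartic terms into multiples of
   [h ^ 2]. *)
have F2 : (kappa + mu * h - K / 2 * h ^+ 2) ^+ 2 <= kappa ^+ 2 + 2 * kappa * mu * h - D * h ^+ 2.
  have -> : (kappa + mu * h - K / 2 * h ^+ 2) ^+ 2 = kappa ^+ 2 + 2 * kappa * mu * h +
    (mu ^+ 2 - kappa * K - mu * (K * h) + (K * h) ^+ 2 / 4) * h ^+ 2 by field.
  rewrite lerD2l -[X in _ <= X]mulNr ler_wpM2r // /D.
  have mu2 : mu ^+ 2 <= Nm ^+ 2 by rewrite -[mu ^+ 2]real_normK ?num_real // lerXn2r ?nnegrE.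
  have Kh' : `|K * h| <= 1 by rewrite normrM (ger0_norm K0).
  have a1 : - (mu * (K * h)) <= Nm.
    apply: le_trans (ler_norm _) _; rewrite normrN normrM -[Nm]mulr1; exact: ler_pM.
  have a2 : (K * h) ^+ 2 <= 1 by rewrite -real_normK ?num_real // expr_le1.
  clear -mu2 a1 a2; lra.
have D0 : 2 / v0 * (1 + 4 * kappa * Nm * M + kappa ^+ 2 * M) <= D by rewrite /D; clear -hK; lra.
have P0 : 0 <= 1 + 4 * kappa * Nm * M + kappa ^+ 2 * M.
  by rewrite !addr_ge0 // !mulr_ge0 ?sqr_ge0 // ltW.
have D00 : 0 <= D by apply: le_trans D0; rewrite mulr_ge0 // divr_ge0 // ltW.
pose W := V + V1 * h + C * h ^+ 2.
have b1 : `|V1 * h| <= M * `|h| by rewrite normrM ler_wpM2r.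
have Wlow : v0 / 2 <= W.
  have c1 : - (V1 * h) <= M * `|h| by apply: le_trans b1; rewrite -normrN ler_norm.
  have c2 : 0 <= C * h ^+ 2 by rewrite mulr_ge0.
  have c3 : 0 <= M * `|h| by rewrite mulr_ge0.
  by rewrite /W; clear -c1 c2 c3 hM vV; lra.
have W0' : 0 <= W by apply: le_trans Wlow; rewrite divr_ge0 // ltW.
have step1 : W0 * (kappa + mu * h - K / 2 * h ^+ 2) ^+ 2 <=
    W * (kappa ^+ 2 + 2 * kappa * mu * h - D * h ^+ 2).
  apply: le_trans (_ : W * (kappa + mu * h - K / 2 * h ^+ 2) ^+ 2 <= _).
    by rewrite ler_wpM2r // sqr_ge0.
  by rewrite ler_wpM2l.
apply: (le_trans (lerD (lexx _) step1)).
have e1 : W * (kappa ^+ 2 + 2 * kappa * mu * h - D * h ^+ 2) =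
   V * kappa ^+ 2 + (2 * kappa * mu * V + kappa ^+ 2 * V1) * h +
   (2 * kappa * mu * V1 + kappa ^+ 2 * C + 2 * kappa * mu * C * h) * h ^+ 2 - W * D * h ^+ 2.
  by rewrite /W; ring.
(* This identity dictates [mu]: it cancels the term [- 2 th Q h] of the first square. *)
have e2 : 2 * kappa * mu * V + kappa ^+ 2 * V1 = 2 * th * Q.
  by rewrite /mu; field; rewrite !gt_eqF.
have t2 : th ^+ 2 <= 1 by rewrite -real_normK ?num_real // expr_le1.
have WD : 1 + 4 * kappa * Nm * M + kappa ^+ 2 * M <= W * D.
  have : v0 / 2 * (2 / v0 * (1 + 4 * kappa * Nm * M + kappa ^+ 2 * M)) <= W * D.
    have v2 : 0 <= v0 / 2 by rewrite divr_ge0 // ltW.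
    have p2 : 0 <= 2 / v0 by rewrite divr_ge0 // ltW.
    by apply: ler_pM => //; apply: mulr_ge0.
  by rewrite mulrA (_ : v0 / 2 * (2 / v0) = 1) ?mul1r //; field; rewrite gt_eqF.
have m1 : mu * V1 <= Nm * M.
  by apply: le_trans (ler_norm _) _; rewrite normrM; apply: ler_pM.
have m2 : mu * C * h <= Nm * M.
  apply: le_trans (ler_norm _) _; rewrite -mulrA normrM; apply: ler_pM => //.
  by rewrite normrM (ger0_norm C0) -[M]mulr1; apply: ler_pM.
have k20 : 0 <= 2 * kappa by rewrite mulr_ge0 // ltW.
have m1' : 2 * kappa * (mu * V1) <= 2 * kappa * (Nm * M) by rewrite ler_wpM2l.
have m2' : 2 * kappa * (mu * C * h) <= 2 * kappa * (Nm * M) by rewrite ler_wpM2l.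
have m3' : kappa ^+ 2 * C <= kappa ^+ 2 * M by rewrite ler_wpM2l // sqr_ge0.
rewrite e1 e2.
have -> : (Q - th * h) ^+ 2 + (V * kappa ^+ 2 + 2 * th * Q * h +
   (2 * kappa * mu * V1 + kappa ^+ 2 * C + 2 * kappa * mu * C * h) * h ^+ 2 - W * D * h ^+ 2) =
   Q ^+ 2 + kappa ^+ 2 * V + (th ^+ 2 + 2 * kappa * (mu * V1) + kappa ^+ 2 * C + 2 * kappa * (mu * C * h) - W * D) * h ^+ 2.
  by ring.
rewrite gerDl mulr_le0_ge0 //.
by clear -t2 m1' m2' m3' WD; lra.
Qed.

(** * Differentiability in several variables *)

Section Differentiability.
Variables (R : realType) (n : nat).
Notation pt := ('I_n.+1 -> R).
Implicit Types (y z G : pt) (S : pt -> R).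

Definition l1 z y : R := \sum_(k < n.+1) `|z k - y k|.

Lemma l1_ge0 z y : 0 <= l1 z y.
Proof. by apply: sumr_ge0 => k _; rewrite normr_ge0. Qed.

Lemma l1_coord z y k : `|z k - y k| <= l1 z y.
Proof. by rewrite /l1 (bigD1 k) //= lerDl sumr_ge0. Qed.

Lemma l1xx y : l1 y y = 0.
Proof. by rewrite /l1 big1 // => k _; rewrite subrr normr0. Qed.

Lemma l1_tri z y w : l1 z w <= l1 z y + l1 y w.
Proof. by rewrite /l1 -big_split; apply: ler_sum => k _; exact: ler_distD. Qed.

Definition lin G z y : R := \sum_(k < n.+1) G k * (z k - y k).

Lemma lin_le G z y : `|lin G z y| <= (\sum_(k < n.+1) `|G k|) * l1 z y.
Proof.
apply: le_trans (ler_norm_sum _ _ _) _; rewrite mulr_suml; apply: ler_sum => k _.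
by rewrite normrM ler_wpM2l // l1_coord.
Qed.

(** Fréchet differentiability with gradient [G], measured in the norm [l1]. *)
Definition diffat S G y : Prop := forall e : R, 0 < e -> exists2 d : R, 0 < d &
  forall z, l1 z y < d -> `|S z - S y - lin G z y| <= e * l1 z y.

Lemma diffat_continuous S G y : diffat S G y -> forall e : R, 0 < e ->
  exists2 d : R, 0 < d & forall z, l1 z y < d -> `|S z - S y| < e.
Proof.
move=> D e e0; have [d d0 Hd] := D 1 ltr01.
pose M := 1 + \sum_(k < n.+1) `|G k|.
have M0 : 0 < M by rewrite ltr_pwDl // sumr_ge0.
exists (Num.min d (e / M)); first by rewrite lt_min d0 divr_gt0.
move=> z; rewrite lt_min => /andP[z1 z2].
have -> : S z - S y = (S z - S y - lin G z y) + lin G z y by rewrite subrK.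
apply: le_lt_trans (ler_normD _ _) _.
apply: le_lt_trans (lerD (Hd _ z1) (lin_le _ _ _)) _.
by rewrite -mulrDl mulrC -ltr_pdivlMr.
Qed.

Lemma diffat_cst (c : R) y : diffat (fun=> c) (fun=> 0) y.
Proof.
move=> e e0; exists 1 => // z _; rewrite /lin subrr sub0r normrN big1 ?normr0 ?mulr_ge0 ?l1_ge0 ?ltW //.
by move=> k _; rewrite mul0r.
Qed.

Lemma diffat_coord j y : diffat (fun z => z j) (fun k => (k == j)%:R) y.
Proof.
move=> e e0; exists 1 => // z _.
have -> : lin (fun k => (k == j)%:R) z y = z j - y j.
  rewrite /lin (bigD1 j) //= eqxx mul1r big1 ?addr0 // => k /negbTE ->; exact: mul0r.
by rewrite subrr normr0 mulr_ge0 ?l1_ge0 // ltW.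
Qed.

Lemma diffat_add S1 S2 G1 G2 y : diffat S1 G1 y -> diffat S2 G2 y ->
  diffat (fun z => S1 z + S2 z) (fun k => G1 k + G2 k) y.
Proof.
move=> D1 D2 e e0; have e2 : 0 < e / 2 by rewrite divr_gt0.
have [d1 d10 H1] := D1 _ e2; have [d2 d20 H2] := D2 _ e2.
exists (Num.min d1 d2); first by rewrite lt_min d10.
move=> z; rewrite lt_min => /andP[/H1 h1 /H2 h2].
have -> : lin (fun k => G1 k + G2 k) z y = lin G1 z y + lin G2 z y.
  by rewrite /lin -big_split; apply: eq_bigr => k _; rewrite mulrDl.
have -> : S1 z + S2 z - (S1 y + S2 y) - (lin G1 z y + lin G2 z y) =
  (S1 z - S1 y - lin G1 z y) + (S2 z - S2 y - lin G2 z y) by ring.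
apply: le_trans (ler_normD _ _) _; apply: le_trans (lerD h1 h2) _.
by rewrite -mulrDl -splitr.
Qed.

Lemma diffat_comp S G y (f : R -> R) (df : R) : diffat S G y -> is_derive (S y) 1 f df ->
  diffat (fun z => f (S z)) (fun k => df * G k) y.
Proof.
move=> D /is_derive_epsP Df e e0.
pose M := \sum_(k < n.+1) `|G k|.
have M0 : 0 <= M by rewrite sumr_ge0.
have N0 : 0 < M + 1 + `|df| by rewrite addrAC ltr_wpDl // addr_ge0.
pose e1 := Num.min 1 (e / 2 / (M + 1 + `|df|)).
have e10 : 0 < e1 by rewrite lt_min ltr01 !divr_gt0.
have e1a : e1 <= 1 by rewrite ge_min lexx.
have e1b : e1 * (M + 1 + `|df|) <= e / 2 by rewrite -ler_pdivlMr // ge_min lexx orbT.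
have [d1 d10 H1] := Df _ e10; have [d2 d20 H2] := D _ e10.
have [d3 d30 H3] := diffat_continuous D d10.
exists (Num.min d2 d3); first by rewrite lt_min d20.
move=> z; rewrite lt_min => /andP[/H2 h2 /H3/H1 h1].
have -> : lin (fun k => df * G k) z y = df * lin G z y.
  by rewrite /lin mulr_sumr; apply: eq_bigr => k _; rewrite mulrA.
have -> : f (S z) - f (S y) - df * lin G z y =
  (f (S z) - f (S y) - df * (S z - S y)) + df * (S z - S y - lin G z y) by ring.
apply: le_trans (ler_normD _ _) _; rewrite normrM.
have l0 := l1_ge0 z y.
have h3 : `|S z - S y| <= (M + 1) * l1 z y.
  have -> : S z - S y = (S z - S y - lin G z y) + lin G z y by rewrite subrK.
  apply: le_trans (ler_normD _ _) _; rewrite mulrDl mul1r addrC; apply: lerD; first exact: lin_le.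
  by apply: le_trans h2 _; rewrite -[X in _ <= X]mul1r ler_wpM2r.
apply: (@le_trans _ _ (e1 * ((M + 1) * l1 z y) + `|df| * (e1 * l1 z y))).
  apply: lerD; last by rewrite ler_wpM2l.
  by apply: le_trans h1 _; rewrite ler_wpM2l // ltW.
have -> : e1 * ((M + 1) * l1 z y) + `|df| * (e1 * l1 z y) = e1 * (M + 1 + `|df|) * l1 z y by ring.
rewrite ler_wpM2r //; apply: le_trans e1b _.
by clear -e0; lra.
Qed.

Lemma diffat_ext S1 S2 G1 G2 y : diffat S1 G1 y -> S1 =1 S2 -> G1 =1 G2 -> diffat S2 G2 y.
Proof. by move=> D /funext <- /funext <-. Qed.

Lemma diffat_scale (c : R) S G y : diffat S G y -> diffat (fun z => c * S z) (fun k => c * G k) y.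
Proof.
move=> D; apply: (diffat_comp D (f := fun s => c * s)).
by have := is_derive_cmul c (is_derive_id (S y) 1); rewrite mulr1.
Qed.

(** Polarization, [4 S1 S2 = (S1 + S2) ^ 2 - (S1 - S2) ^ 2], reduces products to the chain rule. *)
Lemma diffat_mul S1 S2 G1 G2 y : diffat S1 G1 y -> diffat S2 G2 y ->
  diffat (fun z => S1 z * S2 z) (fun k => S2 y * G1 k + S1 y * G2 k) y.
Proof.
move=> D1 D2.
have sq S G : diffat S G y -> diffat (fun z => S z ^+ 2) (fun k => 2 * S y * G k) y.
  move=> D; apply: (diffat_comp D (f := fun s => s ^+ 2)).
  by have := is_derive_pow 2 (is_derive_id (S y) 1); rewrite /= expr1 mulr1.
have Dp := sq _ _ (diffat_add D1 D2).
have Dm := sq _ _ (diffat_add D1 (diffat_scale (-1) D2)).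
apply: (diffat_ext (diffat_scale (4^-1) (diffat_add Dp (diffat_scale (-1) Dm)))) => [z|k] /=.
 by field. by field.
Qed.

End Differentiability.

(** * Local calibrations *)

Section Calibration.
Variables (R : realType) (n : nat) (alpha : 'I_n -> nat).
Notation pt := ('I_n.+1 -> R).
Variables (x p : R -> pt).
Hypothesis H : hamilton_solution alpha x p.
Hypothesis Epos : forall k, (k <= n)%N -> 0 < energy alpha (x 0) (p 0) k.
Hypothesis Riem : forall i : 'I_n, x 0 (wid i) ^+ alpha i != 0.
Variable clk : nat -> R -> R.
Hypothesis Hclk : forall m, (m <= n)%N -> is_clock (clk m) (fun t => seg alpha (x t) 0 m ^+ 2).
Local Notation en k := (energy alpha (x 0) (p 0) k).

(* A local subsolution [S] of the eikonal equation at level [m], with gradient [G], whose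
   restriction to the geodesic grows at the maximal rate. *)
Definition calibrates m (S : pt -> R) (G : pt -> pt) (r e : R) : Prop :=
  [/\ 0 < r, 0 < e,
   forall y, l1 y (x 0) < r -> [/\ diffat S (G y) y, forall k : 'I_n.+1, (k < m)%N -> G y k = 0 &
     \sum_(k < n.+1) seg alpha y 0 k ^+ 2 * G y k ^+ 2 <= seg alpha y 0 m ^+ 2] &
   forall t : R, `|t| < e -> S (x t) = S (x 0) + Num.sqrt (en m) * (clk m t - clk m 0)].

(** The last momentum is constant and the last coordinate moves at that rate in its clock, so this
    coordinate, with the sign of the momentum, is a calibration. *)
Lemma calibrate_last : exists S G r e, calibrates n S G r e.
Proof.
have e0 := Epos (leqnn n); rewrite energy_max in e0.
have pn0 : p 0 ord_max != 0 by apply: contraTneq e0 => ->; rewrite expr0n ltxx.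
pose s : R := p 0 ord_max / `|p 0 ord_max|.
have np : `|p 0 ord_max| != 0 by rewrite normr_eq0.
have s2 : s ^+ 2 = 1 by rewrite /s expr_div_n real_normK ?num_real // divff // sqrf_eq0.
have sp : s * p 0 ord_max = `|p 0 ord_max|.
  by rewrite /s mulrAC -expr2 -[_ ^+ 2]real_normK ?num_real // expr2 mulfK.
move: s s2 sp => s s2 sp.
exists (fun z => s * z ord_max), (fun _ k => s * (k == ord_max)%:R), 1, 1; split => //.
  move=> y _; split; first exact: diffat_scale (diffat_coord ord_max y).
    by move=> k kn; rewrite -val_eqE /= ltn_eqF // mulr0.
  rewrite (bigD1 ord_max) //= eqxx mulr1 s2 mulr1 big1 ?addr0 // => k /negbTE ->.
  by rewrite mulr0 expr0n mulr0.
move=> t _; rewrite energy_max sqrtr_sqr -sp -mulrA -mulrDr; congr (_ * _).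
have D (u : R) : is_derive u 1 (fun u => x u ord_max - p 0 ord_max * clk n u) 0.
  have [Dc _] := Hclk (leqnn n).
  apply: (is_derive_ext (is_derive_sub (sol_x H ord_max u) (is_derive_cmul (p 0 ord_max) (Dc u)))) => //.
  rewrite (is_derive_cst0 (sol_p_max H) u 0) /=; ring.
have /= := is_derive_cst0 D t 0; rewrite mulrBr => E.
by rewrite -[LHS](subrK (p 0 ord_max * clk n t)) E; ring.
Qed.

Section Step.
Variables (m : 'I_n) (S' : pt -> R) (G' : pt -> pt) (r' e' : R).
Hypothesis C' : calibrates m.+1 S' G' r' e'.
Local Notation z t := (x t (wid m)).
Local Notation q t := (p t (wid m)).
Let kappa := Num.sqrt (en m.+1).
Let w0 := S' (x 0).
Let sg := clk m.+1.
Let tm := clk m.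
(** The time at which the geodesic takes the value [w] of [S']: along it [S'] is [w0] plus [kappa]
    times the elapsed clock [sg]. *)
Definition clock_time w := clock_inv sg (sg 0 + kappa^-1 * (w - w0)).

Lemma kappa_gt0 : 0 < kappa. Proof. by rewrite sqrtr_gt0; exact: Epos. Qed.
Lemma kappa_sqr : kappa ^+ 2 = en m.+1. Proof. by rewrite sqr_sqrtr // ltW // Epos. Qed.

Lemma T_x t : `|t| < e' -> clock_time (S' (x t)) = t.
Proof.
move=> te; have [_ _ _ /(_ t te) E] := C'.
apply: (clock_invK (Hclk (ltn_ord m))); rewrite E -/w0 addrAC subrr add0r -/kappa mulrA.
by rewrite mulVf ?gt_eqF ?kappa_gt0 // mul1r addrC subrK.
Qed.

Lemma T_near (rho : R) : 0 < rho -> exists2 d : R, 0 < d & forall w, `|w - w0| < d ->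
  [/\ `|clock_time w| < rho, {for w, continuous clock_time} & exists2 d' : R, 0 < d' &
    forall v : R, `|v - w| < d' -> sg (clock_time v) = sg 0 + kappa^-1 * (v - w0)].
Proof.
move=> rho0; have Hsg := Hclk (ltn_ord m); have k0 := kappa_gt0.
have [d1 d10 H1] := clock_inv_near 0 Hsg.
have cinv := @clock_inv_continuous _ sg _ 0 Hsg.
have /continuous_epsP/(_ _ rho0)[d2 d20 H2] := cinv.
pose d := Num.min d1 d2.
have d0 : 0 < d by rewrite lt_min d10.
have sm w : `|w - w0| < kappa * d -> `|kappa^-1 * (w - w0)| < d.
  by rewrite normrM (gtr0_norm (_ : 0 < kappa^-1)) ?invr_gt0 // ltr_pdivrMl.
have T0 : clock_inv sg (sg 0) = 0 := clock_invK Hsg erefl.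
have val w : `|w - w0| < kappa * d -> sg (clock_time w) = sg 0 + kappa^-1 * (w - w0).
  move=> /sm; rewrite lt_min => /andP[h _]; apply: H1; by rewrite addrAC subrr add0r.
exists (kappa * d); first by rewrite mulr_gt0.
move=> w wd; split.
- have := sm _ wd; rewrite lt_min => /andP[_ h].
  have := H2 (sg 0 + kappa^-1 * (w - w0)); rewrite T0 subr0; apply.
  by rewrite addrAC subrr add0r.
- apply: (@continuous_comp _ _ _ (fun w => sg 0 + kappa^-1 * (w - w0)) (clock_inv sg)).
    have D := is_derive_add (is_derive_cst (sg 0) w 1) (is_derive_cmul kappa^-1
       (is_derive_sub (is_derive_id w 1) (is_derive_cst w0 w 1))).
    exact: is_derive_continuous D.
  by rewrite -(val _ wd); exact: clock_inv_continuous Hsg.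
- exists (kappa * d - `|w - w0|); first by rewrite subr_gt0.
  move=> v vw; apply: val; have := ler_distD w v w0; lra.
Qed.

Lemma T_derive (rho w : R) (G g : R -> R) :
  `|clock_time w| < rho -> {for w, continuous clock_time} -> (exists2 d' : R, 0 < d' &
    forall v : R, `|v - w| < d' -> sg (clock_time v) = sg 0 + kappa^-1 * (v - w0)) ->
  (forall t : R, `|t| < rho -> is_derive t 1 G (seg alpha (x t) 0 m.+1 ^+ 2 * g t)) ->
  {for clock_time w, continuous g} ->
  is_derive w 1 (fun w => G (clock_time w)) (kappa^-1 * g (clock_time w)).
Proof.
move=> Tr cT vT dG cg.
apply: (@is_derive_clock_near _ sg _ G g clock_time (fun v => sg 0 + kappa^-1 * (v - w0)) w _ (Hclk (ltn_ord m))) => //.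
  exists (rho - `|clock_time w|); first by rewrite subr_gt0.
  move=> t tw; apply: dG; have := ler_distD (clock_time w) t 0; rewrite !subr0; lra.
apply: (is_derive_ext (is_derive_add (is_derive_cst (sg 0) w 1) (is_derive_cmul kappa^-1
       (is_derive_sub (is_derive_id w 1) (is_derive_cst w0 w 1))))) => //.
by rewrite subr0 mulr1 add0r.
Qed.

Lemma seg_sqrS t : seg alpha (x t) 0 m.+1 ^+ 2 = seg alpha (x t) 0 m ^+ 2 * z t ^+ (2 * alpha m).
Proof. by rewrite segS // exprMn (mulnC 2%N) exprM. Qed.

Lemma continuous_zpow k t : {for t, continuous (fun s => z s ^+ k)}.
Proof.
apply: (@continuous_comp _ _ _ (fun s => z s) (fun y => y ^+ k)).
  exact: continuous_x H _ _.
exact: exprn_continuous.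
Qed.

(** Geodesic data at the time when [S'] equals [w]: the potential, its derivative in the position,
    the momentum and the position. *)
Let V w := z (clock_time w) ^+ (2 * alpha m).
Let V1 w := (2 * alpha m)%:R * z (clock_time w) ^+ (2 * alpha m).-1.
Let Q w := q (clock_time w).
Let X w := z (clock_time w).

(** Along the geodesic [dw = kappa dsg = kappa V dtm], so each derivative is the one in the clock
    [tm] divided by [kappa V]. *)
Lemma param_derive (rho w : R) :
  (forall t : R, `|t| < rho -> z t ^+ (2 * alpha m) != 0) ->
  `|clock_time w| < rho -> {for w, continuous clock_time} -> (exists2 d' : R, 0 < d' &
    forall v : R, `|v - w| < d' -> sg (clock_time v) = sg 0 + kappa^-1 * (v - w0)) ->
  [/\ is_derive w 1 (fun w => tm (clock_time w)) (kappa * V w)^-1,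
      is_derive w 1 X (Q w / (kappa * V w)) &
      is_derive w 1 Q (- (kappa * V1 w / (2 * V w)))].
Proof.
move=> zn0 Tr cT vT; have kn0 : kappa != 0 by rewrite gt_eqF // kappa_gt0.
have cV t : `|t| < rho -> {for t, continuous (fun s => (z s ^+ (2 * alpha m))^-1)}.
  by move=> /zn0 zt; apply: continuousV => //; exact: continuous_zpow.
have Vn0 := zn0 _ Tr.
split.
- have := @T_derive rho w tm (fun s => (z s ^+ (2 * alpha m))^-1) Tr cT vT.
  rewrite /V invfM; apply; last exact: cV.
  move=> t /zn0 zt; have [D _] := Hclk (ltnW (ltn_ord m)).
  by apply: (is_derive_ext (D t)) => //; rewrite seg_sqrS mulfK.
- have := @T_derive rho w (fun s => z s) (fun s => (z s ^+ (2 * alpha m))^-1 * q s) Tr cT vT.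
  rewrite (_ : Q w / (kappa * V w) = kappa^-1 * ((z (clock_time w) ^+ (2 * alpha m))^-1 * q (clock_time w))); last first.
    by rewrite /Q /V; field; rewrite kn0 Vn0.
  apply.
    move=> t /zn0 zt.
    by apply: (is_derive_ext (sol_x H (wid m) t)) => //; rewrite seg_sqrS mulrA mulfK.
  by apply: continuousM; [exact: cV|exact: continuous_p H _ _].
- have := @T_derive rho w (fun s => q s)
    (fun s => - (kappa ^+ 2 / 2) * ((z s ^+ (2 * alpha m))^-1 * ((2 * alpha m)%:R * z s ^+ (2 * alpha m).-1))) Tr cT vT.
  rewrite (_ : kappa^-1 * _ = - (kappa * V1 w / (2 * V w))); last first.
    by rewrite /V1 /V; field; rewrite kn0 Vn0.
  apply.
    move=> t /zn0 zt.
    apply: (is_derive_ext (sol_p H m t)) => //.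
    rewrite seg_sqrS kappa_sqr (energy_cst H t 0) //.
    by rewrite natrM; field.
  apply: (@continuousM _ _ (cst _)); first exact: cvg_cst.
  apply: continuousM; first exact: cV.
  apply: (@continuousM _ _ (cst _)); first exact: cvg_cst.
  exact: continuous_zpow.
Qed.


Variable K : R.
Let E := en m.
Let sE := Num.sqrt E.

(* The curve is parametrized by the value [w] of the subsolution [S'] of the next level; [corrected]
   is exact on it, and its last term makes the Hessian across the curve decrease at rate [K]. *)
Definition corrected (y : pt) : R := let w := S' y in
  sE^-1 * (E * (tm (clock_time w) - tm 0) + Q w * (y (wid m) - X w) - K / 2 * ((w - w0) * (y (wid m) - X w) ^+ 2)).

(** The factor of [G'] is the derivative in [w]: its constant term [(E - Q ^ 2) / (kappa V)] equals
    [kappa] by conservation of energy, and [mu] gathers what is linear in [h]. *)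
Definition corrected_grad (y : pt) : pt := let w := S' y in
  let h := y (wid m) - X w in let th := K * (w - w0) in
  let mu := - (kappa * V1 w / (2 * V w)) + th * Q w / (kappa * V w) in
  fun k => sE^-1 * ((Q w - th * h) * (k == wid m)%:R + (kappa + mu * h - K / 2 * h ^+ 2) * G' y k).

Lemma coord_energy' t : q t ^+ 2 + kappa ^+ 2 * z t ^+ (2 * alpha m) = E.
Proof.
rewrite kappa_sqr /E -(energy_cst H t 0 (ltnW (ltn_ord m))) energyS (energy_cst H t 0) //.
by rewrite mulrC.
Qed.

Lemma sE_gt0 : 0 < sE. Proof. by rewrite sqrtr_gt0 /E; apply: Epos; exact: ltnW. Qed.
Lemma sE_sqr : sE ^+ 2 = E. Proof. by rewrite sqr_sqrtr // ltW // /E; apply: Epos; exact: ltnW. Qed.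

Lemma diffat_corrected (rho : R) y :
  (forall t : R, `|t| < rho -> z t ^+ (2 * alpha m) != 0) ->
  `|clock_time (S' y)| < rho -> {for S' y, continuous clock_time} -> (exists2 d' : R, 0 < d' &
    forall v : R, `|v - S' y| < d' -> sg (clock_time v) = sg 0 + kappa^-1 * (v - w0)) ->
  diffat S' (G' y) y -> diffat corrected (corrected_grad y) y.
Proof.
move=> zn0 Tr cT vT DS; have [D1 D2 D3] := param_derive zn0 Tr cT vT.
have kn0 : kappa != 0 by rewrite gt_eqF // kappa_gt0.
have Vn0 : V (S' y) != 0 by exact: zn0.
have F1 := diffat_comp DS D1; have F2 := diffat_comp DS D2; have F3 := diffat_comp DS D3.
have Fh := diffat_add (diffat_coord (wid m) y) (diffat_scale (-1) F2).
have Fw := diffat_add DS (diffat_cst (- w0) y).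
have F4 := diffat_mul F3 Fh.
have F5 := diffat_mul Fw (diffat_mul Fh Fh).
have F6 := diffat_scale E (diffat_add F1 (diffat_cst (- tm 0) y)).
apply: (diffat_ext (diffat_scale sE^-1 (diffat_add (diffat_add F6 F4) (diffat_scale (- (K / 2)) F5)))).
  by move=> v; rewrite /corrected; congr (_ * _); rewrite -!/(X _) -/(Q _) ; ring.
move=> k; rewrite /corrected_grad; congr (_ * _).
have e := coord_energy' (clock_time (S' y)); rewrite -/(V (S' y)) -/(Q (S' y)) in e.
rewrite -e; move: Vn0; rewrite /=; move: (V (S' y)) (Q (S' y)) (X (S' y)) (V1 (S' y)) (S' y) (G' y k) (_ == _)%:R (y (wid m)) => v qq xx v1 w g b yy v0.
by field; rewrite kn0 v0.
Qed.

(** [G'] vanishes up to coordinate [m], so there is no cross term and the eikonal inequality of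
    level [m] reduces to one between the numbers [a] and [b]. *)
Lemma grad_bound y : (forall k : 'I_n.+1, (k < m.+1)%N -> G' y k = 0) ->
  \sum_(k < n.+1) seg alpha y 0 k ^+ 2 * G' y k ^+ 2 <= seg alpha y 0 m.+1 ^+ 2 ->
  forall a b : R, a ^+ 2 + y (wid m) ^+ (2 * alpha m) * b ^+ 2 <= E ->
  \sum_(k < n.+1) seg alpha y 0 k ^+ 2 * (sE^-1 * (a * (k == wid m)%:R + b * G' y k)) ^+ 2 <= seg alpha y 0 m ^+ 2.
Proof.
move=> G0 Gle a b ab.
have -> : \sum_(k < n.+1) seg alpha y 0 k ^+ 2 * (sE^-1 * (a * (k == wid m)%:R + b * G' y k)) ^+ 2 =
   E^-1 * (seg alpha y 0 m ^+ 2 * a ^+ 2 + b ^+ 2 * \sum_(k < n.+1) seg alpha y 0 k ^+ 2 * G' y k ^+ 2).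
  rewrite mulrDr !mulr_sumr (bigD1 (wid m)) //= eqxx.
  rewrite [in RHS](bigD1 (wid m)) //= G0 /= ?ltnSn //.
  rewrite expr0n !mulr0 add0r addr0 mulr1 exprMn exprVn sE_sqr mulrCA; congr (_ + _).
  apply: eq_bigr => k /negbTE ->; rewrite mulr0 add0r !exprMn exprVn sE_sqr; ring.
have E0 : 0 < E by apply: Epos; exact: ltnW.
rewrite ler_pdivrMl //.
apply: (@le_trans _ _ (seg alpha y 0 m ^+ 2 * a ^+ 2 + b ^+ 2 * seg alpha y 0 m.+1 ^+ 2)).
  by rewrite lerD2l ler_wpM2l // sqr_ge0.
rewrite segS // exprMn -exprM (mulnC (alpha m)).
have -> : seg alpha y 0 m ^+ 2 * a ^+ 2 + b ^+ 2 * (seg alpha y 0 m ^+ 2 * y (wid m) ^+ (2 * alpha m)) =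
  seg alpha y 0 m ^+ 2 * (a ^+ 2 + y (wid m) ^+ (2 * alpha m) * b ^+ 2) by ring.
by rewrite mulrC ler_wpM2r // sqr_ge0.
Qed.

End Step.

Lemma calibrate_step (m : 'I_n) : (exists S G r e, calibrates m.+1 S G r e) ->
  exists S G r e, calibrates m S G r e.
Proof.
move=> [S' [G' [r' [e' C']]]]; have [r'0 e'0 HS' Hx'] := C'.
pose a2 := (2 * alpha m)%N.
pose z t := x t (wid m); pose q t := p t (wid m).
pose B := `|z 0| + 1.
have B0 : 0 <= B by rewrite addr_ge0.
have [C C0 HC] := pow_taylor a2 B0.
(* A common bound for the Taylor constant, the derivative of the potential and the momentum near the
   base point. *)
pose M := C + (a2%:R * B ^+ a2.-1) + (`|q 0| + 1).
have M1 : 0 <= a2%:R * B ^+ a2.-1 by rewrite mulr_ge0 // exprn_ge0.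
have M2 : 0 <= `|q 0| + 1 by rewrite addr_ge0.
have M0 : 0 <= M by rewrite !addr_ge0.
have z0a : 0 < z 0 ^+ a2.
  rewrite /a2 mulnC exprM lt_def sqrf_eq0 sqr_ge0 andbT; exact: Riem.
(* A lower bound for the potential near the base point, positive by [Riem]. *)
pose v0 := z 0 ^+ a2 / 2.
have v00 : 0 < v0 by rewrite divr_gt0.
pose kappa := Num.sqrt (en m.+1).
have k0 : 0 < kappa by rewrite sqrtr_gt0; exact: Epos.
pose Nm := kappa * M / (2 * v0) + M / (kappa * v0).
(* The threshold in the last hypothesis of [eikonal_ineq]; [K] is chosen to pass it, and only then
   the radius [eta]. *)
pose K0 := Nm ^+ 2 + Nm + 1 + 2 / v0 * (1 + 4 * kappa * Nm * M + kappa ^+ 2 * M).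
pose K := `|K0| / kappa.
have Kk : K0 <= kappa * K by rewrite /K mulrC divfK ?gt_eqF // ler_norm.
have Kge0 : 0 <= K by rewrite divr_ge0 // ltW.
have [eta [eta0 eta1 etaK etaM]] : exists eta : R, [/\ 0 < eta, eta <= 1, K * eta <= 1 & (M + M) * eta <= v0 / 2].
  pose L := 1 + K + (M + M) / (v0 / 2).
  have h0 : 0 <= (M + M) / (v0 / 2) by rewrite divr_ge0 ?addr_ge0 // divr_ge0 // ltW.
  have L0 : 0 < L by rewrite /L; lra.
  exists L^-1; split; first by rewrite invr_gt0.
  - by rewrite invf_le1 // /L; lra.
  - by rewrite ler_pdivrMr // /L; lra.
  - by rewrite ler_pdivrMr // mulrC -ler_pdivrMr ?divr_gt0 // /L; lra.
have [rho [rho0 rz rq rv]] : exists rho : R, [/\ 0 < rho, forall t : R, `|t| < rho -> `|z t - z 0| < eta / 2,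
    forall t : R, `|t| < rho -> `|q t - q 0| < 1 & forall t : R, `|t| < rho -> `|z t ^+ a2 - z 0 ^+ a2| < v0].
  have e2 : 0 < eta / 2 by rewrite divr_gt0.
  have /continuous_epsP/(_ _ e2)[d1 d10 h1] := @continuous_x _ _ _ _ _ H (wid m) 0.
  have /continuous_epsP/(_ _ ltr01)[d2 d20 h2] := @continuous_p _ _ _ _ _ H (wid m) 0.
  have /continuous_epsP/(_ _ v00)[d3 d30 h3] := @continuous_zpow m a2 0.
  exists (Num.min d1 (Num.min d2 d3)); split; first by rewrite !lt_min d10 d20.
  - by move=> t; rewrite !lt_min => /and3P[h _ _]; apply: h1; rewrite subr0.
  - by move=> t; rewrite !lt_min => /and3P[_ h _]; apply: h2; rewrite subr0.
  - by move=> t; rewrite !lt_min => /and3P[_ _ h]; apply: h3; rewrite subr0.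
have zv t : `|t| < rho -> v0 <= z t ^+ a2.
  by move=> /rv; rewrite ltr_norml {1}/v0 => /andP[+ _]; clear; rewrite /v0; lra.
have zn0 t : `|t| < rho -> z t ^+ a2 != 0 by move=> /zv h; rewrite gt_eqF // (lt_le_trans v00 h).
have [d d0 HT] := T_near m S' rho0.
have xx0 : l1 (x 0) (x 0) < r' by rewrite l1xx.
have [DS0 _ _] := HS' _ xx0.
(* This closeness of [S' y] to its base value keeps [th] at most 1 in absolute value. *)
have K10 : 0 < (1 + K)^-1 by rewrite invr_gt0; lra.
have dK : 0 < Num.min d (1 + K)^-1 by rewrite lt_min d0.
have [rw rw0 Hrw] := diffat_continuous DS0 dK.
exists (corrected m S' K), (corrected_grad m S' G' K), (Num.min r' (Num.min rw (eta / 2))), e'.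
split => //; first by rewrite !lt_min r'0 rw0 divr_gt0.
- move=> y; rewrite !lt_min => /and3P[yr' yrw yeta].
  have [DSy Gy0 Gyle] := HS' _ yr'.
  have := Hrw _ yrw; rewrite lt_min => /andP[wd wK].
  have [Tr cT vT] := HT _ wd.
  split; first exact: diffat_corrected zn0 Tr cT vT DSy.
    move=> k km; rewrite /corrected_grad Gy0 ?mulr0 ?addr0; last exact: ltnW.
    by rewrite -val_eqE /= ltn_eqF // !mulr0.
  apply: grad_bound => //.
  rewrite -(coord_energy' m (clock_time m S' (S' y))).
  set t := clock_time m S' (S' y) in Tr *.
  pose h := y (wid m) - z t.
  have ht : `|h| <= eta.
    have h1 := rz _ Tr; have h2 := le_lt_trans (l1_coord y (x 0) (wid m)) yeta.
    have := ler_distD (z 0) (y (wid m)) (z t); rewrite -/h (distrC (z 0)) => h3.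
    by clear -h1 h2 h3; rewrite /z in h1 h3 *; lra.
  have zB : `|z t| <= B.
    have h1 := rz _ Tr; have := ler_normD (z t - z 0) (z 0); rewrite subrK /B => h2.
    by clear -h1 h2 eta1 eta0; lra.
  have yB : `|y (wid m)| <= B.
    have h2 := le_lt_trans (l1_coord y (x 0) (wid m)) yeta.
    have := ler_normD (y (wid m) - z 0) (z 0); rewrite subrK /B => h3.
    by clear -h2 h3 eta1 eta0; rewrite /z in h3 *; lra.
  apply: (@eikonal_ineq _ kappa v0 M K (z t ^+ a2) (a2%:R * z t ^+ a2.-1) C (q t)
    (K * (S' y - S' (x 0))) h (y (wid m) ^+ a2)) => //.
  + exact: zv.
  + rewrite normrM normr_nat normrX.
    apply: (@le_trans _ _ (a2%:R * B ^+ a2.-1)); first by rewrite ler_wpM2l // lerXn2r // nnegrE.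
    by rewrite /M; clear -C0 M2; lra.
  + have h1 := rq _ Tr; have := ler_normD (q t - q 0) (q 0); rewrite subrK => h2.
    by rewrite /M; clear -h1 h2 C0 M1; lra.
  + by rewrite C0 /M; clear -M1 M2; lra.
  + rewrite normrM (ger0_norm Kge0).
    apply: (@le_trans _ _ (K * (1 + K)^-1)); first by rewrite ler_wpM2l // ltW.
    by rewrite ler_pdivrMr ?mul1r; lra.
  + by apply: le_trans etaK; rewrite ler_wpM2l.
  + exact: le_trans ht eta1.
  + by apply: le_trans etaM; rewrite ler_wpM2l // addr_ge0.
  + apply/andP; split; first by rewrite /a2 mulnC exprM sqr_ge0.
    have := HC _ _ zB yB; rewrite -/h => h1.
    have h2 := ler_norm (y (wid m) ^+ a2 - z t ^+ a2 - a2%:R * z t ^+ a2.-1 * h).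
    by clear -h1 h2; lra.
(* On the geodesic [h = 0]: only the clock term survives, with the factor [E / sqrt E]. *)
- move=> t te; rewrite /corrected (T_x C' te).
  have := T_x C' (_ : `|0 : R| < e'); rewrite normr0 => /(_ e'0) ->.
  have ss := sE_sqr m; have s0 := sE_gt0 m.
  move: (Num.sqrt (en m)) ss s0 => s <- s0; by field; rewrite gt_eqF.
Qed.

Lemma calibrate0 : exists S G r e, calibrates 0 S G r e.
Proof.
suff C k : (k <= n)%N -> exists S G r e, calibrates (n - k) S G r e by rewrite -(subnn n); exact: C.
elim: k => [_|k IH kn]; first by rewrite subn0; exact: calibrate_last.
have nk : (n - k.+1 < n)%N by rewrite ltn_subrL (leq_ltn_trans _ kn).
apply: (calibrate_step (m := Ordinal nk)) => /=.
by rewrite -subSn // subSS; exact: IH (ltnW kn).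
Qed.

End Calibration.

(** * Lower bounds for the distance *)

Section LowerBound.
Variables (R : realType) (n : nat) (alpha : 'I_n -> nat).
Notation pt := ('I_n.+1 -> R).
Notation mu := (@lebesgue_measure R).

(** Gradients stay existential here: of the functions built from [xi], only the continuity is
    used. *)
Lemma diffat_prod (I : Type) (s : seq I) (P : pred I) (f : I -> pt -> R) (y : pt) :
  (forall i, exists G, diffat (f i) G y) ->
  exists G, diffat (fun z => \prod_(i <- s | P i) f i z) G y.
Proof.
move=> Hf; elim: s => [|i s [G IH]].
  by exists (fun=> 0); apply: (diffat_ext (diffat_cst 1 y)) => z //; rewrite big_nil.
have [Gi Hi] := Hf i.
case Pi : (P i); last by exists G; apply: (diffat_ext IH) => z //; rewrite big_cons Pi.
exists (fun k => (\prod_(i <- s | P i) f i y) * Gi k + f i y * G k).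
by apply: (diffat_ext (diffat_mul Hi IH)) => z //; rewrite big_cons Pi.
Qed.

Lemma diffat_sum (I : Type) (s : seq I) (P : pred I) (f : I -> pt -> R) (y : pt) :
  (forall i, exists G, diffat (f i) G y) ->
  exists G, diffat (fun z => \sum_(i <- s | P i) f i z) G y.
Proof.
move=> Hf; elim: s => [|i s [G IH]].
  by exists (fun=> 0); apply: (diffat_ext (diffat_cst 0 y)) => z //; rewrite big_nil.
have [Gi Hi] := Hf i.
case Pi : (P i); last by exists G; apply: (diffat_ext IH) => z //; rewrite big_cons Pi.
exists (fun k => Gi k + G k).
by apply: (diffat_ext (diffat_add Hi IH)) => z //; rewrite big_cons Pi.
Qed.

Lemma diffat_pow S G (y : pt) k : diffat S G y -> exists G', diffat (fun z => S z ^+ k) G' y.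
Proof.
move=> D; eexists; apply: (diffat_comp D (f := fun s => s ^+ k)).
exact: is_derive_pow (is_derive_id (S y) 1).
Qed.

Lemma diffat_xi (j : 'I_n.+1) (y : pt) : exists G, diffat (fun z => xi alpha z j) G y.
Proof. by apply: diffat_prod => i; apply: diffat_pow (diffat_coord _ _). Qed.

Lemma diffat_slope (g y : pt) : exists G, diffat (fun z => \sum_(k < n.+1) xi alpha z k ^+ 2 * g k ^+ 2) G y.
Proof.
apply: diffat_sum => k; have [G D] := diffat_xi k y; have [G2 D2] := diffat_pow 2 D.
exists (fun i => g k ^+ 2 * G2 i); apply: (diffat_ext (diffat_scale (g k ^+ 2) D2)) => // z.
exact: mulrC.
Qed.

Lemma diffat_xi_sum (y : pt) : exists G, diffat (fun z => \sum_(k < n.+1) xi alpha z k ^+ 2) G y.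
Proof. by apply: diffat_sum => k; have [G D] := diffat_xi k y; exact: diffat_pow D. Qed.

Lemma coord_le_unorm (v : pt) k : `|v k| <= unorm v.
Proof.
rewrite /unorm -sqrtr_sqr ler_wsqrtr // (bigD1 k) //= lerDl.
by apply: sumr_ge0 => i _; exact: sqr_ge0.
Qed.

Lemma unorm_ge0 (v : pt) : 0 <= unorm v.
Proof. exact: sqrtr_ge0. Qed.

(* Young's inequality, in place of Cauchy-Schwarz: near the unit sphere it loses nothing. *)
Lemma young_unorm (w v : pt) : \sum_(k < n.+1) w k * v k <= (1 + \sum_(k < n.+1) w k ^+ 2) / 2 * unorm v.
Proof.
have [v0|v0] := eqVneq (unorm v) 0.
  rewrite v0 mulr0 big1 // => k _.
  have : v k = 0 by apply/eqP; rewrite -normr_le0 -v0 coord_le_unorm.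
  by move=> ->; rewrite mulr0.
have vp : 0 < unorm v by rewrite lt_def v0 unorm_ge0.
have v2 : unorm v ^+ 2 = \sum_(k < n.+1) v k ^+ 2.
  by rewrite sqr_sqrtr // sumr_ge0 // => k _; exact: sqr_ge0.
apply: (@le_trans _ _ (\sum_(k < n.+1) (v k ^+ 2 / unorm v + w k ^+ 2 * unorm v) / 2)).
  apply: ler_sum => k _; rewrite -subr_ge0.
  have -> : (v k ^+ 2 / unorm v + w k ^+ 2 * unorm v) / 2 - w k * v k =
    (v k - w k * unorm v) ^+ 2 / (2 * unorm v) by field.
  by rewrite divr_ge0 ?sqr_ge0 // mulr_ge0 // ltW.
rewrite -mulr_suml big_split /= -!mulr_suml -v2 le_eqVlt; apply/orP; left; apply/eqP.
by field.
Qed.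

Lemma Rintegral_sum (I : Type) (s : seq I) (f : I -> R -> R) (a b : R) :
  (forall i, mu.-integrable `[a, b] (EFin \o f i)) ->
  mu.-integrable `[a, b] (EFin \o (fun t => \sum_(i <- s) f i t)) /\
  \sum_(i <- s) Rintegral mu `[a, b] (f i) = Rintegral mu `[a, b] (fun t => \sum_(i <- s) f i t).
Proof.
move=> Hf; elim: s => [|i s [IH1 IH2]].
  have -> : (fun t : R => \sum_(i <- [::]) f i t) = cst 0 by apply/funext => t; rewrite big_nil.
  rewrite big_nil; split; first by apply: continuous_integrable => t _; exact: cvg_cst.
  by rewrite Rintegral_cst // mul0r.
have -> : (fun t : R => \sum_(i <- i :: s) f i t) = (fun t => f i t + \sum_(i <- s) f i t).
  by apply/funext => t; rewrite big_cons.
split; last by rewrite big_cons IH2 RintegralD.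
have -> : EFin \o (fun t => f i t + \sum_(i <- s) f i t) =
   ((EFin \o f i) \+ (EFin \o (fun t => (\sum_(i <- s) f i t)%R)))%E by [].
exact: integrableD.
Qed.

Lemma norm_le_1sqr (v : R) : `|v| <= 1 + v ^+ 2.
Proof.
have := sqr_ge0 (`|v| - 1); rewrite -[v ^+ 2]real_normK ?num_real //.
by move: (normr_ge0 v); nra.
Qed.

Section Curve.
Variables (g u : R -> pt).
Hypothesis Hg : admissible alpha g u.
Let f k t := u t k * xi alpha (g t) k.
Let F t := \sum_(k < n.+1) `|f k t|.
Let len s t := Rintegral mu `[s, t] (fun t => unorm (u t)).

Lemma sub_integrable (h : R -> R) s t : 0 <= s -> t <= 1 -> mu.-integrable `[0, 1] (EFin \o h) ->
  mu.-integrable `[s, t] (EFin \o h).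
Proof. by move=> s0 t1 ih; apply: integrableS ih => //; apply: subset_itv; rewrite bnd_simp. Qed.

Lemma int_len s t : 0 <= s -> t <= 1 -> mu.-integrable `[s, t] (EFin \o (fun t => unorm (u t))).
Proof. by move=> s0 t1; apply: sub_integrable => //; have [_ []] := Hg. Qed.

Lemma int_f k s t : 0 <= s -> t <= 1 -> mu.-integrable `[s, t] (EFin \o f k).
Proof. by move=> s0 t1; apply: sub_integrable => //; have [_ [_ [h _]]] := Hg; exact: h. Qed.

Lemma int_absf k s t : 0 <= s -> t <= 1 -> mu.-integrable `[s, t] (EFin \o (fun t => `|f k t|)).
Proof. by move=> s0 t1; exact: integrable_norm (int_f k s0 t1). Qed.

Lemma int_F s t : 0 <= s -> t <= 1 -> mu.-integrable `[s, t] (EFin \o F).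
Proof. by move=> s0 t1; have [] := Rintegral_sum (index_enum 'I_n.+1) (fun k => int_absf k s0 t1). Qed.

Lemma curve_incr k s t : 0 <= s -> s <= t -> t <= 1 -> g t k - g s k = Rintegral mu `[s, t] (f k).
Proof.
move=> s0 st t1; have [_ [_ [_ h]]] := Hg.
rewrite (h k t) ?t1 ?(le_trans s0 st) // (h k s) ?s0 ?(le_trans st t1) //.
rewrite (@Rintegral_split _ (f k) 0 s t) ?s0 ?st //; last exact: int_f.
by rewrite /f; ring.
Qed.

Lemma l1_incr s t : 0 <= s -> s <= t -> t <= 1 -> l1 (g t) (g s) <= Rintegral mu `[s, t] F.
Proof.
move=> s0 st t1; have [_ <-] := Rintegral_sum (index_enum 'I_n.+1) (fun k => int_absf k s0 t1).
apply: ler_sum => k _; rewrite curve_incr //; apply: le_normr_Rintegral => //; exact: int_f.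
Qed.

Lemma len_split s t : 0 <= s -> s <= t -> t <= 1 -> len 0 t = len 0 s + len s t.
Proof. by move=> s0 st t1; apply: Rintegral_split; rewrite ?s0 ?st //; exact: int_len. Qed.

Lemma len_ge0 s t : 0 <= len s t.
Proof. by apply: Rintegral_ge0 => r _; exact: unorm_ge0. Qed.

Lemma l1_sym (y z : pt) : l1 y z = l1 z y.
Proof. by apply: eq_bigr => k _; exact: distrC. Qed.

Lemma curve_continuous t e : 0 <= t <= 1 -> 0 < e -> exists2 d : R, 0 < d &
  forall s, 0 <= s <= 1 -> `|s - t| < d -> l1 (g s) (g t) < e.
Proof.
move=> t01 e0; have F01 := int_F (lexx 0) (lexx 1).
have /subspace_continuousP := parameterized_integral_continuous (@ler01 R) F01.
move=> /(_ t); rewrite /= in_itv /= => /(_ t01) /cvgrPdist_lt /(_ _ e0).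
rewrite /within /= => /nbhs_ballP[d /= d0 Hd].
exists d => // s s01 st.
have h : `|Rintegral mu `[0, t] F - Rintegral mu `[0, s] F| < e.
  by have := Hd s; rewrite /ball /= distrC in_itv /= => /(_ st s01).
have [ts|ts] := leP t s.
  apply: le_lt_trans (l1_incr _ ts _) _; [by case/andP: t01|by case/andP: s01|].
  move: h; rewrite (@Rintegral_split _ F 0 t s); last by apply: int_F => //; case/andP: s01.
    by rewrite opprD addrA subrr sub0r normrN; apply: le_lt_trans; exact: ler_norm.
  by case/andP: t01 => -> _; rewrite ts.
rewrite l1_sym; apply: le_lt_trans (l1_incr _ (ltW ts) _) _; [by case/andP: s01|by case/andP: t01|].
move: h; rewrite (@Rintegral_split _ F 0 s t); last by apply: int_F => //; case/andP: t01.
  by rewrite addrAC subrr add0r; apply: le_lt_trans; exact: ler_norm.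
by case/andP: s01 => -> _; rewrite ltW.
Qed.

(** [S] is only differentiable and the controls only integrable, so [S] along the curve is not
    recovered from a derivative. Near each time [S] is linearized with its gradient frozen at [g t],
    where continuity of [xi] controls the slope; the errors cost a factor [1 + eta], and real
    induction carries the bound from 0 to 1. *)
Lemma curve_calibrated (S : pt -> R) (G : pt -> pt) :
  (forall t, 0 <= t <= 1 -> diffat S (G (g t)) (g t)) ->
  (forall t, 0 <= t <= 1 -> \sum_(k < n.+1) xi alpha (g t) k ^+ 2 * G (g t) k ^+ 2 <= 1) ->
  S (g 1) - S (g 0) <= len 0 1.
Proof.
move=> DS SG.
suff main eta : 0 < eta -> eta <= 1 -> S (g 1) - S (g 0) <= (1 + eta) * len 0 1.
  apply/ler_addgt0Pr => e e0.
  have l0 := len_ge0 0 1.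
  pose eta := Num.min 1 (e / (len 0 1 + 1)).
  have eta0 : 0 < eta by rewrite lt_min ltr01 divr_gt0 // ltr_wpDl.
  have eta1 : eta <= 1 by rewrite ge_min lexx.
  apply: le_trans (main _ eta0 eta1) _; rewrite mulrDl mul1r lerD2l.
  have : eta * (len 0 1 + 1) <= e by rewrite -ler_pdivlMr ?ltr_wpDl // ge_min lexx orbT.
  by apply: le_trans; rewrite ler_wpM2l ?(ltW eta0) // lerDl.
move=> eta0 eta1.
apply: (@real_induction _ (fun t => S (g t) - S (g 0) <= (1 + eta) * len 0 t) 0 1); last by rewrite ler01 lexx.
- by rewrite subrr mulr_ge0 ?len_ge0 // addr_ge0 // ltW.
- move=> t /andP[t0 t1] IH.
  have {}IH := IH t; rewrite t0 lexx in IH; have {}IH := IH isT.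
  have t01 : 0 <= t <= 1 by rewrite t0 ltW.
  have [Gx Dx] := diffat_xi_sum (g t).
  have [Gs Ds] := diffat_slope (G (g t)) (g t).
  pose N := \sum_(k < n.+1) xi alpha (g t) k ^+ 2 + 1.
  have N0 : 0 < N by rewrite ltr_wpDl // sumr_ge0 // => k _; exact: sqr_ge0.
  (* Near [t] the [l1] speed [F] is at most [N1 * unorm u], so a linearization error of
     [eta / 2 / N1] per unit of [l1] costs [eta / 2] per unit of length. *)
  pose N1 := (n.+1%:R * (1 + N)).
  have N10 : 0 < N1 by rewrite mulr_gt0 ?ltr0n // addr_gt0.
  have e0 : 0 < eta / 2 / N1 by rewrite !divr_gt0.
  have [d1 d10 H1] := diffat_continuous Dx ltr01.
  have [d2 d20 H2] := diffat_continuous Ds eta0.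
  have [d3 d30 H3] := DS _ t01 _ e0.
  have d0 : 0 < Num.min d1 (Num.min d2 d3) by rewrite !lt_min d10 d20.
  have [d dd0 Hd] := curve_continuous t01 d0.
  exists d => // s /andP[ts std] s1.
  have near r : t <= r <= s -> l1 (g r) (g t) < Num.min d1 (Num.min d2 d3).
    move=> /andP[tr rs]; apply: Hd; first by rewrite (le_trans t0 tr) (le_trans rs s1).
    by rewrite ger0_norm ?subr_ge0 //; lra.
  rewrite (@len_split t s) ?(ltW ts) // mulrDr.
  suff : S (g s) - S (g t) <= (1 + eta) * len t s by lra.
  have st : t <= s by exact: ltW.
  have := H3 (g s).
  have := near s; rewrite st lexx => /(_ isT); rewrite !lt_min => /and3P[_ _ ->] /(_ isT) h.
  have {}h : S (g s) - S (g t) <= lin (G (g t)) (g s) (g t) + eta / 2 / N1 * l1 (g s) (g t).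
    by have := ler_norm (S (g s) - S (g t) - lin (G (g t)) (g s) (g t)); lra.
  apply: (le_trans h).
  have linE : lin (G (g t)) (g s) (g t) = Rintegral mu `[t, s] (fun r => \sum_(k < n.+1) G (g t) k * f k r).
    have iG k : mu.-integrable `[t, s] (EFin \o (fun r => G (g t) k * f k r)).
      have := @integrableZl _ _ _ mu _ (measurable_itv `[t, s]) (G (g t) k) (EFin \o f k) (int_f k t0 s1).
      by [].
    have [_ <-] := Rintegral_sum (index_enum 'I_n.+1) iG.
    by apply: eq_bigr => k _; rewrite RintegralZl ?curve_incr //; exact: int_f.
  have iGf : mu.-integrable `[t, s] (EFin \o (fun r => \sum_(k < n.+1) G (g t) k * f k r)).
    have iG k : mu.-integrable `[t, s] (EFin \o (fun r => G (g t) k * f k r)).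
      have := @integrableZl _ _ _ mu _ (measurable_itv `[t, s]) (G (g t) k) (EFin \o f k) (int_f k t0 s1).
      by [].
    by have [] := Rintegral_sum (index_enum 'I_n.+1) iG.
  have iF := int_F t0 s1.
  pose c := eta / 2 / N1.
  have icF : mu.-integrable `[t, s] (EFin \o (fun r => c * F r)).
    exact: (@integrableZl _ _ _ mu _ (measurable_itv `[t, s]) c (EFin \o F) iF).
  have iu := int_len t0 s1.
  have icu : mu.-integrable `[t, s] (EFin \o (fun r => (1 + eta) * unorm (u r))).
    exact: (@integrableZl _ _ _ mu _ (measurable_itv `[t, s]) (1 + eta) (EFin \o (fun r => unorm (u r))) iu).
  apply: (@le_trans _ _ (Rintegral mu `[t, s] (fun r => \sum_(k < n.+1) G (g t) k * f k r + c * F r))).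
    rewrite RintegralD // -linE lerD2l RintegralZl // ler_wpM2l ?(ltW e0) //; exact: l1_incr.
  rewrite /len -RintegralZl //; apply: le_Rintegral => //.
    have -> : EFin \o (fun r => \sum_(k < n.+1) G (g t) k * f k r + c * F r) =
      ((EFin \o (fun r => (\sum_(k < n.+1) G (g t) k * f k r)%R)) \+ (EFin \o (fun r => (c * F r)%R)))%E by [].
    exact: integrableD.
  move=> r; rewrite /= in_itv /= => /near; rewrite !lt_min => /and3P[r1 r2 _].
  have u0 := unorm_ge0 (u r).
  have p1 : \sum_(k < n.+1) G (g t) k * f k r <= (1 + eta / 2) * unorm (u r).
    have -> : \sum_(k < n.+1) G (g t) k * f k r = \sum_(k < n.+1) (xi alpha (g r) k * G (g t) k) * u r k.
      by apply: eq_bigr => k _; rewrite /f; ring.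
    apply: le_trans (young_unorm _ _) _; rewrite ler_wpM2r //.
    have -> : \sum_(k < n.+1) (xi alpha (g r) k * G (g t) k) ^+ 2 = \sum_(k < n.+1) xi alpha (g r) k ^+ 2 * G (g t) k ^+ 2.
      by apply: eq_bigr => k _; rewrite exprMn.
    have := H2 _ r2; rewrite ltr_norml => /andP[_ h2]; have h3 := SG _ t01.
    by lra.
  have p2 : c * F r <= eta / 2 * unorm (u r).
    have : F r <= N1 * unorm (u r).
      have -> : N1 * unorm (u r) = \sum_(k < n.+1) ((1 + N) * unorm (u r)).
        by rewrite sumr_const card_ord -[RHS]mulr_natl /N1 mulrA.
      apply: ler_sum => k _; rewrite /f normrM mulrC; apply: ler_pM => //; last exact: coord_le_unorm.
      have h4 : `|xi alpha (g r) k| <= 1 + xi alpha (g r) k ^+ 2.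
        exact: norm_le_1sqr.
      have h5 : xi alpha (g r) k ^+ 2 <= \sum_(k < n.+1) xi alpha (g r) k ^+ 2.
        by rewrite (bigD1 k) //= lerDl sumr_ge0 // => i _; exact: sqr_ge0.
      have := H1 _ r1; rewrite ltr_norml => /andP[_ h6].
      by rewrite /N; lra.
    move=> hF; apply: (@le_trans _ _ (c * (N1 * unorm (u r)))); first by rewrite ler_wpM2l // ltW.
    by rewrite /c mulrA divfK // gt_eqF.
  by lra.
- move=> t /andP[t0 t1] IH; apply/ler_addgt0Pr => e e0.
  have t01 : 0 <= t <= 1 by rewrite (ltW t0).
  have [d d0 Hd] := diffat_continuous (DS _ t01) e0.
  have [d' d'0 Hd'] := curve_continuous t01 d0.
  pose s := Num.max 0 (t - d' / 2).
  have s0 : 0 <= s by rewrite le_max lexx.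
  have sl : t - d' / 2 <= s by rewrite le_max lexx orbT.
  have st : s < t by rewrite gt_max t0 /=; lra.
  have hs := IH s; rewrite s0 st in hs; have {}hs := hs isT.
  have : l1 (g s) (g t) < d.
    apply: Hd'; first by rewrite s0 (ltW (lt_le_trans st t1)).
    by rewrite ltr0_norm ?subr_lt0 //; lra.
  move=> /Hd; rewrite ltr_norml => /andP[h _].
  have := len_split s0 (ltW st) t1; have := len_ge0 s t => l0 le.
  have : (1 + eta) * len 0 s <= (1 + eta) * len 0 t.
    by rewrite ler_wpM2l ?addr_ge0 ?(ltW eta0) // le lerDl.
  by lra.
Qed.

(** Inside the ball each coordinate moves at most [C] per unit of length, so the curve is too short
    to cover the remaining [r / 2]. *)
Lemma curve_stays (x0 : pt) (r C : R) : 0 < r -> 0 <= C ->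
  (forall y, l1 y x0 <= r -> forall k, `|xi alpha y k| <= C) ->
  l1 (g 0) x0 < r / 2 -> n.+1%:R * C * len 0 1 < r / 2 ->
  forall t, 0 <= t <= 1 -> l1 (g t) x0 < r.
Proof.
move=> r0 C0 HC h0 hl; apply: real_induction.
- by apply: lt_trans h0 _; rewrite ltr_pdivrMr // ltr_pMr // ltr1n.
- move=> t /andP[t0 t1] IH.
  have t01 : 0 <= t <= 1 by rewrite t0 ltW.
  have {}IH : l1 (g t) x0 < r by apply: IH; rewrite t0 lexx.
  have e0 : 0 < r - l1 (g t) x0 by rewrite subr_gt0.
  have [d d0 Hd] := curve_continuous t01 e0.
  exists d => // s /andP[ts std] s1.
  have := Hd s; rewrite s1 (le_trans t0 (ltW ts)) => /(_ isT).
  rewrite gtr0_norm ?subr_gt0 // ltrBlDl => /(_ std) h.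
  by apply: le_lt_trans (l1_tri _ (g t) _) _; rewrite -ltrBrDr.
- move=> t /andP[t0 t1] IH.
  have t01 : 0 <= t <= 1 by rewrite (ltW t0).
  have cl : l1 (g t) x0 <= r.
    apply/ler_addgt0Pr => e e0.
    have [d d0 Hd] := curve_continuous t01 e0.
    pose s := Num.max 0 (t - d / 2).
    have s0 : 0 <= s by rewrite le_max lexx.
    have sl : t - d / 2 <= s by rewrite le_max lexx orbT.
    have st : s < t by rewrite gt_max t0 /=; lra.
    have hs : l1 (g s) x0 < r by apply: IH; rewrite s0.
    have : l1 (g s) (g t) < e.
      apply: Hd; first by rewrite s0 (ltW (lt_le_trans st t1)).
      by rewrite ltr0_norm ?subr_lt0 //; lra.
    rewrite l1_sym => h; apply: le_trans (l1_tri _ (g s) _) _.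
    by lra.
  have t0' := ltW t0.
  have iF := int_F (lexx 0) t1; have iu := int_len (lexx 0) t1.
  have icu : mu.-integrable `[0, t] (EFin \o (fun r => n.+1%:R * C * unorm (u r))).
    exact: (@integrableZl _ _ _ mu _ (measurable_itv `[0, t]) (n.+1%:R * C) (EFin \o (fun r => unorm (u r))) iu).
  have h1 : l1 (g t) (g 0) <= n.+1%:R * C * len 0 t.
    apply: le_trans (l1_incr (lexx 0) t0' t1) _.
    rewrite /len -RintegralZl //; apply: le_Rintegral => //.
    move=> s; rewrite /= in_itv /= => /andP[s0 st].
    have -> : n.+1%:R * C * unorm (u s) = \sum_(k < n.+1) (C * unorm (u s)).
      by rewrite sumr_const card_ord -[RHS]mulr_natl mulrA.
    apply: ler_sum => k _; rewrite /f normrM mulrC; apply: ler_pM => //; last exact: coord_le_unorm.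
    apply: HC; have [->//|ne] := eqVneq s t.
    by apply: ltW; apply: IH; rewrite s0 lt_neqAle ne.
  have h2 : n.+1%:R * C * len 0 t <= n.+1%:R * C * len 0 1.
    rewrite ler_wpM2l ?mulr_ge0 // (len_split t0' t1 (lexx 1)) lerDl; exact: len_ge0.
  by apply: le_lt_trans (l1_tri _ (g 0) _) _; lra.
Qed.

End Curve.

(** The factors [(|x0_i| + 1) ^ alpha_i] are at least 1, so their full product bounds every partial
    one. *)
Lemma xi_bound (x0 : pt) : exists2 C : R, 1 <= C & forall y, l1 y x0 <= 1 -> forall k, `|xi alpha y k| <= C.
Proof.
exists (\prod_(i < n) (`|x0 (wid i)| + 1) ^+ alpha i).
  by apply: (big_ind (fun v => 1 <= v)) => // [*|i _]; [exact: mulr_ege1|rewrite exprn_ege1 // lerDr].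
move=> y hy k; rewrite /xi normr_prod.
rewrite [X in _ <= X](bigID (fun i : 'I_n => (i < k)%N)) /=.
rewrite -[X in X <= _]mulr1; apply: ler_pM => //; first by apply: prodr_ge0.
  apply: ler_prod => i _; rewrite normr_ge0 /= normrX lerXn2r // ?nnegrE ?addr_ge0 //.
  have := ler_normD (y (wid i) - x0 (wid i)) (x0 (wid i)); rewrite subrK.
  have := le_trans (l1_coord y x0 (wid i)) hy => h1 h2; clear -h1 h2; lra.
by apply: (big_ind (fun v => 1 <= v)) => // [*|i _]; [exact: mulr_ege1|rewrite exprn_ege1 // lerDr].
Qed.

(** A competitor either has length at least [d], hence at least [L], or stays in the ball, where [S]
    bounds its length from below. *)
Lemma cc_dist_calibrated (x0 : pt) (S : pt -> R) (G : pt -> pt) (r : R) : 0 < r ->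
  (forall y, l1 y x0 < r -> diffat S (G y) y /\ \sum_(k < n.+1) xi alpha y k ^+ 2 * G y k ^+ 2 <= 1) ->
  exists2 d : R, 0 < d & forall y z L, l1 y x0 < d -> L <= d -> L <= S z - S y ->
    (L%:E <= cc_dist alpha y z)%E.
Proof.
move=> r0 HS; have [C C1 HC] := xi_bound x0.
pose r1 := Num.min r 1.
have r10 : 0 < r1 by rewrite lt_min r0 ltr01.
have C0 : 0 <= C by apply: le_trans C1.
have N0 : 1 <= n.+1%:R * C by rewrite mulr_ege1 // ler1n.
exists (r1 / 2 / (n.+1%:R * C)); first by rewrite !divr_gt0 // (lt_le_trans ltr01 N0).
move=> y z L yd Ld LS.
apply: le_ereal_inf_tmp => _ [u [g [Hg [gy gz]]] <-]; rewrite lee_fin.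
have N00 : 0 < n.+1%:R * C := lt_le_trans ltr01 N0.
have [h|h] := ltP (n.+1%:R * C * Rintegral mu `[0, 1] (fun t => unorm (u t))) (r1 / 2); last first.
  by apply: le_trans Ld _; rewrite ler_pdivrMr // [X in _ <= X]mulrC.
have stay : forall t, 0 <= t <= 1 -> l1 (g t) x0 < r1.
  apply: (@curve_stays _ _ Hg x0 r1 C) => //.
    by move=> w hw; apply: HC; apply: le_trans hw _; rewrite ge_min lexx orbT.
  rewrite gy; apply: lt_le_trans yd _; rewrite ler_pdivrMr // ler_peMr // ltW //.
  by rewrite divr_gt0.
have stay' t : 0 <= t <= 1 -> l1 (g t) x0 < r.
  by move=> /stay h1; apply: lt_le_trans h1 _; rewrite ge_min lexx.
apply: le_trans LS _; rewrite -gz -gy.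
by apply: (@curve_calibrated _ _ Hg S G) => t /stay' /HS[].
Qed.

End LowerBound.

(** * Shorter curves past half a period *)

Section Symmetries.
Variables (R : realType) (n : nat) (alpha : 'I_n -> nat).
Notation pt := ('I_n.+1 -> R).
Implicit Types (x p : R -> pt).

Lemma is_derive_shift_comp (f : R -> R) (a t df : R) : is_derive (t + a) 1 f df ->
  is_derive t 1 (fun s => f (s + a)) df.
Proof.
move=> D; have D2 := is_derive_add (is_derive_id t 1) (is_derive_cst a t 1).
have D3 : is_derive t 1 (f \o (fun s => s + a)) (df * (1 + 0)) by apply: is_derive1_comp.
by apply: (is_derive_ext D3) => //; rewrite addr0 mulr1.
Qed.

Lemma is_derive_flip_comp (f : R -> R) (c t df : R) : is_derive (c - t) 1 f df ->
  is_derive t 1 (fun s => f (c - s)) (- df).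
Proof.
move=> D; have D2 := is_derive_sub (is_derive_cst c t 1) (is_derive_id t 1).
have D3 : is_derive t 1 (f \o (fun s => c - s)) (df * (0 - 1)) by apply: is_derive1_comp.
by apply: (is_derive_ext D3) => //; rewrite sub0r mulrN1.
Qed.

Lemma solution_shift x p a : hamilton_solution alpha x p ->
  hamilton_solution alpha (fun t => x (t + a)) (fun t => p (t + a)).
Proof. by move=> H t j; have [h1 h2] := H (t + a) j; split; exact: is_derive_shift_comp. Qed.

Lemma dHdxN (x p : pt) j : dHdx alpha x (fun k => - p k) j = dHdx alpha x p j.
Proof.
rewrite /dHdx; congr derive1; apply/funext => s; rewrite /Ham; congr (_ * _).
by apply: eq_bigr => k _; rewrite sqrrN.
Qed.

Lemma energyN (x p : pt) k : energy alpha x (fun k => - p k) k = energy alpha x p k.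
Proof. by apply: eq_bigr => j _; rewrite mulrN sqrrN. Qed.

Lemma solution_flip x p c : hamilton_solution alpha x p ->
  hamilton_solution alpha (fun t => x (c - t)) (fun t k => - p (c - t) k).
Proof.
move=> H t j; have [h1 h2] := H (c - t) j; split.
  by rewrite mulrN; exact: is_derive_flip_comp.
rewrite dHdxN; have := is_derive_opp (is_derive_flip_comp h2).
by rewrite opprK.
Qed.

Lemma clock_shift S dS (a : R) : is_clock S dS -> is_clock (fun t => S (t + a)) (fun t => dS (t + a)).
Proof.
move=> [h1 [h2 h3]]; split; last split => //.
  by move=> t; exact: is_derive_shift_comp.
move=> t; have [d d0 Hd] := h3 (t + a); exists d => // r rt; apply: Hd.
by rewrite (_ : r + a - (t + a) = r - t) //; ring.
Qed.

Lemma clock_flip S dS (c : R) : is_clock S dS -> is_clock (fun t => - S (c - t)) (fun t => dS (c - t)).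
Proof.
move=> [h1 [h2 h3]]; split; last split => //.
  by move=> t; have := is_derive_opp (is_derive_flip_comp (h1 (c - t))); rewrite opprK.
move=> t; have [d d0 Hd] := h3 (c - t); exists d => // r rt; apply: Hd.
by rewrite (_ : c - r - (c - t) = - (r - t)) ?normrN //; ring.
Qed.

End Symmetries.

Section Shorter.
Variables (R : realType) (n : nat) (alpha : 'I_n -> nat).
Notation pt := ('I_n.+1 -> R).

(** The energies are carried by [en], with no reference to time 0, so that shifts and reversals of
    time keep them. *)
Definition unit_solution (x p : R -> pt) (en : nat -> R) : Prop :=
  [/\ hamilton_solution alpha x p, en 0%N = 1, forall k, (k <= n)%N -> 0 < en k &
      forall t k, (k <= n)%N -> energy alpha (x t) (p t) k = en k].

Lemma unit_solution_shift x p en a : unit_solution x p en ->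
  unit_solution (fun t => x (t + a)) (fun t => p (t + a)) en.
Proof. by move=> [h1 h2 h3 h4]; split => // [|t k kn]; [exact: solution_shift|exact: h4]. Qed.

Lemma unit_solution_flip x p en c : unit_solution x p en ->
  unit_solution (fun t => x (c - t)) (fun t k => - p (c - t) k) en.
Proof.
by move=> [h1 h2 h3 h4]; split => // [|t k kn]; [exact: solution_flip|rewrite energyN; exact: h4].
Qed.

Lemma unit_arc x p en a b : unit_solution x p en -> a < b -> chain alpha (x a) (x b) (b - a).
Proof.
move=> [h1 h2 h3 h4] ab; apply: chain1; apply: (c1arc_sol h1) => // t.
by rewrite h4.
Qed.

Variables (m : 'I_n) (A : R) (en : nat -> R).
Hypotheses (am0 : (0 < alpha m)%N) (A0 : 0 < A) (eA : en m.+1 * A ^+ (2 * alpha m) = en m).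
Let w := Num.sqrt (en m) / A.

Lemma shorter_dec x p S T : unit_solution x p en ->
  is_clock S (fun t => seg alpha (x t) 0 m ^+ 2) -> 0 < T -> pi_a R (alpha m) < w * (S T - S 0) ->
  x 0 (wid m) * p 0 (wid m) < 0 -> exists2 L, L < T & chain alpha (x 0) (x T) L.
Proof.
move=> U HS T0 hT zq; have [h1 h2 h3 h4] := U.
have E0 t : energy alpha (x t) (p t) 0 = 1 by rewrite h4.
have Epos k : (k <= n)%N -> 0 < energy alpha (x 0) (p 0) k by move=> kn; rewrite h4 // h3.
have [sg Hsg] := seg_clock h1 Epos (ltn_ord m).
have mn : (m <= n)%N by exact: ltnW.
have eA' : energy alpha (x 0) (p 0) m.+1 * A ^+ (2 * alpha m) = energy alpha (x 0) (p 0) m.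
  by rewrite !h4.
have hT' : pi_a R (alpha m) < Num.sqrt (energy alpha (x 0) (p 0) m) / A * (S T - S 0) by rewrite h4.
have [b [y [L1 [L2 [/andP[b0 bT] c1 c2 hL]]]]] := competitor_dec h1 E0 Epos am0 A0 eA' HS Hsg T0 hT' zq.
have c := chain_cat (chain1 c1) (chain1 c2).
move: bT; rewrite le_eqVlt => /predU1P[<-|bT]; first by exists (L1 + L2).
exists (L1 + L2 + (T - b)); first by rewrite -ltrBrDr (_ : T - (T - b) = b) //; ring.
exact: chain_cat c (unit_arc U bT).
Qed.

Lemma shorter x p S T : unit_solution x p en ->
  is_clock S (fun t => seg alpha (x t) 0 m ^+ 2) -> 0 < T -> pi_a R (alpha m) < w * (S T - S 0) ->
  x 0 (wid m) != 0 -> exists2 L, L < T & chain alpha (x 0) (x T) L.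
Proof.
move=> U HS T0 hT z0; have [h1 h2 h3 h4] := U.
have E0 t : energy alpha (x t) (p t) 0 = 1 by rewrite h4.
have Epos k : (k <= n)%N -> 0 < energy alpha (x 0) (p 0) k by move=> kn; rewrite h4 // h3.
have mn : (m <= n)%N by exact: ltnW.
have w0 : 0 < w by rewrite divr_gt0 // sqrtr_gt0 h3.
pose hp := pi_a R (alpha m) / w.
have hpw : w * hp = pi_a R (alpha m) by rewrite /hp mulrC divfK // gt_eqF.
have hpT : 0 < S T - S 0 - hp by rewrite subr_gt0 -(ltr_pM2l w0) hpw.
have hp0 : 0 < hp by rewrite divr_gt0 // pi_a_gt0.
have cS : {for 0, continuous S} := clock_continuous HS.
have /continuous_epsP/(_ _ hpT)[dS dS0 HdS] := cS.
have SdS a : 0 < a -> a < dS -> hp < S T - S a.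
  move=> a0 ad; have := HdS a; rewrite subr0 gtr0_norm // => /(_ ad).
  have : S 0 < S a by rewrite (clock_ltE _ _ HS).
  by move=> h; rewrite gtr0_norm ?subr_gt0 //; clear; lra.
have aT a : 0 < a -> a < dS -> a < T.
  by move=> a0 ad; rewrite -(clock_ltE _ _ HS) -subr_gt0; apply: lt_trans hp0 (SdS _ a0 ad).
have [zq|zq|zq] := ltgtP (x 0 (wid m) * p 0 (wid m)) 0.
- exact: shorter_dec U HS T0 hT zq.
- have cz : {for 0, continuous (fun t => x t (wid m) * p t (wid m))}.
    by apply: continuousM; [exact: continuous_x h1 _ _|exact: continuous_p h1 _ _].
  have [d d0 Hd] := continuous_sign cz (lt0r_neq0 zq).
  pose a := Num.min (d / 2) (dS / 2).
  have [a0 ad adS] : [/\ 0 < a, a < d & a < dS].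
    by rewrite /a lt_min !gt_min !divr_gt0 // !ltr_pdivrMr // !ltr_pMr // ltr1n orbT.
  have zqa : 0 < x a (wid m) * p a (wid m).
    by have := Hd a; rewrite subr0 gtr0_norm // => /(_ ad); rewrite pmulr_lgt0.
  have Sa : S a <= S a + hp <= S T.
    by have := SdS _ a0 adS => h; apply/andP; split; [rewrite lerDl ltW|rewrite -lerBrDl ltW].
  (* Half a period after [a]: since [a > 0], the stretch from [T'] back to 0 exceeds half a period,
     and since [a] is small, [T'] precedes [T]. At [T'] position and momentum have both changed
     sign, so in reversed time the coordinate approaches 0. *)
  pose T' := clock_inv S (S a + hp).
  have [/andP[aT' T'T] ST'] := clock_ivt HS Sa.
  have T'T' : T' < T.
    by rewrite -(clock_ltE _ _ HS) ST' -ltrBrDl; exact: SdS.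
  have T'0 : 0 < T' by exact: lt_le_trans a0 aT'.
  have qa0 : p a (wid m) != 0 by apply: contraTneq zqa => ->; rewrite mulr0 ltxx.
  have eA' : energy alpha (x 0) (p 0) m.+1 * A ^+ (2 * alpha m) = energy alpha (x 0) (p 0) m.
    by rewrite !h4.
  have hw : Num.sqrt (energy alpha (x 0) (p 0) m) / A * (S T' - S a) = pi_a R (alpha m).
    by rewrite h4 // ST' addrAC subrr add0r.
  have [zT qT] := antiperiod h1 Epos am0 A0 eA' HS qa0 hw.
  have := unit_solution_flip T' U; have := clock_flip T' HS.
  move=> HS' U'.
  have [L LT c] : exists2 L, L < T' & chain alpha (x (T' - 0)) (x (T' - T')) L.
    apply: (shorter_dec U' HS') => //.
      rewrite subrr subr0 opprK addrC ST' -hpw ltr_pM2l // addrAC ltrDr subr_gt0.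
      by rewrite (clock_ltE _ _ HS).
    rewrite subr0 zT mulrNN.
    have qa2 : 0 < p a (wid m) ^+ 2 by rewrite lt_def sqrf_eq0 qa0 sqr_ge0.
    rewrite -(pmulr_llt0 _ qa2).
    have -> : x a (wid m) * p T' (wid m) * p a (wid m) ^+ 2 =
      (x a (wid m) * p a (wid m)) * (p T' (wid m) * p a (wid m)) by ring.
    by rewrite pmulr_rlt0.
  rewrite subr0 subrr in c.
  exists (L + (T - T')); first by rewrite -ltrBrDr (_ : T - (T - T') = T') //; ring.
  exact: chain_cat (chain_rev c) (unit_arc U T'T').
- have q0 : p 0 (wid m) = 0.
    by move/eqP: zq; rewrite mulf_eq0 (negbTE z0) /= => /eqP.
  (* Up to the factor [xi_m ^ 2], the derivative of position times momentum; it is negative at a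
     turning point, so the product becomes negative right after. *)
  pose h t := p t (wid m) ^+ 2 - (alpha m)%:R * x t (wid m) ^+ (2 * alpha m) * en m.+1.
  have ch : {for 0, continuous h}.
    apply: continuousB.
      apply: (@continuous_comp _ _ _ (fun t => p t (wid m)) (fun y => y ^+ 2)).
        exact: continuous_p h1 _ _.
      exact: exprn_continuous.
    apply: continuousM; last exact: cvg_cst.
    apply: continuousM; first exact: cvg_cst.
    apply: (@continuous_comp _ _ _ (fun t => x t (wid m)) (fun y => y ^+ (2 * alpha m))).
      exact: continuous_x h1 _ _.
    exact: exprn_continuous.
  have h0 : h 0 < 0.
    rewrite /h q0 expr0n /= sub0r oppr_lt0 !mulr_gt0 ?ltr0n // ?h3 //.
    by rewrite exprM exprn_gt0 // lt_def sqrf_eq0 z0 sqr_ge0.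
  have [d d0 Hd] := continuous_sign ch (ltr0_neq0 h0).
  have [d' d'0 Hd'] := seg_isolated h1 Epos 0 mn.
  pose a := Num.min (d / 2) (Num.min (d' / 2) (dS / 2)).
  have [a0 ad [ad' adS]] : [/\ 0 < a, a < d & a < d' /\ a < dS].
    by rewrite /a !lt_min !gt_min !divr_gt0 // !ltr_pdivrMr // !ltr_pMr // ltr1n !orbT.
  have D (t : R) : is_derive t 1 (fun t => x t (wid m) * p t (wid m)) (seg alpha (x t) 0 m ^+ 2 * h t).
    apply: (is_derive_ext (is_derive_mul (sol_x h1 (wid m) t) (sol_p h1 m t))) => //.
    rewrite /h h4 //; have -> : (2 * alpha m)%N = (2 * alpha m).-1.+1 by rewrite prednK // muln_gt0.
    by rewrite (exprS (x t (wid m))) /=; ring.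
  have wc : {within `[0, a], continuous (fun t => x t (wid m) * p t (wid m))}.
    by apply: is_derive_within => t _; exact: D.
  have [c /andP[c0 ca]] := mvt a0 (fun t _ => D t) wc.
  rewrite q0 mulr0 !subr0 => zqa.
  have {}zqa : x a (wid m) * p a (wid m) < 0.
    have sc : seg alpha (x c) 0 m != 0.
      by apply: Hd'; rewrite subr0 gtr0_norm // c0 (lt_trans ca).
    have hc : h c < 0.
      by have := Hd c; rewrite subr0 gtr0_norm // => /(_ (lt_trans ca ad)); rewrite nmulr_lgt0.
    by rewrite zqa pmulr_llt0 // pmulr_rlt0 // lt_def sqrf_eq0 sc sqr_ge0.
  have U' := unit_solution_shift a U; have HS' := clock_shift a HS.
  have aT' := aT _ a0 adS.
  have [L LT c'] : exists2 L, L < T - a & chain alpha (x (0 + a)) (x (T - a + a)) L.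
    apply: (shorter_dec U' HS'); first by rewrite subr_gt0.
      by rewrite subrK add0r -hpw ltr_pM2l // SdS.
    by rewrite add0r.
  rewrite add0r subrK in c'.
  have := unit_arc U a0; rewrite subr0 => c1.
  exists (a + L); first by rewrite addrC -ltrBrDr.
  exact: chain_cat c1 c'.
Qed.

End Shorter.

(** * Initial energies, curve length and the cut time *)

Section InitialEnergies.
Variables (R : realType) (n : nat) (alpha : 'I_n -> nat).
Notation pt := ('I_n.+1 -> R).
Variables (x0 : pt) (phi : 'I_n -> R).
Hypothesis Hr : riemannian alpha x0.
Hypothesis Hphi : in_R0_alpha alpha phi.

Lemma atil_gt0 i : (0 < atil alpha i)%N.
Proof. by rewrite /atil; case: ifP => //; rewrite /inJ lt0n. Qed.

Lemma p0_wid k : p0 alpha x0 phi (wid k) =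
  cos_a (atil alpha k) (phi k) * \prod_(i < n | (i < k)%N) delta alpha x0 phi i.
Proof.
rewrite /p0; have -> : wid k = lift ord_max k by apply/val_inj; rewrite /= /bump leqNgt ltn_ord.
by rewrite liftK.
Qed.

Lemma p0_max : p0 alpha x0 phi ord_max = \prod_(i < n) delta alpha x0 phi i.
Proof. by rewrite /p0 unlift_none. Qed.

Lemma delta_sqr i : delta alpha x0 phi i ^+ 2 =
  (sin_a (atil alpha i) (phi i) / xtil alpha x0 i) ^+ (2 * atil alpha i).
Proof.
rewrite /delta /rho exprMn -exprM mulnC exprM real_normK ?num_real // -exprM -exprD.
congr (_ ^+ _); have := atil_gt0 i; case: (atil alpha i) => // a _.
by rewrite subn1 /= mulnS addnC.
Qed.

Lemma xtil_neq0 i : xtil alpha x0 i != 0.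
Proof. by rewrite /xtil; case: ifP => [/Hr//|_]; exact: oner_neq0. Qed.

Lemma delta_neq0 i : delta alpha x0 phi i != 0.
Proof.
rewrite -sqrf_eq0 delta_sqr expf_neq0 // mulf_neq0 ?invr_eq0 ?xtil_neq0 //.
by case: Hphi => _; exact.
Qed.

Lemma cos_sin i : cos_a (atil alpha i) (phi i) ^+ 2 + sin_a (atil alpha i) (phi i) ^+ (2 * atil alpha i) = 1.
Proof.
have [Hp Hs] := Hphi; rewrite cos_sqr_add_sin ?subrK //; first exact: atil_gt0.
have := Hp i; have p0 := pi_a_gt0 R (atil_gt0 i); case: ifP => // _ /andP[-> h] /=.
by apply: le_lt_trans h _; rewrite ltr_pMl // ltr1n.
Qed.

(** Outside [J] the factor from [x0] is 1, as are the modified exponent and base value, which yields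
    the same formula. *)
Lemma x0_delta i : x0 (wid i) ^+ (2 * alpha i) * delta alpha x0 phi i ^+ 2 =
  sin_a (atil alpha i) (phi i) ^+ (2 * atil alpha i).
Proof.
rewrite delta_sqr /xtil /atil; case: ifP => [iJ|/negbFE/eqP a0].
  by rewrite expr_div_n mulrC divfK // expf_neq0 // Hr.
by rewrite a0 muln0 expr0 mul1r divr1.
Qed.

Definition en0 k : R := \prod_(i < n | (i < k)%N) delta alpha x0 phi i ^+ 2.

Lemma en0_S (i : 'I_n) : en0 i.+1 = en0 i * delta alpha x0 phi i ^+ 2.
Proof.
rewrite /en0 (bigD1 i) //= mulrC; congr (_ * _); apply: eq_bigl => j.
by rewrite ltnS andbC -ltn_neqAle.
Qed.

Lemma en0_gt0 k : 0 < en0 k.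
Proof. by apply: prodr_gt0 => i _; rewrite lt_def sqrf_eq0 delta_neq0 sqr_ge0. Qed.

Lemma en0_0 : en0 0 = 1.
Proof. by rewrite /en0 big_pred0. Qed.

(** Downward induction: [cos_a ^ 2] is the kinetic share of [en0 k] and, by [x0_delta], the power of
    [sin_a] its potential share; [cos_sin] adds them up to 1. *)
Lemma energy_init k : (k <= n)%N -> energy alpha x0 (p0 alpha x0 phi) k = en0 k.
Proof.
elim: {k}(n - k)%N {-2}k (erefl (n - k)%N) => [|d IH] k dk kn.
  have -> : k = n by apply/eqP; rewrite eqn_leq kn -subn_eq0 dk.
  rewrite energy_max p0_max /en0 -prodrXl; apply: eq_bigl => i; exact: esym (ltn_ord i).
have kn' : (k < n)%N by rewrite -subn_gt0 dk.
pose i := Ordinal kn'.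
rewrite (@energyS _ _ _ _ _ i) (IH k.+1) //; last by rewrite subnS dk.
rewrite (en0_S i) p0_wid exprMn -prodrXl mulrCA -/(en0 k) [RHS]/=.
rewrite (mulrC _ (en0 k)) -mulrDr -[LHS]/(en0 k * (_ + _)).
by rewrite x0_delta cos_sin mulr1.
Qed.

(** Links [tau_j] to the oscillator: the right side is its frequency, with the amplitude of the next
    lemma. *)
Lemma omega_sqrt (i : 'I_n) : inJ alpha i ->
  `|omega alpha x0 phi i| = Num.sqrt (en0 i) / `|x0 (wid i) / sin_a (alpha i) (phi i)|.
Proof.
move=> iJ; have sn0 : sin_a (alpha i) (phi i) != 0.
  by have [_ /(_ i)] := Hphi; rewrite /atil iJ.
have xn0 := Hr iJ.
rewrite /en0 prodrXl sqrtr_sqr /omega normrM mulrC; congr (_ * _).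
by rewrite -normfV invf_div.
Qed.

Lemma amplitude (i : 'I_n) : inJ alpha i ->
  0 < `|x0 (wid i) / sin_a (alpha i) (phi i)| /\
  en0 i.+1 * `|x0 (wid i) / sin_a (alpha i) (phi i)| ^+ (2 * alpha i) = en0 i.
Proof.
move=> iJ; have sn0 : sin_a (alpha i) (phi i) != 0.
  by have [_ /(_ i)] := Hphi; rewrite /atil iJ.
have xn0 := Hr iJ; split.
  by rewrite normr_gt0 mulf_neq0 // invr_eq0.
rewrite en0_S -mulrA delta_sqr /atil /xtil iJ.
rewrite -normrX ger0_norm; last by rewrite exprM exprn_ge0 // sqr_ge0.
by rewrite -exprMn mulf_div (mulrC (x0 (wid i))) divff ?expr1n ?mulr1 // mulf_neq0.
Qed.

End InitialEnergies.

(** * The metric length of the geodesic *)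

Section CurveLength.
Variables (R : realType) (n : nat) (alpha : 'I_n -> nat).
Notation pt := ('I_n.+1 -> R).
Notation mu := (@lebesgue_measure R).
Local Notation dist := (@cc_dist R n alpha).

Lemma cc_dist_ge0 (y z : pt) : (0 <= dist y z)%E.
Proof.
apply: le_ereal_inf_tmp => _ [u _ <-]; rewrite lee_fin; apply: Rintegral_ge0 => t _.
exact: unorm_ge0.
Qed.

Lemma cc_distxx (y : pt) : (dist y y <= 0)%E.
Proof.
apply: chain_cc_dist; apply: chain1.
exists (cst y), (fun _ _ => 0), (cst 0), (cst 0), 0, 1; split => //.
- by rewrite subrr.
- by move=> t j _; split; [rewrite mul0r; exact: is_derive_cst|exact: cvg_cst].
- move=> t _; split; [exact: is_derive_cst|exact: cvg_cst|].
  by rewrite /unorm big1 ?sqrtr0 // => j _; rewrite expr0n.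
Qed.

Variables (x p : R -> pt) (en : nat -> R).
Hypothesis U : unit_solution alpha x p en.

Lemma cc_dist_le s t : s <= t -> (dist (x s) (x t) <= (t - s)%:E)%E.
Proof.
rewrite le_eqVlt => /predU1P[->|st]; first by rewrite subrr; exact: cc_distxx.
exact: chain_cc_dist (unit_arc U st).
Qed.

Local Notation cl t := (curve_length dist x 0 t).

Lemma curve_length_le t : (cl t <= t%:E)%E.
Proof.
apply: ge_ereal_sup => _ [k [s [s0 sk smono ->]]].
apply: (@le_trans _ _ (\sum_(i < k) (s i.+1 - s i)%:E)%E).
  by apply: lee_sum => i _; apply: cc_dist_le; exact: smono.
by rewrite sumEFin lee_fin -(big_mkord xpredT (fun i => s i.+1 - s i)) telescope_sumr // s0 sk subr0.
Qed.

Lemma curve_length_ge t : 0 <= t -> (dist (x 0) (x t) <= cl t)%E.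
Proof.
move=> t0; apply: ereal_sup_ubound; exists 1%N, (fun i => if i is 0%N then 0 else t); split => //.
  by case.
by rewrite big_ord1.
Qed.

(** Every partition up to [s] is extended by the single node [t]. *)
Lemma curve_length_add s t (c : R) : 0 <= s <= t -> (c%:E <= dist (x s) (x t))%E ->
  (cl s + c%:E <= cl t)%E.
Proof.
move=> /andP[s0 st] hc; rewrite -leeBrDr //; apply: ge_ereal_sup => _ [k [r [r0 rk rm ->]]].
rewrite leeBrDr //.
apply: (@le_trans _ _ (\sum_(i < k) dist (x (r i)) (x (r i.+1)) + dist (x s) (x t))%E).
  by rewrite leeD2l.
apply: ereal_sup_ubound; exists k.+1, (fun i => if (i <= k)%N then r i else t); split => //.
- by rewrite ltnn.
- move=> i; rewrite ltnS => ik; rewrite ik; have [ik'|ik'] := ltnP i k; first exact: rm.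
  by have -> : i = k by [apply/eqP; rewrite eqn_leq ik]; rewrite rk.
- rewrite big_ord_recr /= ltnn leqnn rk; congr (_ + _)%E.
  by apply: eq_bigr => i _; rewrite ltn_ord (ltnW (ltn_ord i)).
Qed.

Definition nonsingular t := seg alpha (x t) 0 n != 0.

(** A calibration around [x a] grows along the geodesic like the clock of level 0, which is time
    itself as [seg x 0 0 = 1], and at unit rate as the total energy is 1. *)
Lemma local_lower a : nonsingular a -> exists2 d : R, 0 < d &
  forall s t, `|s - a| < d -> `|t - a| < d -> s <= t -> ((t - s)%:E <= dist (x s) (x t))%E.
Proof.
move=> na; have U' := unit_solution_shift a U; have [H1 H2 H3 H4] := U'.
have Epos k : (k <= n)%N -> 0 < energy alpha (x (0 + a)) (p (0 + a)) k by move=> kn; rewrite H4 // H3.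
have Riem (i : 'I_n) : x (0 + a) (wid i) ^+ alpha i != 0.
  by move/prodf_neq0: na => /(_ i); rewrite add0r /= ltn_ord; exact.
have [clk Hclk] : exists clk : nat -> R -> R, forall k, (k <= n)%N ->
    is_clock (clk k) (fun t => seg alpha (x (t + a)) 0 k ^+ 2).
  (* The bound [k <= n] is moved inside, with [id] as a dummy beyond it, so that [choice]
     applies. *)
  have Hk k : exists S : R -> R, (k <= n)%N -> is_clock S (fun t => seg alpha (x (t + a)) 0 k ^+ 2).
    case: (leqP k n) => kn; last by exists id.
    by have [S HS] := seg_clock H1 Epos kn; exists S.
  by have [clk Hclk] := choice Hk; exists clk.
have [S [G [r [e [r0 e0 HS Sx]]]]] := calibrate0 H1 Epos Riem Hclk.
have clk0 t : clk 0%N t - clk 0%N 0 = t.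
  have D (u : R) : is_derive u 1 (fun u => clk 0%N u - u) 0.
    have [Dc _] := Hclk _ (leq0n n).
    apply: (is_derive_ext (is_derive_sub (Dc u) (is_derive_id u 1))) => //.
    by rewrite segkk expr1n subrr.
  have := is_derive_cst0 D t 0; rewrite /= subr0; lra.
have HS' y : l1 y (x (0 + a)) < r -> diffat S (G y) y /\ \sum_(k < n.+1) xi alpha y k ^+ 2 * G y k ^+ 2 <= 1.
  by move=> /HS[h1 _ h2]; split => //; rewrite segkk expr1n in h2.
have [d1 d10 Hd1] := cc_dist_calibrated r0 HS'.
have cl1 : {for 0, continuous (fun t => l1 (x (t + a)) (x (0 + a)))}.
  rewrite (_ : (fun t => _) = \sum_(k < n.+1) (fun t => `|x (t + a) k - x (0 + a) k|)); last first.
    by apply/funext => s; rewrite fct_sumE.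
  elim/big_ind: _ => [|f g|k _].
  - exact: cvg_cst.
  - by move=> cf cg; apply: continuousD.
  - apply: (@continuous_comp _ _ _ (fun t => x (t + a) k - x (0 + a) k) Num.norm); last exact: norm_continuous.
    by apply: continuousB; [exact: continuous_x H1 _ _|exact: cvg_cst].
have /continuous_epsP/(_ _ d10)[d2 d20 Hd2] := cl1.
exists (Num.min e (Num.min (d1 / 2) d2)); first by rewrite !lt_min e0 d20 divr_gt0.
move=> s t; rewrite !lt_min => /and3P[s1 s2 s3] /and3P[t1 t2 t3] st.
have -> : x s = x (s - a + a) by rewrite subrK.
have -> : x t = x (t - a + a) by rewrite subrK.
apply: Hd1.
- have := Hd2 (s - a); rewrite subr0 l1xx subr0 => /(_ s3); rewrite ger0_norm //; exact: l1_ge0.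
- have := ler_distD a t s; rewrite (distrC a s) (ger0_norm (_ : 0 <= t - s)) ?subr_ge0 //.
  by move: s2 t2; lra.
- rewrite (Sx _ s1) (Sx _ t1) !H4 // H2 sqrtr1 !mul1r !clk0 le_eqVlt; apply/orP; left; apply/eqP.
  by ring.
Qed.

Lemma curve_length_fin t : 0 <= t -> cl t = (fine (cl t))%:E.
Proof.
move=> t0; rewrite fineK // ge0_fin_numE.
  exact: le_lt_trans (curve_length_le t) (ltry _).
exact: le_trans (cc_dist_ge0 _ _) (curve_length_ge t0).
Qed.

Lemma fine_add s t (c : R) : 0 <= s <= t -> (c%:E <= dist (x s) (x t))%E ->
  fine (cl s) + c <= fine (cl t).
Proof.
move=> /andP[s0 st] hc; have := @curve_length_add s t c; rewrite s0 st => /(_ isT hc).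
by rewrite (curve_length_fin s0) (curve_length_fin (le_trans s0 st)) -EFinD lee_fin.
Qed.

Lemma fine_mono s t : 0 <= s <= t -> fine (cl s) <= fine (cl t).
Proof. by move=> st; have := fine_add st (cc_dist_ge0 _ _); rewrite addr0. Qed.

Lemma curve_length_nonsingular a b : 0 <= a -> a <= b -> (forall t, a <= t <= b -> nonsingular t) ->
  fine (cl a) + (b - a) <= fine (cl b).
Proof.
move=> a0 ab Hns.
apply: (@real_induction _ (fun t => fine (cl a) + (t - a) <= fine (cl t)) a b); last by rewrite ab lexx.
- by rewrite subrr addr0.
- move=> t /andP[at' tb] IH.
  have {}IH : fine (cl a) + (t - a) <= fine (cl t) by apply: IH; rewrite at' lexx.
  have [d d0 Hd] := local_lower (Hns t ltac:(by rewrite at' ltW)).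
  exists d => // s /andP[ts std] sb.
  have h : fine (cl t) + (s - t) <= fine (cl s).
    apply: fine_add; first by rewrite (le_trans a0 at') ltW.
    apply: Hd; rewrite ?subrr ?normr0 ?gtr0_norm ?subr_gt0 ?ltrBlDl //; exact: ltW.
  by move: IH h; move: (fine _) (fine _) (fine _) => u v w; lra.
- move=> t /andP[at' tb] IH.
  have [d d0 Hd] := local_lower (Hns t ltac:(by rewrite tb ltW)).
  pose s := Num.max a (t - d / 2).
  have [as' sd st] : [/\ a <= s, t - d / 2 <= s & s < t].
    by rewrite /s !le_max !lexx orbT gt_max at' gtrBl divr_gt0.
  have {}IH : fine (cl a) + (s - a) <= fine (cl s) by apply: IH; rewrite as' st.
  have h : fine (cl s) + (t - s) <= fine (cl t).
    apply: fine_add; first by rewrite (le_trans a0 as') ltW.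
    apply: Hd; rewrite ?subrr ?normr0 //; last exact: ltW.
    by rewrite ltr0_norm ?subr_lt0 //; lra.
  by move: IH h; move: (fine _) (fine _) (fine _) => u v w; lra.
Qed.

(** Singular times have no calibration but are isolated. After such a time the nonsingular estimate
    starts up to [e] later, and monotonicity of the length makes the loss at most [e]; monotonicity
    also handles limits from the left. *)
Lemma curve_length_ge_time T : 0 <= T -> (T%:E <= cl T)%E.
Proof.
move=> T0; rewrite (curve_length_fin T0) lee_fin.
have [H1 H2 H3 H4] := U.
have Epos k : (k <= n)%N -> 0 < energy alpha (x 0) (p 0) k by move=> kn; rewrite H4 // H3.
apply: (@real_induction _ (fun t => t <= fine (cl t)) 0 T); last by rewrite T0 lexx.
- by apply: fine_ge0; exact: le_trans (cc_dist_ge0 _ _) (curve_length_ge (lexx 0)).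
- move=> t /andP[t0 tT] IH.
  have {}IH : t <= fine (cl t) by apply: IH; rewrite t0 lexx.
  have [d d0 Hd] := seg_isolated H1 Epos t (leqnn n).
  exists d => // s /andP[ts std] sT.
  apply/ler_addgt0Pr => e e0.
  pose r := Num.min s (t + e).
  have [tr rs re] : [/\ t < r, r <= s & r <= t + e].
    by rewrite /r lt_min ts ltrDl e0 !ge_min !lexx orbT.
  have h1 : fine (cl r) + (s - r) <= fine (cl s).
    apply: curve_length_nonsingular => //; first exact: le_trans t0 (ltW tr).
    move=> v /andP[rv vs]; apply: Hd; have tv := lt_le_trans tr rv.
    by rewrite gtr0_norm ?subr_gt0 // tv ltrBlDl (le_lt_trans vs).
  have h2 : fine (cl t) <= fine (cl r) by apply: fine_mono; rewrite t0 ltW.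
  by move: IH h1 h2 re; move: (fine _) (fine _) (fine _) => u v w; clear; lra.
- move=> t /andP[t0 tT] IH; apply/ler_addgt0Pr => e e0.
  pose s := Num.max 0 (t - e).
  have [s0 se st] : [/\ 0 <= s, t - e <= s & s < t].
    by rewrite /s !le_max !lexx orbT gt_max t0 gtrBl e0.
  have h1 : s <= fine (cl s) by apply: IH; rewrite s0 st.
  have h2 : fine (cl s) <= fine (cl t) by apply: fine_mono; rewrite s0 ltW.
  by rewrite -lerBlDr; apply: le_trans se (le_trans h1 h2).
Qed.

End CurveLength.

Theorem mainTheorem5 (R : realType) (n : nat) (hn : (0 < n)%N)
  (alpha : 'I_n -> nat) (x0 : 'I_n.+1 -> R) (phi : 'I_n -> R)
  (x p : R -> 'I_n.+1 -> R) :
  riemannian alpha x0 ->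
  in_R0_alpha alpha phi ->
  hamilton_solution alpha x p ->
  x 0 = x0 ->
  p 0 = p0 alpha x0 phi ->
  (0 <= t_cut alpha x)%E /\ (t_cut alpha x <= tau alpha x0 phi x)%E.
Proof.
move=> Hr Hphi H x0E p0E.
have U : unit_solution alpha x p (en0 alpha x0 phi).
  split => //; first exact: en0_0.
    by move=> k kn; exact: en0_gt0.
  by move=> t k kn; rewrite (energy_cst H t 0) // x0E p0E energy_init.
have Epos k : (k <= n)%N -> 0 < energy alpha (x 0) (p 0) k.
  by move=> kn; have [_ _ h1 h2] := U; rewrite h2 // h1.
split.
  (* A supremum over the empty set would be [-oo], so a positive minimizing time has to be
     exhibited. *)
  have ns0 : nonsingular alpha x 0.
    apply: seg_neq0 => i _; rewrite x0E; have [iJ|/negPn/eqP ->] := boolP (inJ alpha i).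
      by rewrite expf_neq0 // Hr.
    by rewrite expr0 oner_neq0.
  have [d d0 Hd] := local_lower U ns0.
  have d20 : 0 < d / 2 by rewrite divr_gt0.
  apply: (@le_trans _ _ (d / 2)%:E); first by rewrite lee_fin ltW.
  apply: ereal_sup_ubound; exists (d / 2) => //; split => //.
  apply/eqP; rewrite eq_le; apply/andP; split; last exact: curve_length_ge (ltW d20).
  apply: le_trans (curve_length_le U _) _.
  have := Hd 0 (d / 2); rewrite !subr0 normr0 gtr0_norm // => /(_ d0); apply.
    by rewrite ltr_pdivrMr // ltr_pMr // ltr1n.
  exact: ltW.
(* Each minimizing [T] is compared with each [t] in the sets defining the [tau_j]; an empty set has
   infimum [+oo] and asks for nothing. *)
apply: ge_ereal_sup => _ [T [T0 HT] <-].
apply: le_ereal_inf_tmp => _ [j jJ <-].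
apply: le_ereal_inf_tmp => _ [t [t0 ht] <-].
rewrite lee_fin leNgt; apply/negP => tT.
have jn : (j <= n)%N by exact: ltnW.
have [S HS] := seg_clock H Epos jn.
have [A0 eA] := amplitude Hr Hphi jJ.
have aj : (0 < alpha j)%N by rewrite lt0n.
have om := omega_sqrt Hr Hphi jJ.
have hS : Rintegral (@lebesgue_measure R) `[0, t] (fun s => xi alpha (x s) (wid j) ^+ 2) = S t - S 0.
  have [DS _] := HS.
  apply: Rintegral_FTC2 => [|s _]; first exact: ltW.
  apply: (@continuous_comp _ _ _ (fun s => seg alpha (x s) 0 j) (fun y => y ^+ 2)).
    exact: continuous_seg H _ _ _.
  exact: exprn_continuous.
have phase : pi_a R (alpha j) < Num.sqrt (en0 alpha x0 phi j) / `|x0 (wid j) / sin_a (alpha j) (phi j)| * (S T - S 0).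
  rewrite -ht om hS ltr_pM2l; first by rewrite ltrD2r (clock_ltE _ _ HS).
  by rewrite divr_gt0 // sqrtr_gt0; exact: en0_gt0.
have z0 : x 0 (wid j) != 0 by rewrite x0E; exact: Hr.
have [L LT c] := shorter aj A0 eA U HS T0 phase z0.
have := curve_length_ge_time U (ltW T0).
rewrite HT => h; have := le_trans h (chain_cc_dist c).
by rewrite lee_fin leNgt LT.
Qed.
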